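(* Let $A$ be a Brauer graph algebra over an algebraically closed field $K$. Then $A$ is isomorphic to the idempotent algebra $eBe$ of a biserial weighted surface algebra $B=B(S,\vec{T},m_\bullet)$, for a surface $S$ without boundary, a triangulation $T$ of $S$ without self-folded triangles (with an orientation $\vec{T}$ of its triangles), and an idempotent $e$ of $B$.
   Context: Algebras are associative, unital, finite-dimensional over $K$. Paths in a quiver $Q=(Q_0,Q_1,s,t)$ are composed from left to right: $\alpha\beta$ is a path if $t(\alpha)=s(\beta)$. A quiver is 2-regular if every vertex is the source of exactly two arrows and the target of exactly two arrows; for an arrow $\alpha$ of a 2-regular quiver, $\bar\alpha$ denotes the other arrow with the same source. Brauer graph algebras. A Brauer graph $\Gamma$ is a finite connected graph with at least one edge (loops and multiple edges allowed) such that for each vertex $v$ there is a cyclic ordering of the edges adjacent to $v$ (a loop at $v$ occurs twice in it), and a multiplicity $e(v)\in\mathbb{N}^*=\{1,2,\dots\}$. The quiver $Q_\Gamma$ has the edges of $\Gamma$ as vertices, and an arrow $i\to j$, attached to $v$, whenever $j$ is the consecutive edge of (an occurrence of) $i$ in the cyclic ordering around $v$ (an edge that is the only one around $v$ is its own successor). $Q_\Gamma$ is 2-regular. The cyclic orderings yield a permutation of the arrows of $Q_\Gamma$ whose cycles correspond to the vertices of $\Gamma$, each arrow being followed by the next arrow around the same vertex; $v(\alpha)$ is the vertex to which $\alpha$ is attached, and $C_\alpha$ is the product of the arrows of the cycle containing $\alpha$, in order, starting with $\alpha$. Then $B_\Gamma=KQ_\Gamma/I_\Gamma$, where $I_\Gamma$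 is generated by (1) all paths $\alpha\beta$ of length 2 such that $\beta$ is not the successor of $\alpha$ in its cycle, (2) $C_\alpha^{e(v(\alpha))}-C_{\bar\alpha}^{e(v(\bar\alpha))}$ for all arrows $\alpha$. A Brauer graph algebra is an algebra isomorphic to some $B_\Gamma$. Triangulated surfaces. A surface is a connected compact 2-dimensional real manifold $S$, orientable or not, with or without boundary. A triangulation $T$ of $S$ is given by a finite 2-dimensional cell structure on $S$ in which the boundary of each 2-cell is attached to a union of $k\in\{2,3\}$ 1-cells and $m\in\{1,2,3\}$ 0-cells; closures of 2-cells are called triangles and closures of 1-cells edges; at least two different edges are required. Each triangle has either three pairwise different edges $a,b,c$, or is self-folded, i.e. its sides are $a,a,b$ with $a\neq b$ (a disc bounded by $b$ with $a$ joining a boundary point to an interior point; $a$ is the self-folded edge). Every edge is an edge of exactly two triangles, or is the self-folded edge of a triangle, or lies on the boundary of $S$. An orientation $\vec{T}$ is an arbitrary choice, for each triangle with three different edges, of a cyclic order $(abc)$ or $(cba)$ of its edges, and $(aab)$ for each self-folded triangle. The quiver $Q(S,\vec{T})$ has the edges of $T$ as vertices, and a permutation $f$ of its arrows, defined as follows: each oriented triangle $(abc)$ with different edges gives arrows $\alpha:a\to b$, $\beta:b\to c$, $\gamma:c\to a$ with $f(\alpha)=\beta$, $f(\beta)=\gamma$, $f(\gamma)=\alpha$; each self-folded triangle $(aab)$ gives a loop $\alpha$ at $a$ and arrows $\beta:a\to b$, $\gamma:b\to a$ with $f(\alpha)=\beta$, $f(\beta)=\gamma$, $f(\gamma)=\alpha$;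 each boundary edge $a$ gives a loop $\alpha$ at $a$ with $f(\alpha)=\alpha$. The quiver $Q(S,\vec{T})$ is 2-regular and $s(f(\alpha))=t(\alpha)$ for all arrows. Biserial weighted surface algebras. Let $Q=Q(S,\vec{T})$, let $g$ be the permutation of $Q_1$ given by $g(\alpha)=\overline{f(\alpha)}$, let $\mathcal{O}(\alpha)$ be the $g$-orbit of $\alpha$, $n_\alpha=|\mathcal{O}(\alpha)|$, and let $\mathcal{O}(g)$ be the set of $g$-orbits. A weight function is a map $m_\bullet:\mathcal{O}(g)\to\mathbb{N}^*$; write $m_\alpha=m_{\mathcal{O}(\alpha)}$ and $B_\alpha=(\alpha g(\alpha)\cdots g^{n_\alpha-1}(\alpha))^{m_\alpha}$. The biserial weighted surface algebra $B(S,\vec{T},m_\bullet)$ is $KQ/J$, where $J$ is the ideal generated by all $\alpha f(\alpha)$ and all $B_\alpha-B_{\bar\alpha}$, $\alpha\in Q_1$. *)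

(* Defs.v *)
From HB Require Import structures.
From mathcomp Require Import all_boot all_order all_algebra all_fingroup.
From mathcomp Require Import all_classical all_reals topology normedtype.
From mathcomp Require Import finmap.
From mathcomp Require Import generic_quotient ring_quotient.
(* The notations of monalg clash with those of the analysis libraries. *)
From mathcomp Require Import -(notations) monalg.

Set Implicit Arguments.
Unset Strict Implicit.
Unset Printing Implicit Defensive.

Import Order.TTheory GRing.Theory Num.Theory.
Import numFieldNormedType.Exports.

Local Open Scope classical_set_scope.
Local Open Scope ring_scope.

(* The vertex set is nonempty because the algebras of the library ([algType])
   are nonzero. *)
Record quiver := Quiver {
  vertex : finType;
  arrow : finType;
  src : arrow -> vertex;
  tgt : arrow -> vertex;
  vertex_gt0 : (0 < #|vertex|)%N }.

Arguments src {q}.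
Arguments tgt {q}.

(* The other arrow with the same source; meaningful when exactly two arrows
   start at [src a]. *)
Definition bar (Q : quiver) (a : arrow Q) : arrow Q :=
  odflt a [pick b | (src b == src a) && (b != a)].

Fixpoint walk (Q : quiver) (x : vertex Q) (s : seq (arrow Q)) : bool :=
  if s is a :: s' then (src a == x) && walk (tgt a) s' else true.

Definition walk_end (Q : quiver) (x : vertex Q) (s : seq (arrow Q)) : vertex Q :=
  last x (map tgt s).

(* A path is its first vertex [x] together with its sequence of arrows; the
   empty sequence gives the path of length 0 at [x]. *)
Definition qpath (Q : quiver) : predArgType :=
  {xs : vertex Q * seq (arrow Q) | walk xs.1 xs.2}.

HB.instance Definition _ Q := [isSub of qpath Q for @sval _ _].
HB.instance Definition _ Q := [Choice of qpath Q by <:].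

Definition path_src Q (p : qpath Q) := (val p).1.
Definition path_arrows Q (p : qpath Q) := (val p).2.
Definition path_tgt Q (p : qpath Q) := walk_end (path_src p) (path_arrows p).

(* The vector space of finitely supported functions [qpath Q -> K]. *)
Definition path_algebra (K : fieldType) (Q : quiver) : Type :=
  monalg.malg (qpath Q) K.

HB.instance Definition _ (K : fieldType) Q :=
  GRing.Lmodule.on (path_algebra K Q).

(* Locked: unification otherwise unfolds finitely supported functions. *)
HB.lock Definition basis_path (K : fieldType) (Q : quiver) (p : qpath Q) :
  path_algebra K Q := monalg.mkmalgU p 1.

Section PathAlgebra.
Variables (K : fieldType) (Q : quiver).
Local Notation KQ := (path_algebra K Q).
Local Notation basis_path := (@basis_path K Q).
Implicit Types (p q r : qpath Q) (x y z : KQ).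

Definition coef (p : qpath Q) (x : KQ) : K := monalg.mcoeff p x.

(* The path from [v] with arrows [s], or 0 if there is no such path. *)
Definition path_elt (v : vertex Q) (s : seq (arrow Q)) : KQ :=
  if insub (v, s) is Some p then basis_path p else 0.

Definition mul_path (p q : qpath Q) : KQ :=
  if path_tgt p == path_src q
  then path_elt (path_src p) (path_arrows p ++ path_arrows q) else 0.

Definition path_mul (x y : KQ) : KQ :=
  \sum_(p <- monalg.msupp x) \sum_(q <- monalg.msupp y)
    (coef p x * coef q y) *: mul_path p q.

Definition path_one : KQ := \sum_(v : vertex Q) path_elt v [::].

Definition lin_ext (V : lmodType K) (f : qpath Q -> V) (x : KQ) : V :=
  \sum_(p <- monalg.msupp x) coef p x *: f p.

Lemma lin_extEw (V : lmodType K) (f : qpath Q -> V) (d : {fset qpath Q}) x :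
  (monalg.msupp x `<=` d)%fset -> lin_ext f x = \sum_(p <- d) coef p x *: f p.
Proof.
move=> xd; rewrite /lin_ext (big_fset_incl _ xd) //= => p _.
by rewrite -monalg.mcoeff_eq0 /coef => /eqP ->; rewrite scale0r.
Qed.

Lemma lin_ext_linear (V : lmodType K) (f : qpath Q -> V) : linear (lin_ext f).
Proof.
move=> k x y.
pose d := (monalg.msupp x `|` monalg.msupp y)%fset.
have dx : (monalg.msupp x `<=` d)%fset by apply: fsubsetUl.
have dy : (monalg.msupp y `<=` d)%fset by apply: fsubsetUr.
have dxy : (monalg.msupp (k *: x + y) `<=` d)%fset.
  apply: fsubset_trans (monalg.msuppD_le _ _) _.
  by apply: fsetSU; apply: monalg.msuppZ_le.
rewrite (lin_extEw f dxy) (lin_extEw f dx) (lin_extEw f dy).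
rewrite scaler_sumr -big_split /=; apply: eq_bigr => p _.
by rewrite /coef monalg.mcoeffD monalg.mcoeffZ scalerDl scalerA.
Qed.

HB.instance Definition _ (V : lmodType K) (f : qpath Q -> V) :=
  GRing.isLinear.Build K KQ V *:%R (lin_ext f) (lin_ext_linear f).

Lemma lin_ext_basis (V : lmodType K) (f : qpath Q -> V) p :
  lin_ext f (basis_path p) = f p.
Proof.
rewrite basis_path.unlock (@lin_extEw _ f [fset p]%fset) ?monalg.msuppU_le //.
by rewrite big_seq_fset1 /coef monalg.mcoeffUU scale1r.
Qed.

Lemma lin_ext_id x : lin_ext basis_path x = x.
Proof.
rewrite [RHS]monalg.monalgE; apply: eq_bigr => p _; apply/monalg.malgP => k.
by rewrite monalg.mcoeffZ basis_path.unlock [in LHS]monalg.mcoeffU [RHS]monalg.mcoeffU mulr_natr.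
Qed.

Lemma lin_ext_eq (V : lmodType K) (f : {linear KQ -> V}) x :
  f x = lin_ext (f \o basis_path) x.
Proof.
rewrite -{1}(lin_ext_id x) /lin_ext linear_sum /=.
by apply: eq_bigr => p _; rewrite linearZ.
Qed.

Lemma basis_ext (V : lmodType K) (f g : {linear KQ -> V}) :
  (forall p, f (basis_path p) = g (basis_path p)) -> f =1 g.
Proof.
move=> fg x; rewrite (lin_ext_eq f) (lin_ext_eq g).
by apply: eq_bigr => p _ /=; rewrite fg.
Qed.

Lemma path_mulE x y : path_mul x y = lin_ext (fun p => lin_ext (mul_path p) y) x.
Proof.
rewrite /path_mul /lin_ext; apply: eq_bigr => p _.
by rewrite scaler_sumr; apply: eq_bigr => q _; rewrite scalerA.
Qed.

Lemma path_mul_linear_l y : linear (path_mul^~ y).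
Proof. by move=> k u v; rewrite !path_mulE linearP. Qed.

Lemma path_mul_linear_r x : linear (path_mul x).
Proof.
move=> k u v; rewrite !path_mulE /lin_ext scaler_sumr -big_split /=.
apply: eq_bigr => p _.
by rewrite -!/(lin_ext (mul_path p) _) linearP scalerDr !scalerA mulrC.
Qed.

Definition path_mull y x := path_mul x y.
Definition path_mulr x y := path_mul x y.

HB.instance Definition _ y :=
  GRing.isLinear.Build K KQ KQ *:%R (path_mull y) (path_mul_linear_l y).
HB.instance Definition _ x :=
  GRing.isLinear.Build K KQ KQ *:%R (path_mulr x) (path_mul_linear_r x).

Lemma path_mul_basis p q : path_mul (basis_path p) (basis_path q) = mul_path p q.
Proof. by rewrite path_mulE !lin_ext_basis. Qed.

Lemma walk_cat (v : vertex Q) s t :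
  walk v (s ++ t) = walk v s && walk (walk_end v s) t.
Proof. by elim: s v => //= a s IH v; rewrite IH andbA. Qed.

Lemma walk_end_cat (v : vertex Q) s t :
  walk_end v (s ++ t) = walk_end (walk_end v s) t.
Proof. by rewrite /walk_end map_cat last_cat. Qed.

Lemma pathP (p : qpath Q) : walk (path_src p) (path_arrows p).
Proof. exact: (valP p). Qed.

Lemma path_elt_val p : path_elt (path_src p) (path_arrows p) = basis_path p.
Proof.
rewrite /path_elt /path_src /path_arrows.
by rewrite -surjective_pairing valK.
Qed.

Variant mul_path_spec p q : KQ -> Prop :=
  | MulPathSome r of path_tgt p = path_src q & path_src r = path_src p
      & path_arrows r = path_arrows p ++ path_arrows q
      & path_tgt r = path_tgt q : mul_path_spec p q (basis_path r)
  | MulPathNone of path_tgt p != path_src q : mul_path_spec p q 0.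

Lemma mul_pathP p q : mul_path_spec p q (mul_path p q).
Proof.
rewrite /mul_path; case: eqP => [pq | /eqP]; last by constructor.
rewrite /path_elt; case: insubP => [r _ rE | ].
  have [r1 r2] : path_src r = path_src p /\
      path_arrows r = path_arrows p ++ path_arrows q.
    by rewrite /path_src /path_arrows rE.
  apply: MulPathSome => //.
  by rewrite /path_tgt r1 r2 walk_end_cat -/(path_tgt p) pq.
by rewrite /= walk_cat pathP /= -/(path_tgt p) pq pathP.
Qed.

Lemma qpath_eq p q :
  path_src p = path_src q -> path_arrows p = path_arrows q -> p = q.
Proof.
case: p q => [[v s] h] [[w t] h']; rewrite /path_src /path_arrows /= => vw st.
by apply: val_inj; rewrite /= vw st.
Qed.

Lemma path_mul0l y : path_mul 0 y = 0.
Proof. exact: (linear0 (path_mull y)). Qed.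

Lemma path_mul0r x : path_mul x 0 = 0.
Proof. exact: (linear0 (path_mulr x)). Qed.

Lemma path_mulA : associative path_mul.
Proof.
move=> x y z.
apply: (basis_ext (f := path_mull (path_mul y z))
                  (g := path_mull z \o path_mull y) _ x) => p.
apply: (basis_ext (f := path_mulr (basis_path p) \o path_mull z)
                  (g := path_mull z \o path_mulr (basis_path p)) _ y) => q.
apply: (basis_ext (f := path_mulr (basis_path p) \o path_mulr (basis_path q))
          (g := path_mulr (path_mulr (basis_path p) (basis_path q))) _ z) => r.
rewrite /= /path_mull /path_mulr (path_mul_basis q r) (path_mul_basis p q).
case: (mul_pathP q r) => [u qr u1 u2 u3 | qr];
    case: (mul_pathP p q) => [w pq w1 w2 w3 | pq].
- rewrite (path_mul_basis p u) (path_mul_basis w r).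
  case: (mul_pathP p u) => [s _ s1 s2 _ | ]; last by rewrite u1 pq eqxx.
  case: (mul_pathP w r) => [t _ t1 t2 _ | ]; last by rewrite w3 qr eqxx.
  congr basis_path; apply: qpath_eq; first by rewrite s1 t1 w1.
  by rewrite s2 t2 u2 w2 catA.
- rewrite (path_mul_basis p u) path_mul0l.
  by case: mul_pathP => // s; rewrite u1 => /eqP; rewrite (negPf pq).
- rewrite (path_mul_basis w r) path_mul0r.
  by case: mul_pathP => // s; rewrite w3 => /eqP; rewrite (negPf qr).
- by rewrite path_mul0l path_mul0r.
Qed.

Lemma mul_vertex_l (v : vertex Q) p :
  path_mul (path_elt v [::]) (basis_path p) =
  (if v == path_src p then basis_path p else 0).
Proof.
rewrite /path_elt; case: insubP => [e _ eE | ] //.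
have [e1 e2] : path_src e = v /\ path_arrows e = [::].
  by rewrite /path_src /path_arrows eE.
have e3 : path_tgt e = v by rewrite /path_tgt e1 e2.
rewrite path_mul_basis; case: mul_pathP => [r | ]; rewrite e3.
  move=> vp r1 r2 _; rewrite vp eqxx; congr basis_path.
  by apply: qpath_eq; rewrite ?r1 ?r2 ?e1 ?e2.
by move/negPf ->.
Qed.

Lemma mul_vertex_r (v : vertex Q) p :
  path_mul (basis_path p) (path_elt v [::]) =
  (if path_tgt p == v then basis_path p else 0).
Proof.
rewrite /path_elt; case: insubP => [e _ eE | ] //.
have [e1 e2] : path_src e = v /\ path_arrows e = [::].
  by rewrite /path_src /path_arrows eE.
rewrite path_mul_basis; case: mul_pathP => [r | ]; rewrite e1.
  move=> pv r1 r2 _; rewrite pv eqxx; congr basis_path.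
  by apply: qpath_eq; rewrite ?r1 ?r2 ?e2 ?cats0.
by move/negPf ->.
Qed.

Lemma path_mul1l : left_id path_one path_mul.
Proof.
apply: (basis_ext (f := path_mulr path_one) (g := idfun)) => p /=.
rewrite /path_mulr -/(path_mull _ _) linear_sum /= (bigD1 (path_src p)) //=.
rewrite /path_mull mul_vertex_l eqxx big1 ?addr0 // => v /negPf vp.
by rewrite mul_vertex_l vp.
Qed.

Lemma path_mul1r : right_id path_one path_mul.
Proof.
apply: (basis_ext (f := path_mull path_one) (g := idfun)) => p /=.
rewrite /path_mull -/(path_mulr _ _) linear_sum /= (bigD1 (path_tgt p)) //=.
rewrite /path_mulr mul_vertex_r eqxx big1 ?addr0 // => v /negPf vp.
by rewrite mul_vertex_r eq_sym vp.
Qed.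

Lemma path_mulDl : left_distributive path_mul +%R.
Proof. by move=> x y z; exact: (linearD (path_mull z)). Qed.

Lemma path_mulDr : right_distributive path_mul +%R.
Proof. by move=> x y z; exact: (linearD (path_mulr x)). Qed.

Lemma coef_vertex (v w : vertex Q) (e : qpath Q) :
  val e = (v, [::]) -> coef e (path_elt w [::]) = (w == v)%:R.
Proof.
move=> eE; rewrite /path_elt; case: insubP => [e' _ e'E | ] //.
rewrite /coef basis_path.unlock monalg.mcoeffU -(inj_eq val_inj) eE e'E.
by rewrite /eq_op /= eqxx andbT.
Qed.

Lemma coef_one (v : vertex Q) (e : qpath Q) :
  val e = (v, [::]) -> coef e path_one = 1.
Proof.
move=> eE; rewrite /coef /path_one raddf_sum /= (bigD1 v) //=.
rewrite -/(coef _ _) (coef_vertex _ eE) eqxx big1 ?addr0 // => w /negPf wv.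
by rewrite -/(coef _ _) (coef_vertex _ eE) wv.
Qed.

Lemma path_one_neq0 : path_one != 0.
Proof.
case/card_gt0P: (vertex_gt0 Q) => v _.
pose e : qpath Q := Sub (v, [::]) isT.
apply/eqP => /(congr1 (coef e)).
rewrite (@coef_one v) // /coef monalg.mcoeff0.
by apply/eqP; rewrite oner_eq0.
Qed.

HB.instance Definition _ := GRing.Zmodule_isNzRing.Build KQ
  path_mulA path_mul1l path_mul1r path_mulDl path_mulDr path_one_neq0.

Lemma path_scaleAl (k : K) x y : k *: (x * y) = (k *: x) * y.
Proof. by rewrite -[RHS]/(path_mull y (k *: x)) linearZ. Qed.

HB.instance Definition _ := GRing.Lmodule_isLalgebra.Build K KQ path_scaleAl.

Lemma path_scaleAr (k : K) x y : k *: (x * y) = x * (k *: y).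
Proof. by rewrite -[RHS]/(path_mulr x (k *: y)) linearZ. Qed.

HB.instance Definition _ := GRing.Lalgebra_isAlgebra.Build K KQ path_scaleAr.

Definition arrow_elt (a : arrow Q) : KQ := path_elt (src a) [:: a].

(* The product a (g a) (g (g a)) ... along the whole [g]-orbit of [a], starting with [a] *)
Definition cycle_elt (g : arrow Q -> arrow Q) (a : arrow Q) : KQ :=
  \prod_(i < fingraph.order g a) arrow_elt (iter i g a).

(* The span of the paths of length at least 1. *)
Definition arrow_ideal : set KQ :=
  [set x | forall p : qpath Q, path_arrows p = [::] -> coef p x = 0].

End PathAlgebra.

Arguments arrow_elt K {Q} a.
Arguments cycle_elt K {Q} g a.

Definition two_sided_ideal (A : pzRingType) (I : set A) : Prop :=
  [/\ I 0, forall x y, I x -> I y -> I (x + y) &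
      forall a x, I x -> I (a * x) /\ I (x * a)].

Definition generated_ideal (A : pzRingType) (G : set A) : set A :=
  smallest (@two_sided_ideal A) G.

Lemma generated_ideal_ideal (A : pzRingType) (G : set A) :
  two_sided_ideal (generated_ideal G).
Proof.
split=> [I [[] //]|x y|a x Ix].
  move=> Ix Iy I GI; have [[_ ID _] _] := GI.
  by apply: ID; [exact: Ix | exact: Iy].
by split=> I GI; have [[_ _ IM] _] := GI; have [] := IM a x (Ix I GI).
Qed.

Definition ideal_pred (A : pzRingType) (G : set A) : pred A :=
  fun x => `[< generated_ideal G x >].

Lemma ideal_zmod_closed (A : pzRingType) (G : set A) :
  zmod_closed (ideal_pred G).
Proof.
have [I0 ID IM] := generated_ideal_ideal G.
split=> [|x y /asboolP Ix /asboolP Iy]; apply/asboolP => //.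
apply: ID => //.
by rewrite -mulN1r; have [] := IM (-1) y Iy.
Qed.

HB.instance Definition _ (A : pzRingType) (G : set A) :=
  GRing.isZmodClosed.Build A (ideal_pred G) (ideal_zmod_closed G).

Definition ideal_zmod (A : pzRingType) (G : set A) : zmodClosed A :=
  GRing.ZmodClosed.clone A (ideal_pred G) _.

(* The quotient of [A] by the two-sided ideal generated by [G]; [G1] makes it
   nonzero, as the library requires of an algebra. *)
Definition quotient_alg (K : fieldType) (A : algType K) (G : set A)
  (G1 : ~ generated_ideal G 1) : Type := @Quotient.quot A (ideal_zmod G).

Section QuotientAlg.
Variables (K : fieldType) (A : algType K) (G : set A).
Hypothesis G1 : ~ generated_ideal G 1.
Local Notation I := (generated_ideal G).
Local Notation Q := (quotient_alg G1).
Local Open Scope quotient_scope.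

HB.instance Definition _ := GRing.Zmodule.on Q.
HB.instance Definition _ := Quotient.on Q.

Definition quot_proj (x : A) : Q := \pi_(@Quotient.quot A (ideal_zmod G)) x.

Lemma quot_projE x y : quot_proj x = quot_proj y <-> I (x - y).
Proof.
split.
  by move=> /eqP; rewrite -(Quotient.idealrBE (ideal_zmod G)) => /asboolP.
by move=> Ixy; apply/eqP; rewrite -(Quotient.idealrBE (ideal_zmod G));
  apply/asboolP.
Qed.

Lemma quot_projK (u : Q) : quot_proj (repr u) = u.
Proof. exact: (@reprK _ (@Quotient.quot A (ideal_zmod G))). Qed.

Lemma quot_projD x y : quot_proj (x + y) = quot_proj x + quot_proj y.
Proof. exact: (raddfD (\pi_(@Quotient.quot A (ideal_zmod G)))). Qed.

Definition quot_one : Q := quot_proj 1.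
Definition quot_mul (u v : Q) : Q := quot_proj (repr u * repr v).
Definition quot_scale (k : K) (u : Q) : Q := quot_proj (k *: repr u).

Lemma quot_projM x y : quot_mul (quot_proj x) (quot_proj y) = quot_proj (x * y).
Proof.
apply/quot_projE; have [_ ID IM] := generated_ideal_ideal G.
set x' := repr _; set y' := repr _.
have Ix : I (x' - x) by apply/quot_projE; rewrite quot_projK.
have Iy : I (y' - y) by apply/quot_projE; rewrite quot_projK.
have -> : x' * y' - x * y = (x' - x) * y' + x * (y' - y).
  by rewrite mulrBl mulrBr addrA subrK.
by apply: ID; [exact: (IM _ _ Ix).2 | exact: (IM _ _ Iy).1].
Qed.

Lemma quot_projZ k x : quot_scale k (quot_proj x) = quot_proj (k *: x).
Proof.
apply/quot_projE; have [_ _ IM] := generated_ideal_ideal G.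
have Ix : I (repr (quot_proj x) - x) by apply/quot_projE; rewrite quot_projK.
by rewrite -scalerBr -mulr_algl; exact: (IM _ _ Ix).1.
Qed.

Lemma quot_mulA : associative quot_mul.
Proof.
move=> u v w; rewrite -(quot_projK u) -(quot_projK v) -(quot_projK w).
by rewrite !quot_projM mulrA.
Qed.

Lemma quot_mul1l : left_id quot_one quot_mul.
Proof. by move=> u; rewrite -(quot_projK u) quot_projM mul1r. Qed.

Lemma quot_mul1r : right_id quot_one quot_mul.
Proof. by move=> u; rewrite -(quot_projK u) quot_projM mulr1. Qed.

Lemma quot_mulDl : left_distributive quot_mul +%R.
Proof.
move=> u v w; rewrite -(quot_projK u) -(quot_projK v) -(quot_projK w).
by rewrite -quot_projD !quot_projM -quot_projD mulrDl.
Qed.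

Lemma quot_mulDr : right_distributive quot_mul +%R.
Proof.
move=> u v w; rewrite -(quot_projK u) -(quot_projK v) -(quot_projK w).
by rewrite -quot_projD !quot_projM -quot_projD mulrDr.
Qed.

Lemma quot_one_neq0 : quot_one != 0.
Proof.
apply/eqP; have -> : 0 = quot_proj 0.
  exact/esym/(raddf0 (\pi_(@Quotient.quot A (ideal_zmod G)))).
by move/quot_projE; rewrite subr0.
Qed.

HB.instance Definition _ := GRing.Zmodule_isNzRing.Build Q
  quot_mulA quot_mul1l quot_mul1r quot_mulDl quot_mulDr quot_one_neq0.

Lemma quot_scaleA a b (u : Q) :
  quot_scale a (quot_scale b u) = quot_scale (a * b) u.
Proof. by rewrite -(quot_projK u) !quot_projZ scalerA. Qed.

Lemma quot_scale1 : left_id 1 quot_scale.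
Proof. by move=> u; rewrite -(quot_projK u) !quot_projZ scale1r. Qed.

Lemma quot_scaleDr : right_distributive quot_scale +%R.
Proof.
move=> a u v; rewrite -(quot_projK u) -(quot_projK v).
by rewrite -quot_projD !quot_projZ -quot_projD scalerDr.
Qed.

Lemma quot_scaleDl u : {morph quot_scale^~ u : a b / a + b}.
Proof.
by move=> a b; rewrite -(quot_projK u) !quot_projZ -quot_projD scalerDl.
Qed.

HB.instance Definition _ := GRing.Zmodule_isLmodule.Build K Q
  quot_scaleA quot_scale1 quot_scaleDr quot_scaleDl.

Lemma quot_scaleAl (k : K) (u v : Q) : k *: (u * v) = (k *: u) * v.
Proof.
rewrite -(quot_projK u) -(quot_projK v) /GRing.scale /GRing.mul /=.
by rewrite !(quot_projM, quot_projZ) scalerAl.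
Qed.

HB.instance Definition _ := GRing.Lmodule_isLalgebra.Build K Q quot_scaleAl.

Lemma quot_scaleAr (k : K) (u v : Q) : k *: (u * v) = u * (k *: v).
Proof.
rewrite -(quot_projK u) -(quot_projK v) /GRing.scale /GRing.mul /=.
by rewrite !(quot_projM, quot_projZ) scalerAr.
Qed.

HB.instance Definition _ := GRing.Lalgebra_isAlgebra.Build K Q quot_scaleAr.

End QuotientAlg.

(* [idem_neq0] makes the algebra eBe nonzero, as the library requires. *)
Record idempotent_of (K : fieldType) (B : algType K) := Idempotent {
  idem_val : B;
  idem_mul : idem_val * idem_val = idem_val;
  idem_neq0 : idem_val != 0 }.

Section Corner.
Variables (K : fieldType) (B : algType K) (e : idempotent_of B).

Definition corner_pred : {pred B} :=
  fun x => `[< exists b : B, x = idem_val e * b * idem_val e >].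

Definition corner : predArgType := {x : B | x \in corner_pred}.

HB.instance Definition _ := [isSub of corner for @sval _ _].
HB.instance Definition _ := [Choice of corner by <:].

Lemma corner_submod : submod_closed corner_pred.
Proof.
split=> [|k x y /asboolP [b ->] /asboolP [c ->]]; apply/asboolP.
  by exists 0; rewrite mulr0 mul0r.
by exists (k *: b + c); rewrite mulrDr mulrDl -scalerAr -scalerAl.
Qed.

HB.instance Definition _ :=
  GRing.isSubmodClosed.Build K B corner_pred corner_submod.
HB.instance Definition _ := [SubChoice_isSubLmodule of corner by <:].

Lemma corner_one_subproof : idem_val e \in corner_pred.
Proof. by apply/asboolP; exists 1; rewrite mulr1 idem_mul. Qed.

Lemma corner_mul_subproof (x y : corner) : val x * val y \in corner_pred.
Proof.
case: x y => [x hx] [y hy] /=; move: hx hy => /asboolP [b ->] /asboolP [c ->].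
by apply/asboolP; exists (b * idem_val e * idem_val e * c); rewrite !mulrA.
Qed.

Definition corner_one : corner := Sub (idem_val e) corner_one_subproof.
Definition corner_mul (x y : corner) : corner :=
  Sub (val x * val y) (corner_mul_subproof x y).

Lemma corner_mulA : associative corner_mul.
Proof. by move=> x y z; apply: val_inj; rewrite /= mulrA. Qed.

Lemma corner_mul1l : left_id corner_one corner_mul.
Proof.
move=> x; apply: val_inj; case: x => x hx /=; move: hx => /asboolP [b ->].
by rewrite !mulrA idem_mul.
Qed.

Lemma corner_mul1r : right_id corner_one corner_mul.
Proof.
move=> x; apply: val_inj; case: x => x hx /=; move: hx => /asboolP [b ->].
by rewrite -!mulrA idem_mul.
Qed.

Lemma corner_mulDl : left_distributive corner_mul +%R.
Proof. by move=> x y z; apply: val_inj; exact: mulrDl. Qed.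

Lemma corner_mulDr : right_distributive corner_mul +%R.
Proof. by move=> x y z; apply: val_inj; exact: mulrDr. Qed.

Lemma corner_one_neq0 : corner_one != 0.
Proof. by rewrite -(inj_eq val_inj) /= idem_neq0. Qed.

HB.instance Definition _ := GRing.Zmodule_isNzRing.Build corner
  corner_mulA corner_mul1l corner_mul1r corner_mulDl corner_mulDr corner_one_neq0.

Lemma corner_scaleAl (k : K) (x y : corner) : k *: (x * y) = (k *: x) * y.
Proof. by apply: val_inj; exact: scalerAl. Qed.

HB.instance Definition _ := GRing.Lmodule_isLalgebra.Build K corner corner_scaleAl.

Lemma corner_scaleAr (k : K) (x y : corner) : k *: (x * y) = x * (k *: y).
Proof. by apply: val_inj; exact: scalerAr. Qed.

HB.instance Definition _ := GRing.Lalgebra_isAlgebra.Build K corner corner_scaleAr.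

End Corner.

Definition alg_isomorphic (K : fieldType) (A B : algType K) : Prop :=
  exists f : {lrmorphism A -> B}, bijective f.

Lemma path_arrows_elt (K : fieldType) (Q : quiver) (v : vertex Q) s :
  s != [::] -> arrow_ideal (path_elt K v s).
Proof.
move=> s0 p p0; rewrite /path_elt; case: insubP => [q _ qE | ]; last first.
  by rewrite /coef monalg.mcoeff0.
rewrite basis_path.unlock /coef monalg.mcoeffU; case: eqP => // qp.
by move: s0; rewrite -[s]/((v, s).2) -qE qp -[(sval p).2]/(path_arrows p) p0.
Qed.

Lemma arrow_ideal_ideal (K : fieldType) (Q : quiver) :
  two_sided_ideal (@arrow_ideal K Q).
Proof.
split=> [p _|x y Ix Iy p p0|a x Ix].
- by rewrite /coef monalg.mcoeff0.
- by rewrite /coef monalg.mcoeffD -!/(coef p _) Ix // Iy // addr0.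
have sum_ideal (I : Type) (r : seq I) (F : I -> path_algebra K Q) :
    (forall i, arrow_ideal (F i)) -> arrow_ideal (\sum_(i <- r) F i).
  by move=> FI p p0; rewrite /coef raddf_sum big1 //= => i _; apply: FI.
have prod_ideal (p q : qpath Q) (k : K) :
    path_arrows p != [::] \/ path_arrows q != [::] ->
    arrow_ideal (k *: mul_path K p q).
  move=> pq r r0; rewrite /coef monalg.mcoeffZ -/(coef r _) /mul_path.
  case: ifP => _; last by rewrite /coef monalg.mcoeff0 mulr0.
  rewrite path_arrows_elt ?mulr0 //; rewrite -size_eq0 size_cat addn_eq0.
  by case: pq; rewrite -size_eq0 => /negPf ->; rewrite ?andbF.
split; apply: (sum_ideal) => p; apply: (sum_ideal) => q.
  case: (eqVneq (path_arrows q) [::]) => [q0|q0].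
    by rewrite (Ix q q0) mulr0 scale0r => r _; rewrite /coef monalg.mcoeff0.
  by apply: prod_ideal; right.
case: (eqVneq (path_arrows p) [::]) => [p0|p0].
  by rewrite (Ix p p0) mul0r scale0r => r _; rewrite /coef monalg.mcoeff0.
by apply: prod_ideal; left.
Qed.

Lemma relations_proper (K : fieldType) (Q : quiver) (G : set (path_algebra K Q)) :
  G `<=` @arrow_ideal K Q -> ~ generated_ideal G 1.
Proof.
move=> GA /(_ _ (conj (@arrow_ideal_ideal K Q) GA)).
case/card_gt0P: (vertex_gt0 Q) => v _.
pose e : qpath Q := Sub (v, [::]) isT.
move=> /(_ e erefl); rewrite (@coef_one K Q v) // => /eqP.
by rewrite oner_eq0.
Qed.

Lemma arrow_ideal_arrow (K : fieldType) (Q : quiver) (a : arrow Q) :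
  arrow_ideal (arrow_elt K a).
Proof. exact: path_arrows_elt. Qed.

Lemma arrow_ideal_cycle (K : fieldType) (Q : quiver) g (a : arrow Q) n :
  (0 < n)%N -> arrow_ideal (cycle_elt K g a ^+ n).
Proof.
have [_ _ IM] := arrow_ideal_ideal K Q.
case: n => // n _; rewrite exprS; apply: (IM _ _ _).2.
rewrite /cycle_elt; case: (fingraph.order g a) (fingraph.order_gt0 g a) => // m _.
by rewrite big_ord_recl; apply: (IM _ _ _).2; exact: arrow_ideal_arrow.
Qed.

Lemma arrow_idealB (K : fieldType) (Q : quiver) (x y : path_algebra K Q) :
  arrow_ideal x -> arrow_ideal y -> arrow_ideal (x - y).
Proof.
have [_ ID IM] := arrow_ideal_ideal K Q.
move=> Ix Iy; apply: ID => //.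
by rewrite -mulN1r; exact: (IM _ _ Iy).1.
Qed.

(* The edge [i] has the two half-edges [(i, true)] and [(i, false)], and [bg_end]
   is the vertex at which a half-edge is attached; a loop has both half-edges at
   the same vertex, and so occurs twice around it. The cyclic orderings around
   the vertices are the cycles of [bg_rot]. *)
Record brauer_graph := BrauerGraph {
  bg_vertex : finType;
  bg_edge : finType;
  bg_end : bg_edge * bool -> bg_vertex;
  bg_rot : {perm bg_edge * bool};
  bg_rotP : forall h h' : bg_edge * bool,
    (h' \in porbit bg_rot h) = (bg_end h' == bg_end h);
  bg_mult : bg_vertex -> nat;
  bg_mult_gt0 : forall v, (0 < bg_mult v)%N;
  bg_edge_gt0 : (0 < #|bg_edge|)%N;
  bg_connected : forall u v : bg_vertex,
    connect [rel x y | [exists i, exists b,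
      (bg_end (i, b) == x) && (bg_end (i, ~~ b) == y)]] u v }.

Section BrauerGraphAlgebra.
Variables (K : fieldType) (G : brauer_graph).

(* The arrow [h] starts at the occurrence [h] of the edge [h.1]. *)
Definition brauer_quiver : quiver :=
  @Quiver (bg_edge G) (bg_edge G * bool)%type (fun h => h.1)
    (fun h => (bg_rot G h).1) (bg_edge_gt0 G).

Definition brauer_succ (a : arrow brauer_quiver) : arrow brauer_quiver :=
  bg_rot G a.

Definition brauer_mult (a : arrow brauer_quiver) : nat := bg_mult (bg_end a).

Definition brauer_relations : set (path_algebra K brauer_quiver) :=
  [set x | exists a b : arrow brauer_quiver,
     [/\ tgt a = src b, b <> brauer_succ a & x = arrow_elt K a * arrow_elt K b]]
  `|`
  [set x | exists a : arrow brauer_quiver,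
     x = cycle_elt K brauer_succ a ^+ brauer_mult a
       - cycle_elt K brauer_succ (bar a) ^+ brauer_mult (bar a)].

Lemma brauer_relations_proper : ~ generated_ideal brauer_relations 1.
Proof.
apply: relations_proper => x [[a [b [_ _ ->]]]|[a ->]].
  by have [_ _ IM] := arrow_ideal_ideal K brauer_quiver;
    apply: (IM _ _ _).2; exact: arrow_ideal_arrow.
by apply: arrow_idealB; apply: arrow_ideal_cycle; apply: bg_mult_gt0.
Qed.

Definition brauer_algebra := quotient_alg brauer_relations_proper.

End BrauerGraphAlgebra.

Definition is_brauer_graph_algebra (K : fieldType) (A : algType K) : Prop :=
  exists G : brauer_graph, alg_isomorphic A (brauer_algebra K G).

Section Surface.
Variables (R : realType) (S : topologicalType).

Definition half_plane : set (R * R) := [set p | 0 <= p.2].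

(* [f] is a homeomorphism, with inverse [g], from an open neighbourhood [U] of
   [x] onto an open subset of [H]. *)
Definition has_chart (H : set (R * R)) (x : S) : Prop :=
  exists (U : set S) (W : set (R * R)) (f : S -> R * R) (g : R * R -> S),
    [/\ open U /\ U x, open W, f @` U = W `&` H,
        {within U, continuous f} /\ {within W `&` H, continuous g} &
        forall y, U y -> g (f y) = y].

Definition surface_boundary : set S := [set x | ~ has_chart setT x].

Definition is_surface : Prop :=
  [/\ compact [set: S], connected [set: S], hausdorff_space S,
      [set: S] !=set0 &
      forall x : S, has_chart setT x \/ has_chart half_plane x].

Definition std_triangle : set (R * R) :=
  [set p | [/\ 0 <= p.1, 0 <= p.2 & p.1 + p.2 <= 1]].

Definition std_triangle_int : set (R * R) :=
  [set p | [/\ 0 < p.1, 0 < p.2 & p.1 + p.2 < 1]].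

(* Parametrizations of the sides by [0,1], running once around the triangle:
   each side ends at the corner where the next one starts. *)
Definition side_point (k : 'I_3) (u : R) : R * R :=
  match val k with
  | 0%N => (u, 0)
  | 1%N => (1 - u, u)
  | _ => (0, 1 - u)
  end.

(* The characteristic maps of the 1-cells are defined on [0,1], those of the
   2-cells on the standard triangle. *)
Record cell_data := CellData {
  tr_vertex : finType;
  tr_edge : finType;
  tr_face : finType;
  tr_vertex_map : tr_vertex -> S;
  tr_edge_map : tr_edge -> R -> S;
  tr_face_map : tr_face -> R * R -> S;
  tr_side : tr_face -> 'I_3 -> tr_edge }.

Definition open_cell (D : cell_data)
  (c : tr_vertex D + tr_edge D + tr_face D) : set S :=
  match c with
  | inl (inl v) => [set tr_vertex_map v]
  | inl (inr e) => tr_edge_map e @` `]0, 1[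
  | inr t => tr_face_map t @` std_triangle_int
  end.

(* The edge [e] lies on the sides [k] and [k+1] of [t], which are folded onto
   each other around the corner between them. *)
Definition is_self_folded_edge (D : cell_data) (t : tr_face D) (e : tr_edge D) :=
  exists k : 'I_3,
    [/\ tr_side t k = e, tr_side t (ordS k) = e, tr_side t (ord_pred k) <> e &
        forall u : R, `[0, 1]%classic u ->
          tr_face_map t (side_point k u) =
          tr_face_map t (side_point (ordS k) (1 - u))].

Definition self_folded (D : cell_data) (t : tr_face D) : Prop :=
  exists e, is_self_folded_edge t e.

Definition is_boundary_edge (D : cell_data) (e : tr_edge D) : Prop :=
  tr_edge_map e @` `[0, 1] `<=` surface_boundary.

(* On a compact Hausdorff space the characteristic maps restrict to
   homeomorphisms from the open cells' domains onto the open cells, and the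
   topology is determined by the cells. [tr_face_attach] says that each side of
   a triangle runs along one whole 1-cell, in one of the two directions. *)
Record triangulation := Triangulation {
  tr_cells :> cell_data;
  tr_edge_cont : forall e : tr_edge tr_cells,
    {within `[0, 1], continuous (tr_edge_map e)};
  tr_face_cont : forall t : tr_face tr_cells,
    {within std_triangle, continuous (tr_face_map t)};
  tr_edge_inj : forall e : tr_edge tr_cells,
    {in `]0, 1[%classic &, injective (tr_edge_map e)};
  tr_face_inj : forall t : tr_face tr_cells,
    {in std_triangle_int &, injective (tr_face_map t)};
  tr_cells_disjoint : trivIset setT (@open_cell tr_cells);
  tr_cells_cover : \bigcup_c @open_cell tr_cells c = setT;
  tr_edge_attach : forall e : tr_edge tr_cells,
    range (@tr_vertex_map tr_cells) (tr_edge_map e 0) /\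
    range (@tr_vertex_map tr_cells) (tr_edge_map e 1);
  tr_face_attach : forall (t : tr_face tr_cells) k,
    (forall u, `[0, 1]%classic u ->
       tr_face_map t (side_point k u) = tr_edge_map (tr_side t k) u) \/
    (forall u, `[0, 1]%classic u ->
       tr_face_map t (side_point k u) = tr_edge_map (tr_side t k) (1 - u));
  tr_face_kind : forall t : tr_face tr_cells,
    injective (tr_side t) \/ self_folded t;
  tr_edge_kind : forall e : tr_edge tr_cells,
    [\/ #|[set t : tr_face tr_cells | e \in codom (tr_side t)]%SET| = 2%N,
        exists t, is_self_folded_edge t e | is_boundary_edge e];
  tr_edge_ge2 : (2 <= #|tr_edge tr_cells|)%N }.

(* [o t] tells whether the triangle [t] is oriented along the numbering of its
   sides or against it. On a self-folded triangle both values give the cyclic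
   order (aab). *)
Definition orientation (T : triangulation) : Type := tr_face T -> bool.

Section SurfaceQuiver.
Variables (T : triangulation) (o : orientation T).

Definition next_side (t : tr_face T) (k : 'I_3) : 'I_3 :=
  if o t then ordS k else ord_pred k.

Definition boundary_edge : finType := {e : tr_edge T | `[< is_boundary_edge e >]}.

Lemma tr_edge_gt0 : (0 < #|tr_edge T|)%N.
Proof. exact: leq_trans (tr_edge_ge2 T). Qed.

(* The arrow [inl (t, k)] starts at the side [k] of the triangle [t]. *)
Definition surface_quiver : quiver :=
  @Quiver (tr_edge T) (tr_face T * 'I_3 + boundary_edge)%type
    (fun a => match a with inl (t, k) => tr_side t k | inr e => val e end)
    (fun a => match a with
              | inl (t, k) => tr_side t (next_side t k)
              | inr e => val e
              end)
    tr_edge_gt0.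

Definition surface_f (a : arrow surface_quiver) : arrow surface_quiver :=
  match a with inl (t, k) => inl (t, next_side t k) | inr e => inr e end.

Definition surface_g (a : arrow surface_quiver) : arrow surface_quiver :=
  bar (surface_f a).

Definition g_orbit (a : arrow surface_quiver) : {set arrow surface_quiver} :=
  [set b | fconnect surface_g a b]%SET.

(* A map on the set of g-orbits; the values on other sets are irrelevant. *)
Record weight_function := WeightFunction {
  weight :> {set arrow surface_quiver} -> nat;
  weight_gt0 : forall a, (0 < weight (g_orbit a))%N }.

End SurfaceQuiver.

Section BiserialWeightedSurfaceAlgebra.
Variables (K : fieldType) (T : triangulation) (o : orientation T).
Variable m : weight_function o.

Definition surface_relations : set (path_algebra K (surface_quiver o)) :=
  [set x | exists a : arrow (surface_quiver o),
     x = arrow_elt K a * arrow_elt K (surface_f a)]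
  `|`
  [set x | exists a : arrow (surface_quiver o),
     x = cycle_elt K (@surface_g T o) a ^+ m (g_orbit a)
       - cycle_elt K (@surface_g T o) (bar a) ^+ m (g_orbit (bar a))].

Lemma surface_relations_proper : ~ generated_ideal surface_relations 1.
Proof.
apply: relations_proper => x [[a ->]|[a ->]].
  by have [_ _ IM] := arrow_ideal_ideal K (surface_quiver o);
    apply: (IM _ _ _).2; exact: arrow_ideal_arrow.
by apply: arrow_idealB; apply: arrow_ideal_cycle; apply: weight_gt0.
Qed.

Definition surface_algebra := quotient_alg surface_relations_proper.

End BiserialWeightedSurfaceAlgebra.

End Surface.

Arguments surface_boundary R S : clear implicits.
Arguments is_surface R S : clear implicits.

(* Main.v *)
(* A Brauer graph is the 1-skeleton of a cell structure on a closed surface whose faces are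
   polygons, one for each cycle of [h |-> flip (rot h)] on half-edges. Every polygon is coned
   off from a centre and every sector of the cone is divided into three triangles, so that even
   a polygon with one side contains no self-folded triangle. Around a vertex of the Brauer
   graph three new edges then lie between two consecutive old ones, hence the g-orbits of the
   quiver of the triangulation that meet the old edges are the cycles of the Brauer quiver with
   every arrow replaced by a path of length four. With the old multiplicities on these orbits,
   and [e] the sum of the idempotents of the old edges, this replacement induces the
   isomorphism onto [eBe]. *)

From HB Require Import structures.
Require Import Defs.
From mathcomp Require Import all_fingroup all_boot all_order all_algebra.
From mathcomp Require Import all_classical all_reals topology normedtype.
From mathcomp Require Import ring lra.

Set Implicit Arguments.
Unset Strict Implicit.
Unset Printing Implicit Defensive.

Import Order.TTheory GRing.Theory Num.Theory.
Import numFieldNormedType.Exports.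
Local Open Scope classical_set_scope.
Local Open Scope ring_scope.

(** The algebraic obstacle is injectivity: an element of the corner could be a combination of
    relations of the larger quiver that run outside the corner. No basis or dimension is computed.
    Instead a linear, not multiplicative, map [Psi] on paths undoes the replacement and is shown to
    vanish on every product path-relation-path. This rests on one fact about both presentations: a
    path longer than the cycle power at its first arrow is zero.

    The topological obstacle is that the surface must be an actual space with a chart at every
    point. Points are stored in normal form, one for each point of an open cell, and functions on
    the space are families of functions on triangles that agree along glued sides. The charts are
    unfolded pairs of triangles along edges, and at vertices polar coordinates for the l1 norm, so
    that linear arithmetic settles most of the verification. Glued sides always run in opposite
    directions, so the numbering of the sides already orients the triangles coherently. *)

Lemma alg_isomorphic_trans (K : fieldType) (A B C : algType K) :
  alg_isomorphic A B -> alg_isomorphic B C -> alg_isomorphic A C.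
Proof.
move=> [f bf] [g bg].
by exists (GRing.LRMorphism.clone K A C *:%R (g \o f) _); exact: bij_comp.
Qed.

(** * Idempotent subalgebras of biserial path algebras *)

Section PathElements.
Variables (K : fieldType) (Q : quiver).
Local Notation path_elt := (path_elt K).
Implicit Types (v w : vertex Q) (s t : seq (arrow Q)).

Lemma path_elt_walk v s (ws : walk v s) :
  path_elt v s = basis_path K (Sub (v, s) ws : qpath Q).
Proof. by rewrite -path_elt_val. Qed.

Lemma path_elt_nwalk v s : ~~ walk v s -> path_elt v s = 0.
Proof. by move=> ws; rewrite /Defs.path_elt insubF //; apply: negbTE. Qed.

Lemma path_elt_cat v s t :
  path_elt v s * path_elt (walk_end v s) t = path_elt v (s ++ t).
Proof.
have [ws|ws] := boolP (walk v s); last first.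
  by rewrite (path_elt_nwalk ws) mul0r path_elt_nwalk // walk_cat negb_and ws.
have [wt|wt] := boolP (walk (walk_end v s) t); last first.
  by rewrite (path_elt_nwalk wt) mulr0 path_elt_nwalk // walk_cat negb_and wt orbT.
rewrite (path_elt_walk ws) (path_elt_walk wt) -[LHS]/(path_mul _ _) path_mul_basis.
by rewrite /mul_path eqxx.
Qed.

Lemma path_elt_mul0 v s w t : walk_end v s != w -> path_elt v s * path_elt w t = 0.
Proof.
move=> sw; have [ws|ws] := boolP (walk v s); last by rewrite (path_elt_nwalk ws) mul0r.
have [wt|wt] := boolP (walk w t); last by rewrite (path_elt_nwalk wt) mulr0.
rewrite (path_elt_walk ws) (path_elt_walk wt) -[LHS]/(path_mul _ _) path_mul_basis /mul_path.
by case: ifP sw => // /eqP -> /eqP.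
Qed.

Lemma src_bar (a : arrow Q) : src (bar a) = src a.
Proof. by rewrite /bar; case: pickP => //= b /andP [/eqP]. Qed.

End PathElements.

(** * Generated ideals and their quotients *)

Section GeneratedIdeal.
Variables (K : fieldType) (A : algType K) (G : set A).
Local Notation I := (generated_ideal G).

Lemma idealD x y : I x -> I y -> I (x + y).
Proof. by have [_ D _] := generated_ideal_ideal G; apply: D. Qed.

Lemma ideal0 : I 0.
Proof. by have [D _ _] := generated_ideal_ideal G. Qed.

Lemma idealMl a x : I x -> I (a * x).
Proof. by have [_ _ D] := generated_ideal_ideal G => /(D a) []. Qed.

Lemma idealMr a x : I x -> I (x * a).
Proof. by have [_ _ D] := generated_ideal_ideal G => /(D a) []. Qed.

Lemma ideal_gen x : G x -> I x.
Proof. by move=> Gx J [_]; apply. Qed.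

Lemma idealBr x y : I (x - y) -> I y -> I x.
Proof. by move=> xy y0; rewrite -(subrK y x); apply: idealD. Qed.

Lemma quot_proj0 (p : ~ I 1) : quot_proj p 0 = 0.
Proof. exact: (raddf0 (\pi_(@Quotient.quot A (ideal_zmod G)))%qT). Qed.

Lemma quot_proj_eq0 (p : ~ I 1) x : quot_proj p x = 0 <-> I x.
Proof. by rewrite -(quot_proj0 p) quot_projE subr0. Qed.

(** Meant for maps that are additive but not multiplicative: vanishing on generators is then not
    enough, so the products [y * x * z] are tested. The elements all of whose products are sent to 0
    form an ideal containing [G]. *)
Lemma ideal_sandwich (V : zmodType) (f : A -> V) : f 0 = 0 -> {morph f : x y / x + y} ->
  (forall x y z, G x -> f (y * x * z) = 0) -> forall x, I x -> f x = 0.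
Proof.
move=> f0 fD fG x Ix; rewrite -[x]mul1r -[_ * x]mulr1.
apply: (Ix [set x | forall y z, f (y * x * z) = 0]).
split=> [|{Ix}x Gx] /=; last by move=> y z; apply: fG.
split=> /= [y z|u v uP vP y z|a u uP]; first by rewrite mulr0 mul0r f0.
  by rewrite mulrDr mulrDl fD uP vP addr0.
by split=> y z; [rewrite mulrA | rewrite mulrA -mulrA].
Qed.

Lemma quot_proj_mul (p : ~ I 1) x y : quot_proj p (x * y) = quot_proj p x * quot_proj p y.
Proof. by rewrite [RHS](@quot_projM _ _ _ p). Qed.

Lemma quot_proj_sandwich (p : ~ I 1) x z :
  quot_proj p (x * z * x) = quot_proj p x * quot_proj p z * quot_proj p x.
Proof. by rewrite !quot_proj_mul. Qed.

Lemma quot_proj_scale (p : ~ I 1) k x : quot_proj p (k *: x) = k *: quot_proj p x.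
Proof. by rewrite [RHS](@quot_projZ _ _ _ p). Qed.

Lemma idealZ k x : I x -> I (k *: x).
Proof. by move=> Ix; rewrite -mulr_algl; apply: idealMl. Qed.

End GeneratedIdeal.

(** * Paths that vanish under biserial relations *)

Section BiserialRelations.
Variables (K : fieldType) (Q : quiver) (g : arrow Q -> arrow Q) (m : arrow Q -> nat).

(** Both kinds of algebras are presented in this form, which allows the comparison to be made for
    two abstract quivers. *)
Definition biserial_relations : set (path_algebra K Q) :=
  [set x | exists a b : arrow Q,
     [/\ tgt a = src b, b <> g a & x = arrow_elt K a * arrow_elt K b]]
  `|`
  [set x | exists a : arrow Q,
     x = cycle_elt K g a ^+ m a - cycle_elt K g (bar a) ^+ m (bar a)].

Hypotheses (g_inj : injective g) (src_g : forall a, src (g a) = tgt a).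
Hypotheses (bar_neq : forall a : arrow Q, bar a != a) (m_gt0 : forall a, (0 < m a)%N).
Local Notation I := (generated_ideal biserial_relations).

Lemma walk_traject a n : walk (src a) (traject g a n).
Proof. by elim: n a => //= n IH a; rewrite eqxx -src_g IH. Qed.

Lemma walk_end_traject a n : walk_end (src a) (traject g a n) = src (iter n g a).
Proof.
elim: n a => //= n IH a.
by rewrite -[LHS]/(walk_end (tgt a) _) -src_g IH -iterSr.
Qed.

Lemma path_elt_traject a n :
  path_elt K (src a) (traject g a n.+1) = \prod_(i < n.+1) arrow_elt K (iter i g a).
Proof.
elim: n => [|n IH]; first by rewrite big_ord1.
rewrite big_ord_recr -IH trajectSr -cats1 -path_elt_cat walk_end_traject.
by [].
Qed.

Lemma cycle_eltE a : cycle_elt K g a = path_elt K (src a) (traject g a (order g a)).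
Proof. by rewrite /cycle_elt -(prednK (order_gt0 g a)) path_elt_traject. Qed.

Lemma traject_add a k n : traject g a (k + n) = traject g a k ++ traject g (iter k g a) n.
Proof. by elim: k a => //= k IH a; rewrite IH -iterSr. Qed.

Lemma iter_order_mul a k : iter (order g a * k) g a = a.
Proof.
elim: k => [|k IH]; first by rewrite muln0.
by rewrite mulnS addnC iterD (iter_order g_inj) IH.
Qed.

Lemma cycle_eltX a k : (0 < k)%N ->
  cycle_elt K g a ^+ k = path_elt K (src a) (traject g a (order g a * k)).
Proof.
case: k => // k _; elim: k => [|k IH]; first by rewrite expr1 muln1 cycle_eltE.
rewrite exprSr IH cycle_eltE [in RHS]mulnS addnC traject_add iter_order_mul.
by rewrite -path_elt_cat walk_end_traject iter_order_mul.
Qed.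

Lemma nsorted_split s : ~~ sorted (frel g) s ->
  exists s1 a b s2, s = s1 ++ [:: a, b & s2] /\ b <> g a.
Proof.
elim: s => //= a [|b s] IH //=.
rewrite negb_and => /orP [ab|/IH [s1 [c [d [s2 [-> cd]]]]]].
  by exists [::], a, b, s; split=> //; apply/eqP; rewrite eq_sym.
by exists (a :: s1), c, d, s2.
Qed.

(** Either the sequence is no walk and the element is 0, or it has two consecutive arrows [a], [b]
    with [b <> g a], whose product is a generator. *)
Lemma nsorted_ideal v s : ~~ sorted (frel g) s -> I (path_elt K v s).
Proof.
move=> /nsorted_split [s1 [a [b [s2 [-> ab]]]]].
have [ws|ws] := boolP (walk v (s1 ++ [:: a, b & s2])); last first.
  by rewrite path_elt_nwalk //; apply: ideal0.
rewrite -path_elt_cat; apply: idealMl.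
move: ws; rewrite walk_cat /= => /and4P [_ /eqP <- /eqP bE _].
rewrite -[_ :: _]/([:: a] ++ [:: b] ++ s2) -path_elt_cat.
rewrite -path_elt_cat mulrA; apply: idealMr; apply: ideal_gen; left.
have -> : walk_end (src a) [:: a] = src b by rewrite bE.
by exists a, b; split.
Qed.

Lemma sorted_traject a s : sorted (frel g) (a :: s) -> a :: s = traject g a (size s).+1.
Proof. by move=> /= /fpathP [n ->]; rewrite size_traject. Qed.

Lemma traject_sorted a n : sorted (frel g) (traject g a n).
Proof. by case: n => //= n; apply: fpath_traject. Qed.

(** The path is the power of the cycle of [a] followed by [a] again. Modulo the second kind of
    relation this power becomes that of [bar a], whose last arrow has successor [bar a] and not [a],
    so that a zero relation occurs. *)
Lemma long_ideal a s : sorted (frel g) (a :: s) ->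
  (order g a * m a < size (a :: s))%N -> I (path_elt K (src a) (a :: s)).
Proof.
move=> /sorted_traject -> /=; rewrite size_traject => lts.
rewrite -[a :: _]/(traject g a (size s).+1) -(subnKC lts) addSnnS.
rewrite traject_add iter_order_mul -path_elt_cat.
rewrite walk_end_traject iter_order_mul -cycle_eltX //.
set n := (_ - _)%N; set x := path_elt _ _ _.
apply: (@idealBr _ _ _ _ (cycle_elt K g (bar a) ^+ m (bar a) * x)).
  by rewrite -mulrBl; apply: idealMr; apply: ideal_gen; right; exists a.
rewrite cycle_eltX // /x -(src_bar a).
have := walk_end_traject (bar a) (order g (bar a) * m (bar a)).
rewrite iter_order_mul => {2}<-; rewrite path_elt_cat; apply: nsorted_ideal.
have : (0 < order g (bar a) * m (bar a))%N by rewrite muln_gt0 order_gt0 m_gt0.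
move: (iter_order_mul (bar a) (m (bar a))).
case: (_ * _)%N => // k bE _; rewrite trajectSr cat_rcons sorted_cat_cons /=.
by rewrite -iterS bE (negbTE (bar_neq a)) andbF.
Qed.

Lemma orderS a : order g (g a) = order g a.
Proof. exact/esym/eq_card/(same_fconnect1 g_inj). Qed.

End BiserialRelations.

Arguments biserial_relations K {Q} g m.

Lemma order_dvdn (T : finType) (f : T -> T) (f_inj : injective f) x n :
  iter n f x = x -> (order f x %| n)%N.
Proof.
move=> nx; have ltr : (n %% order f x < order f x)%N by rewrite ltn_mod order_gt0.
rewrite /dvdn -(findex_iter ltr); apply/eqP/(@eq_trans _ _ (findex f x x)); last first.
  exact: findex0.
congr findex; rewrite -[RHS]nx [in RHS](divn_eq n (order f x)) addnC iterD.
congr (iter _ _ _); elim: (n %/ _)%N => // k IH.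
by rewrite mulSn iterD -IH (iter_order f_inj).
Qed.

Section PathInduction.
Variables (K : fieldType) (Q : quiver).

Lemma path_elt_ind (P : path_algebra K Q -> Prop) :
  P 0 -> (forall k x y, P x -> P y -> P (k *: x + y)) ->
  (forall v s, walk v s -> P (path_elt K v s)) -> forall x, P x.
Proof.
move=> P0 PD Pp x; rewrite -(lin_ext_id x) /lin_ext.
apply: big_rec => // p y _ Py; apply: PD => //.
by rewrite -path_elt_val; exact: (Pp _ _ (Defs.pathP p)).
Qed.

Lemma path_elt_mul (v w : vertex Q) (s t : seq (arrow Q)) :
  path_elt K v s * path_elt K w t =
  (if walk_end v s == w then path_elt K v (s ++ t) else 0).
Proof. by case: eqP => [<-|/eqP]; [apply: path_elt_cat | apply: path_elt_mul0]. Qed.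

End PathInduction.

(** * Comparison of a biserial algebra with a corner of a larger one *)

Section CornerIso.
Variables (K : fieldType) (Q1 Q2 : quiver).
Variables (g1 : arrow Q1 -> arrow Q1) (m1 : arrow Q1 -> nat).
Variables (g2 : arrow Q2 -> arrow Q2) (m2 : arrow Q2 -> nat).
Hypotheses (g1_inj : injective g1) (src_g1 : forall a, src (g1 a) = tgt a).
Hypotheses (bar1 : forall a : arrow Q1, bar a != a) (m1_gt0 : forall a, (0 < m1 a)%N).
Hypotheses (g2_inj : injective g2) (src_g2 : forall a, src (g2 a) = tgt a).
Hypotheses (bar2 : forall a : arrow Q2, bar a != a) (m2_gt0 : forall a, (0 < m2 a)%N).
Hypothesis m2_g : forall a, m2 (g2 a) = m2 a.
Variables (iota : vertex Q1 -> vertex Q2) (arr : arrow Q1 -> arrow Q2) (l : nat).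
Hypotheses (iota_inj : injective iota) (arr_inj : injective arr) (l_gt0 : (0 < l)%N).
Hypothesis src_arr : forall h, src (arr h) = iota (src h).
Hypothesis iter_arr : forall h, iter l g2 (arr h) = arr (g1 h).
Hypothesis src_mid : forall h j v, (0 < j < l)%N -> src (iter j g2 (arr h)) <> iota v.
Hypothesis arr_onto : forall a v, src a = iota v -> exists h, a = arr h.
Hypothesis m_arr : forall h, m2 (arr h) = m1 h.
Hypothesis bar_arr : forall h, bar (arr h) = arr (bar h).

Local Notation R1 := (biserial_relations K g1 m1).
Local Notation R2 := (biserial_relations K g2 m2).
Hypotheses (R1_proper : ~ generated_ideal R1 1) (R2_proper : ~ generated_ideal R2 1).
Local Notation I1 := (generated_ideal R1).
Local Notation I2 := (generated_ideal R2).
Local Notation B1 := (quotient_alg R1_proper).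
Local Notation B2 := (quotient_alg R2_proper).

(** The path of length [l] that replaces the arrow [h]. By [src_mid] it meets vertices [iota v] only
    at its ends, and by [arr_onto] every arrow leaving such a vertex begins one of these paths. *)
Definition seg h := traject g2 (arr h) l.
Definition lift (s : seq (arrow Q1)) := flatten (map seg s).

Lemma size_lift s : size (lift s) = (size s * l)%N.
Proof.
by elim: s => //= h s IH; rewrite /lift /= size_cat size_traject [size _]IH mulSn.
Qed.

Lemma lift_cat s t : lift (s ++ t) = lift s ++ lift t.
Proof. by rewrite /lift map_cat flatten_cat. Qed.

(** All blocks have the same positive length, so the sequence can be cut into blocks again, and a
    block determines [h] by its first arrow. *)
Lemma lift_inj : injective lift.
Proof.
elim=> [|h s IH] [|h' s'] //=.
- by move=> /(congr1 size); rewrite !size_lift mulSn; case: l l_gt0.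
- by move=> /(congr1 size); rewrite !size_lift mulSn; case: l l_gt0.
move=> /eqP; rewrite /lift /= eqseq_cat ?size_traject // => /andP [/eqP hh /eqP /IH ->].
by congr (_ :: _); apply: arr_inj; move: hh; rewrite /seg; case: l l_gt0 => // k _ [].
Qed.

Lemma iter_arr_mul h n : iter (n * l) g2 (arr h) = arr (iter n g1 h).
Proof.
elim: n h => //= n IH h.
by rewrite mulSn addnC iterD iter_arr IH -iterS iterSr.
Qed.

Lemma lift_traject h n : lift (traject g1 h n) = traject g2 (arr h) (n * l).
Proof.
elim: n h => //= n IH h; rewrite /lift /= -/(lift _) IH mulSn traject_add.
by rewrite iter_arr.
Qed.

Lemma sorted_lift s : sorted (frel g1) s -> sorted (frel g2) (lift s).
Proof.
by case: s => // h s /sorted_traject ->; rewrite lift_traject traject_sorted.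
Qed.

Lemma walk_seg x h : walk x (seg h) = (iota (src h) == x).
Proof.
rewrite /seg; case: l l_gt0 => //= k _; rewrite src_arr -src_g2 walk_traject //.
by rewrite andbT.
Qed.

Lemma walk_end_seg x h : walk_end x (seg h) = iota (tgt h).
Proof.
rewrite -src_g1 -src_arr -iter_arr -(walk_end_traject src_g2) /seg.
by case: l l_gt0.
Qed.

Lemma walk_end_lift v s : walk_end (iota v) (lift s) = iota (walk_end v s).
Proof.
elim: s v => //= h s IH v.
by rewrite /lift /= walk_end_cat walk_end_seg IH.
Qed.

Lemma walk_lift v s : walk (iota v) (lift s) = walk v s.
Proof.
elim: s v => //= h s IH v.
by rewrite /lift /= walk_cat walk_seg walk_end_seg IH (inj_eq iota_inj).
Qed.

(** A sorted path is a trajectory of [g2], here from some [arr h]. Were its length not a multiple of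
    [l], it would end strictly inside a replacing path, away from the image of [iota]. *)
Lemma lift_onto v w a t : sorted (frel g2) (a :: t) -> src a = iota v ->
  walk_end (src a) (a :: t) = iota w -> exists s, a :: t = lift s.
Proof.
move=> at_sorted av; have [h aE] := arr_onto av.
rewrite (sorted_traject at_sorted) walk_end_traject // aE.
set n := (size t).+1; rewrite (divn_eq n l).
set q := (n %/ l)%N; set r := (n %% l)%N.
rewrite addnC iterD iter_arr_mul => srcw.
case: (posnP r) => [r0|r0]; last first.
  by case: (@src_mid (iter q g1 h) r w); rewrite ?r0 ?ltn_mod.
by exists (traject g1 h q); rewrite lift_traject r0.
Qed.

Lemma order_arr h : order g2 (arr h) = (order g1 h * l)%N.
Proof.
apply/eqP; rewrite eqn_dvd; apply/andP; split.
  by apply: order_dvdn => //; rewrite iter_arr_mul iter_order.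
have := iter_order g2_inj (arr h); set n := order g2 (arr h).
rewrite (divn_eq n l); set q := (n %/ l)%N; set r := (n %% l)%N.
rewrite addnC iterD iter_arr_mul => nE.
have r0 : r = 0%N.
  case: (posnP r) => // r0; case: (@src_mid (iter q g1 h) r (src h)).
    by rewrite r0 ltn_mod.
  by rewrite nE src_arr.
move: nE; rewrite r0 /= => /arr_inj /(order_dvdn g1_inj) qh.
by rewrite add0n dvdn_mul.
Qed.

(* Locked: unification otherwise unfolds products of path algebra elements. *)
Fact Phi_key : unit. Proof. by []. Qed.
Definition Phi : path_algebra K Q1 -> path_algebra K Q2 := locked_with Phi_key
  (lin_ext (fun p => path_elt K (iota (path_src p)) (lift (path_arrows p)))).

Lemma PhiP k x y : Phi (k *: x + y) = k *: Phi x + Phi y.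
Proof. by rewrite /Phi unlock linearP. Qed.
Lemma Phi0 : Phi 0 = 0. Proof. by rewrite /Phi unlock linear0. Qed.
Lemma PhiD x y : Phi (x + y) = Phi x + Phi y.
Proof. by rewrite /Phi unlock linearD. Qed.
Lemma PhiB x y : Phi (x - y) = Phi x - Phi y.
Proof. by rewrite /Phi unlock linearB. Qed.

Lemma Phi_path v s : Phi (path_elt K v s) = path_elt K (iota v) (lift s).
Proof.
have [ws|ws] := boolP (walk v s); last first.
  by rewrite !path_elt_nwalk ?walk_lift // Phi0.
by rewrite (path_elt_walk K ws) /Phi unlock lin_ext_basis.
Qed.

Lemma PhiM x y : Phi (x * y) = Phi x * Phi y.
Proof.
move: x; apply: path_elt_ind => [|k x x' xP x'P|v s vs].
- by rewrite Phi0 [RHS]mul0r [X in Phi X]mul0r Phi0.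
- rewrite PhiP [RHS]mulrDl -[in RHS]scalerAl -xP -x'P -PhiP; congr Phi.
  by rewrite mulrDl scalerAl.
move: y; apply: path_elt_ind => [|k y y' yP y'P|w t wt].
- by rewrite Phi0 [RHS]mulr0 [X in Phi X]mulr0 Phi0.
- rewrite PhiP [RHS]mulrDr -[in RHS]scalerAr -yP -y'P -PhiP; congr Phi.
  by rewrite mulrDr scalerAr.
rewrite !Phi_path !path_elt_mul walk_end_lift (inj_eq iota_inj).
by case: ifP => _; rewrite ?Phi0 // Phi_path lift_cat.
Qed.

Definition E : path_algebra K Q2 := \sum_v path_elt K (iota v) [::].

Lemma Phi1 : Phi 1 = E.
Proof.
rewrite -[1]/(path_one K Q1) /path_one /Phi unlock linear_sum.
by apply: eq_bigr => v _; rewrite -(Phi_path v [::]) /Phi unlock.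
Qed.

Lemma cycle1 a : cycle_elt K g1 a ^+ m1 a = path_elt K (src a) (traject g1 a (order g1 a * m1 a)).
Proof. exact: cycle_eltX. Qed.

Lemma cycle2 a : cycle_elt K g2 a ^+ m2 a = path_elt K (src a) (traject g2 a (order g2 a * m2 a)).
Proof. exact: cycle_eltX. Qed.

Lemma Phi_cycle h : Phi (cycle_elt K g1 h ^+ m1 h) = cycle_elt K g2 (arr h) ^+ m2 (arr h).
Proof.
rewrite cycle1 cycle2 Phi_path lift_traject src_arr m_arr order_arr.
by rewrite (mulnAC (order g1 h) l).
Qed.

Lemma Phi_ideal x : I1 x -> I2 (Phi x).
Proof.
move=> Ix; apply: (Ix [set x | I2 (Phi x)]).
split=> [|{Ix}x [[a [b [ab nab ->]]]|[a ->]]] /=; first split=> /=.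
- by rewrite Phi0; apply: ideal0.
- by move=> y z; rewrite PhiD; apply: idealD.
- move=> a y Iy; split; [rewrite (PhiM a y) | rewrite (PhiM y a)].
    exact: idealMl.
  exact: idealMr.
- rewrite /arrow_elt -ab -[tgt a]/(walk_end (src a) [:: a]) path_elt_cat Phi_path.
  apply: nsorted_ideal => //; apply/negP => srt; case: nab; apply: arr_inj.
  rewrite -iter_arr; move: srt; rewrite /lift /= cats0.
  have -> : seg a ++ seg b = arr a :: behead (seg a ++ seg b).
    by rewrite /seg; case: l l_gt0.
  (* If sorted, the sequence would have [iter l g2 (arr a) = arr (g1 a)] at position [l], where it
     has [arr b]. *)
  move=> /sorted_traject /(congr1 (nth (arr a) ^~ l)).
  have -> : arr a :: behead (seg a ++ seg b) = seg a ++ seg b.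
    by rewrite /seg; case: l l_gt0.
  rewrite nth_cat size_traject ltnn subnn.
  have -> : nth (arr a) (seg b) 0 = arr b by rewrite /seg; case: l l_gt0.
  set n := size _; move=> ->; apply: nth_traject.
  rewrite ltnS /n size_behead size_cat !size_traject.
  by case: l l_gt0 => // k _; rewrite addSn /= addnS ltnS leq_addr.
- apply: ideal_gen; right; exists (arr a).
  by rewrite PhiB (Phi_cycle a) (Phi_cycle (bar a)) -bar_arr.
Qed.


(* The partial inverse of the injection [(v, s) |-> (iota v, lift s)] on paths; its linear extension
   [Psi] kills the ideal [I2] and satisfies [Psi (Phi x) = x] modulo [I1]. *)
Definition section_path (q : qpath Q2) : B1 :=
  if pselect (exists p : qpath Q1, val q = (iota (path_src p), lift (path_arrows p)))
    is left ex then quot_proj R1_proper (basis_path K (projT1 (cid ex))) else 0.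

Fact Psi_key : unit. Proof. by []. Qed.
Definition Psi : path_algebra K Q2 -> B1 := locked_with Psi_key (lin_ext section_path).

Lemma PsiP k x y : Psi (k *: x + y) = k *: Psi x + Psi y.
Proof. by rewrite /Psi unlock linearP. Qed.
Lemma Psi0 : Psi 0 = 0. Proof. by rewrite /Psi unlock linear0. Qed.
Lemma PsiD x y : Psi (x + y) = Psi x + Psi y.
Proof. by rewrite /Psi unlock linearD. Qed.
Lemma PsiB x y : Psi (x - y) = Psi x - Psi y.
Proof. by rewrite /Psi unlock linearB. Qed.

Lemma Psi_lift v s : Psi (path_elt K (iota v) (lift s)) = quot_proj R1_proper (path_elt K v s).
Proof.
have [ws|ws] := boolP (walk v s); last first.
  by rewrite !path_elt_nwalk ?walk_lift // Psi0 quot_proj0.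
have ws' : walk (iota v) (lift s) by rewrite walk_lift.
rewrite (path_elt_walk K ws') (path_elt_walk K ws) /Psi unlock lin_ext_basis /section_path.
case: pselect => [ex|[]]; last by exists (Sub (v, s) ws).
case: (cid ex) => p /= [/iota_inj vE /lift_inj sE]; congr (quot_proj _ (basis_path _ _)).
by apply: qpath_eq; rewrite -?vE -?sE.
Qed.

Variant Psi_spec w t : B1 -> Prop :=
  | PsiLift v s of walk v s & w = iota v & t = lift s :
      Psi_spec w t (quot_proj R1_proper (path_elt K v s))
  | PsiZero : Psi_spec w t 0.

Lemma Psi_pathP w t : Psi_spec w t (Psi (path_elt K w t)).
Proof.
have [wt|wt] := boolP (walk w t); last by rewrite path_elt_nwalk // Psi0; constructor.
have [[v [s [-> ->]]]|nex] := pselect (exists v s, w = iota v /\ t = lift s).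
  have [ws|ws] := boolP (walk v s); first by rewrite Psi_lift; apply: PsiLift.
  by rewrite path_elt_nwalk ?walk_lift // Psi0; constructor.
rewrite (path_elt_walk K wt) /Psi unlock lin_ext_basis /section_path.
case: pselect => [ex|_]; last by constructor.
by case: nex; case: ex => p [wE tE]; exists (path_src p), (path_arrows p).
Qed.

Lemma Psi_nsorted w t : ~~ sorted (frel g2) t -> Psi (path_elt K w t) = 0.
Proof.
move=> nt; case: (Psi_pathP w t) => // v s _ _ tE; apply/quot_proj_eq0.
have ns : ~~ sorted (frel g1) s by apply/negP => /sorted_lift; rewrite -tE (negbTE nt).
exact: (nsorted_ideal v ns).
Qed.

(** Serves to carry order and multiplicity over from [a], which may lie inside a replacing path, to
    the first arrow of the whole path. *)
Lemma sorted_orbit s a t n : sorted (frel g2) (s ++ traject g2 a n.+1 ++ t) ->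
  exists k b, ohead (s ++ traject g2 a n.+1 ++ t) = Some b /\ a = iter k g2 b.
Proof.
case: s => [|b s] /= st; first by exists 0%N, a.
exists (size s).+1, b; split=> //.
have st' := sorted_traject st; set c := s ++ _ in st'.
have lts : ((size s).+1 < (size c).+1)%N by rewrite ltnS size_cat /= addnS ltnS leq_addr.
by rewrite -[RHS](nth_traject g2 lts b) -st' /= nth_cat ltnn subnn.
Qed.

(** With an additional arrow the path is longer than [order g2 a * m2 a]. If it is the lift of a
    sorted path, then dividing by [l] shows that this path exceeds the bound of [long_ideal]. So the
    two terms of a relation vanish separately here. *)
Lemma Psi_cycle v s a w t : (s != [::]) || (t != [::]) ->
  Psi (path_elt K v s * (cycle_elt K g2 a ^+ m2 a) * path_elt K w t) = 0.
Proof.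
move=> st; rewrite cycle_eltX // path_elt_mul.
case: eqP => [vs|_]; last by rewrite mul0r Psi0.
rewrite path_elt_mul; case: eqP => _; last by rewrite Psi0.
rewrite -catA; set c := s ++ _.
have [cs|/Psi_nsorted -> //] := boolP (sorted (frel g2) c).
have sz : (order g2 a * m2 a < size c)%N.
  rewrite /c !size_cat size_traject addnCA -[ltnLHS]addn0 ltn_add2l.
  by rewrite addn_gt0 !lt0n !size_eq0.
case: (Psi_pathP v c) => // v' s' ws' vE cE; apply/quot_proj_eq0.
have [ss|ns] := boolP (sorted (frel g1) s'); last exact: (nsorted_ideal v' ns).
have n0 : (0 < order g2 a * m2 a)%N by rewrite muln_gt0 order_gt0 m2_gt0.
have := cs; rewrite {1}/c -(prednK n0) => /sorted_orbit [k [b []]].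
rewrite (prednK n0) -/c; case: s' ws' cE ss => [|h s'] ws' cE ss; first by rewrite cE.
have -> : ohead c = Some (arr h) by rewrite cE /lift /= /seg; case: l l_gt0.
move=> [<-] aE; case/andP: (ws') => /eqP <- _; apply: long_ideal => //.
move: sz; rewrite cE size_lift.
have -> : m2 a = m1 h by rewrite aE -m_arr; elim: k {aE} => //= k <-.
have -> : order g2 a = (order g1 h * l)%N.
  by rewrite aE -order_arr; elim: k {aE} => //= k <-; apply: orderS.
by rewrite mulnAC ltn_pmul2r.
Qed.

Lemma Psi_Phi x : Psi (Phi x) = quot_proj R1_proper x.
Proof.
move: x; apply: path_elt_ind => [|k x y xP yP|v s ws].
- by rewrite Phi0 Psi0 quot_proj0.
- rewrite PhiP PsiP xP yP quot_projD -quot_projZ.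
  by [].
- by rewrite Phi_path Psi_lift.
Qed.

(** If [src a] is some [iota v], the difference is the image of a relation under [Phi]. Otherwise
    neither cycle is a lift, as both start outside the image of [iota]. *)
Lemma Psi_cycle_diff a :
  Psi (cycle_elt K g2 a ^+ m2 a - cycle_elt K g2 (bar a) ^+ m2 (bar a)) = 0.
Proof.
have [[v av]|nv] := pselect (exists v, src a = iota v).
  have [h ->] := arr_onto av; rewrite bar_arr -(Phi_cycle h) -(Phi_cycle (bar h)).
  rewrite -PhiB Psi_Phi; apply/quot_proj_eq0.
  by apply: ideal_gen; right; exists h.
rewrite PsiB (cycle2 a) (cycle2 (bar a)) src_bar.
case: Psi_pathP => [v s _ av|]; first by case: nv; exists v.
by case: Psi_pathP => [v s _ av|]; [case: nv; exists v | rewrite subr0].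
Qed.

Lemma Psi_relation x y z : R2 x -> Psi (y * x * z) = 0.
Proof.
move=> Rx; rewrite -mulrA; move: y; apply: path_elt_ind => [|k y y' yP y'P|v s vs].
- by rewrite mul0r Psi0.
- by rewrite mulrDl -scalerAl PsiP [X in _ *: X]yP scaler0 add0r; exact: y'P.
rewrite mulrA; move: z; apply: path_elt_ind => [|k z z' zP z'P|w t wt].
- by rewrite mulr0 Psi0.
- by rewrite mulrDr -scalerAr PsiP [X in _ *: X]zP scaler0 add0r; exact: z'P.
case: Rx => [[a [b [ab nab ->]]]|[a ->]].
  rewrite /arrow_elt -ab -[tgt a]/(walk_end (src a) [:: a]) path_elt_cat.
  rewrite path_elt_mul; case: eqP => _; last by rewrite mul0r Psi0.
  rewrite path_elt_mul; case: eqP => _; last by rewrite Psi0.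
  rewrite -catA; apply: Psi_nsorted; apply/negP => /= srt; case: nab; symmetry.
  have /cat_sorted2 [_ /= /andP [/eqP]] := srt.
  by [].
have [st|] := boolP ((s != [::]) || (t != [::])).
  rewrite mulrBr mulrBl PsiB [X in X - _](Psi_cycle v a w st) sub0r.
  by rewrite [X in - X](Psi_cycle v (bar a) w st) oppr0.
rewrite negb_or !negbK => /andP [/eqP -> /eqP ->].
(* Trivial paths keep both cycles or kill both, because the closed paths at [a] and [bar a] have the
   same base vertex. *)
have cyc b : path_elt K v [::] * (cycle_elt K g2 b ^+ m2 b) * path_elt K w [::] =
    if (v == src b) && (src b == w) then cycle_elt K g2 b ^+ m2 b else 0.
  rewrite cycle2 path_elt_mul /walk_end /=; case: eqP => [->|_]; last exact: mul0r.
  by rewrite path_elt_mul cats0 walk_end_traject // iter_order_mul.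
move: (path_elt K v [::]) (path_elt K w [::]) cyc => pv pw cyc.
rewrite mulrBr mulrBl [X in X - _](cyc a) [X in _ - X](cyc (bar a)) src_bar.
case: (_ && _); first exact: (Psi_cycle_diff a).
by rewrite subr0; exact: Psi0.
Qed.

Lemma Psi_ideal x : I2 x -> Psi x = 0.
Proof.
by apply: ideal_sandwich; [exact: Psi0 | exact: PsiD | move=> *; exact: Psi_relation].
Qed.

Definition corner_unit : B2 := quot_proj R2_proper E.

Lemma E_idem : E * E = E.
Proof. by rewrite -Phi1 -PhiM mulr1. Qed.

Lemma corner_unit_idem : corner_unit * corner_unit = corner_unit.
Proof. by rewrite -[LHS]/(quot_mul _ _) quot_projM E_idem. Qed.

Lemma corner_unit_neq0 : corner_unit != 0.
Proof.
apply/eqP => /quot_proj_eq0 /Psi_ideal; rewrite -Phi1 Psi_Phi.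
by move/quot_proj_eq0.
Qed.

Definition corner_idem : idempotent_of B2 := Idempotent corner_unit_idem corner_unit_neq0.

Lemma E_path w t : (forall v, w <> iota v) -> E * path_elt K w t = 0.
Proof.
move=> nw; rewrite /E mulr_suml big1 // => v _; rewrite path_elt_mul.
by case: eqP => // /esym /nw.
Qed.

Lemma path_E w t : (forall v, walk_end w t <> iota v) -> path_elt K w t * E = 0.
Proof.
move=> nw; rewrite /E mulr_sumr big1 // => v _; rewrite path_elt_mul.
by case: eqP => // /nw.
Qed.

Lemma E_path_iota v t : E * path_elt K (iota v) t = path_elt K (iota v) t.
Proof.
rewrite /E mulr_suml (bigD1 v) //= path_elt_mul eqxx big1 ?addr0 // => w /negbTE wv.
by rewrite path_elt_mul [_ == _](inj_eq iota_inj) wv.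
Qed.

Lemma path_E_iota w t v : walk_end w t = iota v -> path_elt K w t * E = path_elt K w t.
Proof.
move=> wv; rewrite /E mulr_sumr (bigD1 v) //= path_elt_mul wv eqxx cats0.
rewrite big1 ?addr0 // => u uv; rewrite path_elt_mul wv.
by rewrite (inj_eq iota_inj) eq_sym (negbTE uv).
Qed.

(** Only paths with both ends in the image of [iota] survive the factors [E]. Such a path is in [I2]
    if unsorted and a lift if sorted; the trivial path is separate, as [lift_onto] needs a first
    arrow. *)
Lemma Phi_onto z : exists x, I2 (E * z * E - Phi x).
Proof.
move: z; apply: path_elt_ind => [|k y z [u uP] [x xP]|w t wt].
- by exists 0; rewrite mulr0 mul0r Phi0 subr0; apply: ideal0.
- exists (k *: u + x); rewrite mulrDr mulrDl PhiP opprD addrACA.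
  by apply: idealD => //; rewrite -scalerAr -scalerAl -scalerBr; apply: idealZ.
have [[v wE]|nw] := pselect (exists v, w = iota v); last first.
  exists 0; rewrite E_path ?mul0r ?Phi0 ?subr0; first exact: ideal0.
  by move=> v wE; apply: nw; exists v.
have [[u tE]|nt] := pselect (exists v, walk_end w t = iota v); last first.
  exists 0; rewrite -mulrA path_E ?mulr0 ?Phi0 ?subr0; first exact: ideal0.
  by move=> u tE; apply: nt; exists u.
rewrite {1}wE E_path_iota -wE (path_E_iota tE).
have [st|nst] := boolP (sorted (frel g2) t); last first.
  by exists 0; rewrite Phi0 subr0; apply: nsorted_ideal.
case: t wt tE st => [|a t] wt tE st.
  by exists (path_elt K v [::]); rewrite Phi_path wE subrr; apply: ideal0.
have /andP [/eqP aw _] := wt.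
have av : src a = iota v by rewrite aw.
have aend : walk_end (src a) (a :: t) = iota u by rewrite aw.
have [s sE] := lift_onto st av aend.
by exists (path_elt K v s); rewrite Phi_path -sE -wE subrr; apply: ideal0.
Qed.

Lemma corner_unit_proj z :
  corner_unit * quot_proj R2_proper z * corner_unit = quot_proj R2_proper (E * z * E).
Proof. exact/esym/(quot_proj_sandwich R2_proper E z). Qed.

Lemma E_Phi x : E * Phi x * E = Phi x.
Proof. by rewrite -Phi1 -(PhiM 1 x) -(PhiM (1 * x) 1) mulr1 mul1r. Qed.

Lemma corner_map_subproof (x : path_algebra K Q1) :
  quot_proj R2_proper (Phi x) \in corner_pred corner_idem.
Proof.
apply/asboolP; exists (quot_proj R2_proper (Phi x)).
by rewrite [RHS]corner_unit_proj E_Phi.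
Qed.

Definition corner_map (u : B1) : corner corner_idem :=
  Sub (quot_proj R2_proper (Phi (repr u))) (corner_map_subproof (repr u)).

Lemma corner_map_proj x :
  val (corner_map (quot_proj R1_proper x)) = quot_proj R2_proper (Phi x).
Proof.
apply/quot_projE; rewrite -PhiB; apply: Phi_ideal; apply/quot_projE.
by rewrite quot_projK.
Qed.

Lemma corner_map_linear : linear corner_map.
Proof.
move=> k u v; apply: val_inj.
rewrite -[RHS]/(k *: val (corner_map u) + val (corner_map v)).
rewrite -(quot_projK u) -(quot_projK v); move: (repr u) (repr v) => x y.
have -> : k *: quot_proj R1_proper x + quot_proj R1_proper y =
    quot_proj R1_proper (k *: x + y) by rewrite quot_projD quot_proj_scale.
by rewrite !corner_map_proj PhiP quot_projD quot_proj_scale.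
Qed.

Lemma corner_map_monoid : monoid_morphism corner_map.
Proof.
split; first by apply: val_inj; rewrite corner_map_proj Phi1.
move=> u v; apply: val_inj.
rewrite -[RHS]/(val (corner_map u) * val (corner_map v)).
rewrite -(quot_projK u) -(quot_projK v); move: (repr u) (repr v) => x y.
by rewrite -quot_proj_mul !corner_map_proj PhiM quot_proj_mul.
Qed.

HB.instance Definition _ := GRing.isLinear.Build K B1 (corner corner_idem) *:%R
  corner_map corner_map_linear.
HB.instance Definition _ := GRing.isMonoidMorphism.Build B1 (corner corner_idem)
  corner_map corner_map_monoid.

Lemma Psi_proj x y : quot_proj R2_proper x = quot_proj R2_proper y -> Psi x = Psi y.
Proof. by move=> /quot_projE /Psi_ideal /eqP; rewrite PsiB subr_eq0 => /eqP. Qed.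

Theorem corner_iso : exists e : idempotent_of B2, alg_isomorphic B1 (corner e).
Proof.
(* Since [Psi] vanishes on [I2], its value does not depend on the representative. [Psi_Phi] makes it
   a left inverse, and [Phi_onto] a right inverse. *)
exists corner_idem, corner_map; exists (fun y => Psi (repr (val y))).
  move=> u; rewrite -[u in RHS]quot_projK -Psi_Phi; apply: Psi_proj.
  by rewrite quot_projK.
move=> y; have := valP y => /asboolP [b yE].
have [x xP] := Phi_onto (repr b).
have yx : val y = quot_proj R2_proper (Phi x).
  by rewrite yE -(quot_projK b) [LHS]corner_unit_proj; apply/quot_projE.
have -> : Psi (repr (val y)) = quot_proj R1_proper x.
  by rewrite -Psi_Phi; apply: Psi_proj; rewrite quot_projK.
by apply: val_inj; rewrite corner_map_proj.
Qed.

End CornerIso.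

(** * Surfaces glued from triangles *)

Section Barycentric.
Variable R : realType.
Implicit Types (p q : R * R) (k j : 'I_3) (u : R).

(** Barycentric coordinates: [bary k] belongs to the corner where the side [k] starts. On the
    triangle, the side [k] is the locus [bary (ord_pred k) p = 0]. *)
Definition bary k p : R :=
  match val k with 0%N => 1 - p.1 - p.2 | 1%N => p.1 | _ => p.2 end.

Definition of_bary k (x y : R) : R * R :=
  match val k with 0%N => (x, y) | 1%N => (1 - x - y, x) | _ => (y, 1 - x - y) end.

Lemma ord3P (P : 'I_3 -> Prop) k : P k -> P (ordS k) -> P (ord_pred k) -> forall j, P j.
Proof.
have ext (i i' : 'I_3) : val i = val i' -> P i -> P i' by move=> /val_inj ->.
case: k => [[|[|[|]]]] //= ? P0 P1 P2 [[|[|[|]]]] //= ?;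
  by [move: P0; apply: ext | move: P1; apply: ext | move: P2; apply: ext].
Qed.

Lemma ord_predS k : ord_pred (ordS k) = k.
Proof. exact: ordSK. Qed.

Lemma ordSS k : ordS (ordS k) = ord_pred k.
Proof. by case: k => [[|[|[|]]]] //= ?; apply: val_inj. Qed.

Lemma ord_pred2 k : ord_pred (ord_pred k) = ordS k.
Proof. by case: k => [[|[|[|]]]] //= ?; apply: val_inj. Qed.

Lemma ordS_neq k : ordS k != k.
Proof. by case: k => [[|[|[|]]]] //=. Qed.

Lemma ord_pred_neq k : ord_pred k != k.
Proof. by case: k => [[|[|[|]]]] //=. Qed.

Lemma ordS_pred_neq k : ordS k != ord_pred k.
Proof. by case: k => [[|[|[|]]]] //=. Qed.

Lemma bary_sum k p : bary k p + bary (ordS k) p + bary (ord_pred k) p = 1.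
Proof. by case: k => [[|[|[|]]]] //= ?; rewrite /bary /=; lra. Qed.

Lemma bary_of k x y :
  [/\ bary k (of_bary k x y) = 1 - x - y, bary (ordS k) (of_bary k x y) = x
    & bary (ord_pred k) (of_bary k x y) = y].
Proof. by case: k => [[|[|[|]]]] //= ?; rewrite /bary /of_bary /=; split; lra. Qed.

Lemma bary_inj k p q : bary (ordS k) p = bary (ordS k) q ->
  bary (ord_pred k) p = bary (ord_pred k) q -> p = q.
Proof.
by case: p q k => [x y] [x' y'] [[|[|[|]]]] //= ?; rewrite /bary /= => ? ?; congr pair; lra.
Qed.

Lemma side_of_bary k u : side_point k u = of_bary k u 0.
Proof. by case: k => [[|[|[|]]]] //= ?; rewrite /side_point /of_bary /=; congr pair; lra. Qed.

Lemma bary_side k u : [/\ bary k (side_point k u) = 1 - u,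
  bary (ordS k) (side_point k u) = u & bary (ord_pred k) (side_point k u) = 0].
Proof. by rewrite side_of_bary; have [-> -> ->] := bary_of k u 0; split=> //; lra. Qed.

Definition tri p := forall k, 0 <= bary k p.

Lemma triP p : std_triangle p <-> tri p.
Proof.
split=> [[x0 y0 xy] [[|[|[|]]]] //= ?|h]; rewrite /bary /=; first lra.
have := h (Ordinal (isT : 0 < 3)%N); have := h (Ordinal (isT : 1 < 3)%N).
have := h (Ordinal (isT : 2 < 3)%N); rewrite /bary /= => ? ? ?; split; lra.
Qed.

Lemma tri_intP p : std_triangle_int p <-> forall k, 0 < bary k p.
Proof.
split=> [[x0 y0 xy] [[|[|[|]]]] //= ?|h]; rewrite /bary /=; first lra.
have := h (Ordinal (isT : 0 < 3)%N); have := h (Ordinal (isT : 1 < 3)%N).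
have := h (Ordinal (isT : 2 < 3)%N); rewrite /bary /= => ? ? ?; split; lra.
Qed.

Lemma tri_of k x y : 0 <= x -> 0 <= y -> x + y <= 1 -> tri (of_bary k x y).
Proof.
by move=> x0 y0 xy; have [h1 h2 h3] := bary_of k x y;
  apply: (@ord3P _ k); rewrite ?h1 ?h2 ?h3 //; lra.
Qed.

Lemma tri_side k u : 0 <= u <= 1 -> tri (side_point k u).
Proof. by move=> /andP [u0 u1]; rewrite side_of_bary; apply: tri_of; lra. Qed.

Lemma tri_cases p : tri p ->
  [\/ exists k, p = side_point k 0, exists k u, 0 < u < 1 /\ p = side_point k u
    | forall k, 0 < bary k p].
Proof.
move=> tp; have [[k k0]|int] := pselect (exists k, bary (ord_pred k) p = 0); last first.
  apply: Or33 => k; rewrite lt_def tp andbT; apply/eqP => k0.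
  by apply: int; exists (ordS k); rewrite ord_predS.
have [s1 s2 s3] := bary_side k (bary (ordS k) p).
have pE : p = side_point k (bary (ordS k) p) by apply: (bary_inj (k := k)); rewrite ?s2 ?s3.
have := tp (ordS k); rewrite le_eqVlt => /orP [/eqP u0|u0].
  by apply: Or31; exists k; rewrite {1}pE -u0.
have := tp k; rewrite le_eqVlt => /orP [/eqP u1|u1].
  apply: Or31; exists (ordS k); have := bary_sum k p; rewrite -u1 k0 => u1'.
  have [t1 t2 t3] := bary_side (ordS k) 0.
  apply: (bary_inj (k := ordS k)); first by rewrite t2 ordSS k0.
  by rewrite t3 ord_predS -u1.
apply: Or32; exists k, (bary (ordS k) p); split=> //.
by rewrite u0; have := bary_sum k p; lra.
Qed.

(* A retraction onto the triangle, which turns maps on the triangle into maps on the plane and so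
   avoids relative topologies. *)
Definition clamp p : R * R :=
  let x := Num.max 0 (Num.min 1 p.1) in (x, Num.max 0 (Num.min (1 - x) p.2)).

Lemma clamp_tri p : tri (clamp p).
Proof.
apply/triP; rewrite /clamp; set x := Num.max 0 (Num.min 1 p.1).
have x0 : 0 <= x by rewrite /x le_max lexx.
have x1 : x <= 1 by rewrite /x ge_max ler01 ge_min lexx.
split=> //=; first by rewrite le_max lexx.
rewrite addrC -lerBrDr ge_max ge_min lexx andbT; lra.
Qed.

Lemma clamp_id p : tri p -> clamp p = p.
Proof.
move=> /triP [x0 y0 xy]; rewrite /clamp.
have -> : Num.max 0 (Num.min 1 p.1) = p.1.
  by rewrite min_r ?max_r //; lra.
by rewrite min_r ?max_r -?surjective_pairing //; lra.
Qed.

Lemma fst_cont : continuous (fun p => p.1). Proof. by move=> p; apply: cvg_fst. Qed.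
Lemma snd_cont : continuous (fun p => p.2). Proof. by move=> p; apply: cvg_snd. Qed.

Lemma cvg_max (T : Type) (F : set_system T) (FF : Filter F) (f g : T -> R) (x y : R) :
  f @ F --> x -> g @ F --> y -> Num.max (f z) (g z) @[z --> F] --> Num.max x y.
Proof.
move=> fx gy; rewrite maxr_absE; under eq_fun do rewrite maxr_absE.
by apply: cvgMl; apply: cvgD; [apply: cvgD | apply: cvg_norm; apply: cvgB].
Qed.

Lemma cvg_min (T : Type) (F : set_system T) (FF : Filter F) (f g : T -> R) (x y : R) :
  f @ F --> x -> g @ F --> y -> Num.min (f z) (g z) @[z --> F] --> Num.min x y.
Proof.
move=> fx gy; rewrite minr_absE; under eq_fun do rewrite minr_absE.
by apply: cvgMl; apply: cvgB; [apply: cvgD | apply: cvg_norm; apply: cvgB].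
Qed.

Lemma cvg_point (T : Type) (F : set_system T) (FF : Filter F) (f g : T -> R) (x y : R) :
  f @ F --> x -> g @ F --> y -> (f z, g z) @[z --> F] --> (x, y).
Proof. exact: cvg_pair. Qed.

Lemma clamp_cont : continuous clamp.
Proof.
have c0 : continuous (fun p : R * R => Num.max 0 (Num.min 1 p.1)).
  move=> p; apply: cvg_max; first exact: cvg_cst.
  by apply: cvg_min; [exact: cvg_cst | exact: fst_cont].
move=> p; apply: cvg_point; first exact: c0.
apply: cvg_max; first exact: cvg_cst.
apply: cvg_min; last exact: snd_cont.
by apply: cvgB; [exact: cvg_cst | exact: c0].
Qed.

Lemma bary_cont k : continuous (bary k).
Proof.
case: k => [[|[|[|]]]] //= ? p; rewrite /bary /=.
- apply: cvgB; last exact: snd_cont.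
  by apply: cvgB; [exact: cvg_cst | exact: fst_cont].
- exact: fst_cont.
- exact: snd_cont.
Qed.

End Barycentric.

(** Paired sides are to be identified in opposite directions. [mate_face] makes the three sides of a
    triangle three different edges and puts every edge on two different triangles. *)
Record gluing := Gluing {
  face : finType;
  mate : face * 'I_3 -> face * 'I_3;
  mateK : involutive mate;
  mate_face : forall x, (mate x).1 != x.1;
  mate_connect : forall t t',
    connect [rel t1 t2 | [exists k, (mate (t1, k)).1 == t2]] t t';
  face0 : face }.

(** * Vertices and edges of a gluing *)

Section GluingCells.
Variable G : gluing.
Local Notation side := (face G * 'I_3)%type.
Implicit Types x y : side.

Lemma mate_neq x : mate x != x.
Proof. by apply/eqP => gx; have := mate_face x; rewrite gx eqxx. Qed.

(* A side also stands for the corner at which it starts; crossing it leads to the next corner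
   around the same vertex. *)
Definition corner_next x : side := ((mate x).1, ordS (mate x).2).

Lemma corner_next_inj : injective corner_next.
Proof.
move=> x y /eqP; rewrite xpair_eqE => /andP [/eqP h1 /eqP /(can_inj (@ordSK 3)) h2].
by apply: (can_inj (@mateK G)); rewrite [LHS]surjective_pairing h1 h2 -surjective_pairing.
Qed.

Definition corner_class : finType := {x : side | froot corner_next x == x}.

Lemma corner_class_subproof x : froot corner_next (froot corner_next x) == froot corner_next x.
Proof. by rewrite (root_root (fconnect_sym corner_next_inj)). Qed.

Definition vert x : corner_class := 
  exist (fun y => froot corner_next y == y) _ (corner_class_subproof x).

Lemma vertP x y : reflect (vert x = vert y) (fconnect corner_next x y).
Proof.
rewrite -(root_connect (fconnect_sym corner_next_inj)).
apply: (iffP eqP) => [xy|/(congr1 val) //]; exact: val_inj.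
Qed.

Lemma vert_next x : vert (corner_next x) = vert x.
Proof. by apply/esym/vertP/fconnect1. Qed.

Lemma vert_val (v : corner_class) : vert (val v) = v.
Proof. by apply: val_inj; case: v => x /= /eqP. Qed.

Definition side_rep x : side := if (enum_rank x < enum_rank (mate x))%N then x else mate x.

Lemma side_repE x : side_rep x = x \/ side_rep x = mate x.
Proof. by rewrite /side_rep; case: ifP; [left | right]. Qed.

Lemma side_rep_mate x : side_rep (mate x) = side_rep x.
Proof.
rewrite /side_rep mateK; case: ltngtP => // /ord_inj /enum_rank_inj gx.
by have := mate_neq x; rewrite gx eqxx.
Qed.

Lemma side_rep_eq x y : side_rep x = side_rep y <-> x = y \/ x = mate y.
Proof.
split=> [|[->|->]]; rewrite ?side_rep_mate //.
case: (side_repE x) => ->; case: (side_repE y) => ->; auto.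
  by move=> <-; rewrite mateK; right.
by move=> /(can_inj (@mateK G)); left.
Qed.

Definition edge : finType := {x : side | side_rep x == x}.

Lemma edge_subproof x : side_rep (side_rep x) == side_rep x.
Proof. by case: (side_repE x) => {1}->; rewrite ?side_rep_mate. Qed.

Definition edge_of x : edge := exist (fun y => side_rep y == y) _ (edge_subproof x).

Lemma edge_ofP x y : edge_of x = edge_of y <-> x = y \/ x = mate y.
Proof.
rewrite -side_rep_eq; split=> [/(congr1 val) //|xy]; exact: val_inj.
Qed.

Lemma edge_of_mate x : edge_of (mate x) = edge_of x.
Proof. by apply/edge_ofP; right. Qed.

Lemma edge_val (e : edge) : edge_of (val e) = e.
Proof. by apply: val_inj; case: e => x /= /eqP. Qed.

Lemma edge_of_inj t : injective (fun k => edge_of (t, k)).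
Proof.
move=> k j /edge_ofP [[] //|kj].
by have := mate_face (t, j); rewrite -kj eqxx.
Qed.

End GluingCells.

(** * The point set of the glued surface *)

Section GluedSurface.
Variables (R : realType) (G : gluing).
Local Notation side := (face G * 'I_3)%type.
Local Notation plane := (R * R)%type.
Implicit Types (t : face G) (k : 'I_3) (p q : plane) (x y : side).

(** A point is its open cell together with its position there: nothing for a vertex, a parameter for
    an edge, a point of the open triangle for a face. These normal forms take the place of a
    quotient. *)
Definition is_cell_point (c : corner_class G + edge G * R + face G * plane) : bool :=
  match c with
  | inl (inl _) => true
  | inl (inr eu) => 0 < eu.2 < 1
  | inr tp => [forall k, 0 < bary k tp.2]
  end.

Definition surf : Type := {c | is_cell_point c}.
HB.instance Definition _ := [isSub of surf for @sval _ _].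
HB.instance Definition _ := [Choice of surf by <:].

(* The side [x] parametrizes its edge forwards if it represents it, and backwards otherwise. *)
Definition edge_param x (u : R) : R := if side_rep x == x then u else 1 - u.

(** Corners are tested before sides because a corner lies on two sides. *)
Definition cell_point t p : corner_class G + edge G * R + face G * plane :=
  if [pick k | bary k p == 1] is Some k then inl (inl (vert (t, k)))
  else if [pick k | bary (ord_pred k) p == 0] is Some k
  then inl (inr (edge_of (t, k), edge_param (t, k) (bary (ordS k) p)))
  else inr (t, p).

Lemma is_cell_pointP t p : tri p -> is_cell_point (cell_point t p).
Proof.
move=> tp; rewrite /cell_point; case: pickP => [//|n1].
case: pickP => [k /eqP k0|n0] /=.
  have := tp (ordS k); rewrite le_eqVlt => /orP [/eqP u0|u0].
    by have := n1 k; have := bary_sum k p; rewrite k0 -u0 !addr0 => -> /eqP.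
  have := tp k; rewrite le_eqVlt => /orP [/eqP u1|u1].
    by have := n1 (ordS k); have := bary_sum k p; rewrite k0 -u1 addr0 add0r => -> /eqP.
  by have := bary_sum k p; rewrite k0 /edge_param; case: ifP => _ ?; apply/andP; split; lra.
apply/forallP => k; rewrite lt_def tp andbT.
by have := n0 (ordS k); rewrite ord_predS => ->.
Qed.

Lemma cell_point_corner t k : cell_point t (side_point k 0) = inl (inl (vert (t, k))).
Proof.
have [b1 b2 b3] := bary_side k (0 : R); rewrite subr0 in b1.
rewrite /cell_point; case: pickP => [j /eqP bj|/(_ k)]; last by rewrite b1 eqxx.
suff -> : j = k by [].
move: j bj; apply: (@ord3P (fun j => bary j (side_point k 0) = 1 -> j = k) k) => //.
  by rewrite b2 => /eqP; rewrite eq_sym oner_eq0.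
by rewrite b3 => /eqP; rewrite eq_sym oner_eq0.
Qed.

Lemma cell_point_side t k (u : R) : 0 < u < 1 ->
  cell_point t (side_point k u) = inl (inr (edge_of (t, k), edge_param (t, k) u)).
Proof.
move=> /andP [u0 u1]; have [b1 b2 b3] := bary_side k u.
rewrite /cell_point; case: pickP => [j /eqP|_].
  move=> bj; exfalso; move: j bj.
  by apply: (@ord3P (fun j => bary j (side_point k u) = 1 -> False) k);
    rewrite ?b1 ?b2 ?b3 => ?; lra.
case: pickP => [j /eqP|/(_ k)]; last by rewrite b3 eqxx.
move=> bj; suff -> : j = k by rewrite b2.
move: j bj; apply: (@ord3P (fun j => bary (ord_pred j) (side_point k u) = 0 -> j = k) k) => //.
- by rewrite ord_predS b1 => ?; exfalso; lra.
- by rewrite ord_pred2 b2 => ?; exfalso; lra.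
Qed.

Lemma cell_point_int t p : (forall k, 0 < bary k p) -> cell_point t p = inr (t, p).
Proof.
move=> p0; rewrite /cell_point; case: pickP => [k /eqP k1|_].
  exfalso; have := bary_sum k p; have := p0 (ordS k); have := p0 (ord_pred k).
  by rewrite k1; lra.
by case: pickP => [k /eqP k0|//]; have := p0 (ord_pred k); rewrite k0 ltxx.
Qed.

Definition surf_pt t p : surf := Sub (cell_point t (clamp p)) (is_cell_pointP t (clamp_tri p)).

Lemma val_surf_pt t p : tri p -> val (surf_pt t p) = cell_point t p.
Proof. by move=> tp; rewrite /= clamp_id. Qed.

Definition surf_rep (s : surf) : face G * plane :=
  match val s with
  | inl (inl v) => ((val v).1, side_point (val v).2 0)
  | inl (inr eu) => ((val eu.1).1, side_point (val eu.1).2 eu.2)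
  | inr tp => tp
  end.

Lemma tri_corner k : tri (side_point k (0 : R)).
Proof. by apply: tri_side; rewrite lexx ler01. Qed.

Lemma surf_rep_tri s : tri (surf_rep s).2.
Proof.
case: s => [[[v|[e u]]|[t p]] sP]; rewrite /surf_rep /=.
- exact: tri_corner.
- by apply: tri_side; case/andP: sP => /ltW -> /ltW ->.
- by move=> k; apply/ltW; move/forallP: sP; apply.
Qed.

Lemma surf_repK s : surf_pt (surf_rep s).1 (surf_rep s).2 = s.
Proof.
apply: val_inj; rewrite val_surf_pt; last exact: surf_rep_tri.
case: s => [[[v|[e u]]|[t p]] sP]; rewrite /surf_rep /=.
- by rewrite cell_point_corner -surjective_pairing vert_val.
- rewrite cell_point_side //= -surjective_pairing edge_val /edge_param.
  by rewrite (eqP (valP e)) eqxx.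
- have p0 : forall k, 0 < bary k p by move=> k; move/forallP: sP; apply.
  by rewrite cell_point_int.
Qed.

Definition compatible (T : Type) (phi : face G -> plane -> T) : Prop :=
  forall x u, 0 <= u <= 1 ->
    phi x.1 (side_point x.2 u) = phi (mate x).1 (side_point (mate x).2 (1 - u)).

Definition lift_surf (T : Type) (phi : face G -> plane -> T) (s : surf) : T :=
  phi (surf_rep s).1 (surf_rep s).2.

Lemma side_point1 k : side_point k 1 = side_point (ordS k) 0 :> plane.
Proof.
have [a1 a2 a3] := bary_side k (1 : R); have [b1 b2 b3] := bary_side (ordS k) (0 : R).
by apply: (bary_inj (k := k)); rewrite ?a2 ?a3 ?b1 -?ordSS ?b2; lra.
Qed.

(** [surf_rep] chooses one preimage of each point, so the value must not depend on the choice. At a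
    vertex this follows by turning around it with [corner_next], each step being compatibility at
    parameter 0. *)
Lemma lift_surfE (T : Type) (phi : face G -> plane -> T) t p :
  compatible phi -> tri p -> lift_surf phi (surf_pt t p) = phi t p.
Proof.
move=> phiC tp; rewrite /lift_surf /surf_rep val_surf_pt //.
case: (tri_cases tp) => [[k ->]|[k [u [u01 ->]]]|p0].
- rewrite cell_point_corner /=; set x := (t, k).
  suff phiV y : fconnect (@corner_next G) x y ->
      phi x.1 (side_point x.2 0) = phi y.1 (side_point y.2 0).
    by rewrite -phiV //; apply: connect_root.
  move=> /iter_findex <-; elim: (findex _ _ _) => // n -> /=.
  rewrite phiC ?lexx ?ler01 // subr0 side_point1.
  by [].
- rewrite cell_point_side //=.
  have [uw ul] : 0 <= u <= 1 /\ 0 <= 1 - u <= 1.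
    by case/andP: u01 => ? ?; split; apply/andP; split; lra.
  rewrite /edge_param; case: eqP => [-> //|nx].
  by case: (side_repE (t, k)) => // -> ; rewrite -(phiC (t, k)).
- by rewrite cell_point_int.
Qed.

Lemma surf_pt_mate : compatible surf_pt.
Proof.
move=> x u u01.
have u01' : 0 <= 1 - u <= 1 by case/andP: u01 => ? ?; apply/andP; split; lra.
apply: val_inj; rewrite !val_surf_pt; try exact: tri_side.
case/andP: u01 => u0 u1; move: u0; rewrite le_eqVlt => /orP [/eqP <-|u0].
  rewrite subr0 side_point1 !cell_point_corner -!surjective_pairing -/(corner_next x).
  by rewrite vert_next.
move: u1; rewrite le_eqVlt => /orP [/eqP ->|u1].
  rewrite subrr side_point1 !cell_point_corner; congr (inl (inl _)).
  rewrite -[RHS]vert_next /corner_next -surjective_pairing mateK.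
  by [].
rewrite !cell_point_side; [|lra..]; rewrite -!surjective_pairing edge_of_mate.
congr (inl (inr (_, _))); rewrite /edge_param side_rep_mate.
case: (side_repE x) => ->; rewrite eqxx; last by rewrite (negbTE (mate_neq x)).
by rewrite eq_sym (negbTE (mate_neq x)); lra.
Qed.

End GluedSurface.

(** * Charts *)

Section Charts.
Variables (R : realType) (S : topologicalType).
Implicit Types (f : S -> R * R) (psi : S -> R) (s : S).

Lemma open_pos (T : topologicalType) (psi : T -> R) : continuous psi -> open [set s | 0 < psi s].
Proof. by move=> /continuousP/(_ _ (@open_gt R 0)). Qed.

Lemma plane_hausdorff : hausdorff_space (R * R)%type.
Proof. exact: norm_hausdorff. Qed.

(* The closed sets [{psi >= e}] are compact and [f] maps them onto [{omega >= e}], so that no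
   invariance of domain is needed for the continuity of the inverse. *)
Lemma chart_of f psi (omega : R * R -> R) :
  compact [set: S] -> continuous psi -> continuous omega ->
  (forall s, 0 < psi s -> psi s = omega (f s)) ->
  (forall z, 0 < omega z -> exists2 s, 0 < psi s & f s = z) ->
  (forall s s', 0 < psi s -> 0 < psi s' -> f s = f s' -> s = s') ->
  (forall s, 0 < psi s -> {for s, continuous f}) ->
  forall s, 0 < psi s -> has_chart [set: R * R] s.
Proof.
move=> cS cpsi comega psiE fonto finj cf s0 s0P.
pose g z := if pselect (exists2 s, 0 < psi s & f s = z) is left ex
  then projT1 (cid2 ex) else s0.
have gP z : 0 < omega z -> 0 < psi (g z) /\ f (g z) = z.
  move=> /fonto ex; rewrite /g; case: pselect => // ex'.
  by case: (cid2 ex').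
have fP s : 0 < psi s -> 0 < omega (f s) by move=> s1; rewrite -psiE.
exists [set s | 0 < psi s], [set z | 0 < omega z], f, g; split.
- by split=> //; apply: open_pos.
- exact: open_pos.
- rewrite setIT; apply/seteqP; split=> [_ [s sP <-]|z /fonto [s sP sz]]; first exact: fP.
  by exists s.
- split.
    apply/subspace_continuousP => s sP; apply: cvg_within_filter.
    exact: cf.
  rewrite setIT; apply/subspace_continuousP => z zP; apply: cvg_within_filter.
  (* Near [z] the function [omega] stays above the level [e], which keeps the preimages in the
     compact set where [psi] is at least [e]. *)
  move=> N gN; have z0 : 0 < omega z := zP; pose e := omega z / 2.
  have e0 : 0 < e by rewrite divr_gt0.
  pose D := [set s | e <= psi s] `&` ~` N^°.
  have cD : compact D.
    apply: (subclosed_compact _ cS) => //; apply: closedI; last exact/open_closedC/open_interior.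
    by apply: (@closed_comp _ _ psi _ _ (@closed_ge R e)) => x _; exact: cpsi.
  have cfD : closed (f @` D).
    apply: compact_closed; first exact: plane_hausdorff.
    apply: continuous_compact => //; apply/subspace_continuousP => s [sP _].
    by apply: cvg_within_filter; apply: cf; apply: lt_le_trans sP.
  have zfD : ~ (f @` D) z.
    move=> [s [sP sN] sz]; apply: sN; have [g0 fg] := gP z zP.
    have -> : s = g z by apply: finj; rewrite ?sz ?fg //; apply: lt_le_trans sP.
    exact: gN.
  have nz : nbhs z (~` (f @` D)).
    by apply: open_nbhs_nbhs; split=> //; apply: closed_openC.
  have no : nbhs z [set w | 0 < omega w - e].
    apply: open_nbhs_nbhs; split; last by rewrite /= /e; lra.
    by apply: open_pos => w; apply: cvgB; [exact: comega | exact: cvg_cst].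
  rewrite /nbhs /=; apply: filterS2 nz no => w wD; rewrite /= => we.
  have [g1 fg] : 0 < psi (g w) /\ f (g w) = w by apply: gP; lra.
  have [//|nN] := pselect (N^° (g w)); first exact: interior_subset.
  by case: wD; exists (g w) => //; split=> //=; rewrite psiE // fg; lra.
- move=> s sP; have [g1 fg] := gP _ (fP s sP).
  exact: finj.
Qed.

(** Each [psi] is continuous on all of [S], so points without disjoint neighbourhoods have the same
    value under it. They therefore lie in a common chart domain, where [f] separates them. *)
Lemma hausdorff_of_charts :
  (forall s, exists f psi, [/\ continuous psi, 0 < psi s,
    (forall s s', 0 < psi s -> 0 < psi s' -> f s = f s' -> s = s') &
    (forall s, 0 < psi s -> {for s, continuous f})]) ->
  hausdorff_space S.
Proof.
move=> charts s s' ss'; have [f [psi [cpsi sP finj cf]]] := charts s.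
have psiE : psi s = psi s'.
  apply: (@Rhausdorff R) => A B nA nB.
  have [y [yA yB]] := ss' _ _ (cpsi s _ nA) (cpsi s' _ nB).
  by exists (psi y).
have s'P : 0 < psi s' by rewrite -psiE.
apply: finj => //; apply: plane_hausdorff => A B nA nB.
have [y [yA yB]] := ss' _ _ (cf s sP _ nA) (cf s' s'P _ nB).
by exists (f y).
Qed.

End Charts.

(** * Topology of the glued surface: compactness and connectedness *)

Section SurfaceTopology.
Variables (R : realType) (G : gluing).
Local Notation plane := (R * R)%type.
Local Notation S := (surf R G).

(* The final topology with respect to the triangles. *)
Definition surf_open (U : set S) : Prop := forall t, open (@surf_pt R G t @^-1` U).

Lemma surf_openT : surf_open setT.
Proof. by move=> t; rewrite preimage_setT; apply: openT. Qed.

Lemma surf_openI : setI_closed surf_open.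
Proof. by move=> U V oU oV t; rewrite preimage_setI; apply: openI. Qed.

Lemma surf_open_bigcup (I : Type) (U : I -> set S) :
  (forall i, surf_open (U i)) -> surf_open (\bigcup_i U i).
Proof. by move=> oU t; rewrite preimage_bigcup; apply: bigcup_open => i _; apply: oU. Qed.

HB.instance Definition _ :=
  isOpenTopological.Build S surf_openT surf_openI surf_open_bigcup.

Lemma surf_pt_cont t : continuous (@surf_pt R G t).
Proof. by apply/continuousP => U; apply. Qed.

Lemma surf_pt_clamp t p : surf_pt t (clamp p) = @surf_pt R G t p.
Proof. by apply: val_inj; rewrite /= (clamp_id (clamp_tri p)). Qed.

Lemma lift_surf_clamp (T : Type) (phi : face G -> plane -> T) t p :
  compatible phi -> lift_surf phi (surf_pt t p) = phi t (clamp p).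
Proof. by move=> phiC; rewrite -surf_pt_clamp lift_surfE //; apply: clamp_tri. Qed.

(** Restricted to an open set [U] because the chart maps are cut off to 0 outside their domains and
    may jump there. *)
Lemma lift_surf_cont (T : topologicalType) (phi : face G -> plane -> T) (U : set S) :
  compatible phi -> open U ->
  (forall t p, U (surf_pt t p) -> {for p, continuous (phi t \o @clamp R)}) ->
  forall s, U s -> {for s, continuous (lift_surf phi)}.
Proof.
move=> phiC oU cphi s sU N nN; rewrite /= nbhsE.
exists (U `&` lift_surf phi @^-1` N^°); last by move=> s' [_] /interior_subset.
split; last by split=> //; exact: nN.
move=> t; rewrite openE => p [/= pU]; rewrite lift_surf_clamp // => pN.
have nU : nbhs p (@surf_pt R G t @^-1` U) by apply: open_nbhs_nbhs; split=> //; exact: oU.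
have := cphi t p pU _ (nbhs_interior pN); apply: filterS2 nU => q /= qU qN.
by split=> //=; rewrite lift_surf_clamp.
Qed.

Lemma compact_std_triangle : compact (@std_triangle R).
Proof.
have -> : @std_triangle R = @clamp R @` (`[0, 1] `*` `[0, 1]).
  apply/seteqP; split=> [p /triP tp|_ [p _ <-]]; last exact/triP/clamp_tri.
  exists p; last exact: clamp_id.
  have /triP [x0 y0 xy] := tp.
  by split; rewrite /= in_itv /=; apply/andP; split; lra.
apply: continuous_compact; last by apply: compact_setX; exact: segment_compact.
exact/continuous_subspaceT/clamp_cont.
Qed.

Lemma surf_compact : compact [set: S].
Proof.
have -> : [set: S] = \big[setU/set0]_(t <- enum (face G)) (@surf_pt R G t @` @std_triangle R).
  apply/seteqP; split=> [s _|//]; rewrite -(bigcup_seq (enum (face G))).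
  exists (surf_rep s).1; first by rewrite /= mem_enum.
  by exists (surf_rep s).2; [exact/triP/surf_rep_tri | exact: surf_repK].
apply: bigsetU_compact => t _; apply: continuous_compact; last exact: compact_std_triangle.
exact/continuous_subspaceT/surf_pt_cont.
Qed.

Lemma plane_clopen (B : set plane) p q : open B -> closed B -> B p -> B q.
Proof.
move=> oB cB Bp.
pose h (u : R) : plane := ((1 - u) * p.1 + u * q.1, (1 - u) * p.2 + u * q.2).
have ch : continuous h.
  have cl (a b : R) : continuous (fun u : R => (1 - u) * a + u * b).
    move=> u; apply: cvgD; first by apply: cvgMl; apply: cvgB; [exact: cvg_cst | exact: cvg_id].
    by apply: cvgMl; exact: cvg_id.
  by move=> u; apply: cvg_point; apply: cl.
have h0 : h 0 = p by rewrite /h subr0 !mul1r !mul0r !addr0 -surjective_pairing.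
have h1 : h 1 = q by rewrite /h subrr !mul1r !mul0r !add0r -surjective_pairing.
have hB : `[0, 1] `&` h @^-1` B = `[0, 1]%classic.
  apply: (@segment_connected R 0 1).
  - by exists 0; split; rewrite /= ?h0 // in_itv /= lexx ler01.
  - by exists (h @^-1` B) => //; move/continuousP: ch; apply.
  - by exists (h @^-1` B) => //; apply: closed_comp cB => u _; exact: ch.
have : (`[0, 1] `&` h @^-1` B) 1 by rewrite hB /= in_itv /= lexx ler01.
by move=> [_ /=]; rewrite h1.
Qed.

(** An open and closed set contains all or nothing of a triangle, and adjacent triangles share a
    corner through which to pass. *)
Lemma surf_connected : connected [set: S].
Proof.
move=> B [s0 Bs0] [C oC BC] [D cD BD].
rewrite setTI in BC; rewrite setTI in BD.
have oB : open B by rewrite BC.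
have cB : closed B by rewrite BD.
have cst t p q : B (surf_pt t p) -> B (surf_pt t q).
  apply: (@plane_clopen (@surf_pt R G t @^-1` B)); first exact: oB.
  by apply: closed_comp cB => u _; exact: surf_pt_cont.
apply/seteqP; split=> // s _; rewrite -(surf_repK s).
move: (surf_rep s) => [t p] /=; apply: (cst t (0, 0)).
have Bt0 : B (surf_pt (surf_rep s0).1 (0, 0)).
  by apply: (cst _ (surf_rep s0).2); rewrite surf_repK.
case/connectP: (mate_connect (surf_rep s0).1 t) => c cP ->.
elim: c (surf_rep s0).1 Bt0 cP => //= t' c IH t0 Bt0 /andP [/existsP [k /eqP kt] cP].
apply: IH cP; rewrite -kt.
have := @surf_pt_mate R G (t0, k) 0; rewrite lexx ler01 => /(_ isT) ptE.
by apply: (cst _ (side_point (mate (t0, k)).2 (1 - 0))); rewrite -ptE; apply: cst Bt0.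
Qed.

End SurfaceTopology.

(** * Functions assembled from the sides or corners of triangles *)

Section SideSums.
Variables (R : realType) (G : gluing).
Local Notation plane := (R * R)%type.
Local Notation side := (face G * 'I_3)%type.
Local Notation S := (surf R G).
Implicit Types (t : face G) (k : 'I_3) (p q : plane) (x y : side).

Lemma sum_ord3 (V : zmodType) (F : 'I_3 -> V) k :
  \sum_j F j = F k + F (ordS k) + F (ord_pred k).
Proof.
rewrite (bigD1 k) //= (bigD1 (ordS k)) ?ordS_neq //= (bigD1 (ord_pred k)) /=; last first.
  by rewrite ord_pred_neq eq_sym ordS_pred_neq.
rewrite big1 ?addr0 ?addrA // => j /andP [/andP [jk jS] jP]; move: jk jS jP.
by move: j; apply: (@ord3P (fun j => j != k -> j != ordS k -> j != ord_pred k -> F j = 0) k);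
  rewrite ?eqxx.
Qed.

(** On a given side the summands of the other two sides vanish, each having an end coordinate equal
    to 0 there. Only the summand of that side has to match across the gluing. *)
Lemma compatible_side_sum (V : zmodType) (phi : side -> plane -> V) :
  (forall x u, 0 <= u <= 1 ->
    phi x (side_point x.2 u) = phi (mate x) (side_point (mate x).2 (1 - u))) ->
  (forall x p, tri p -> bary x.2 p = 0 \/ bary (ordS x.2) p = 0 -> phi x p = 0) ->
  compatible (fun t p => \sum_k phi (t, k) p).
Proof.
move=> phiM phi0 x u u01.
have side_sum y v : 0 <= v <= 1 ->
    \sum_k phi (y.1, k) (side_point y.2 v) = phi y (side_point y.2 v).
  move=> v01; have [b1 b2 b3] := bary_side y.2 v; have tv := @tri_side R y.2 v v01.
  rewrite (sum_ord3 _ y.2) -surjective_pairing.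
  rewrite (phi0 (y.1, ordS y.2)) ?addr0 //=; last by right; rewrite ordSS.
  by rewrite (phi0 (y.1, ord_pred y.2)) ?addr0 //=; left.
have u01' : 0 <= 1 - u <= 1 by case/andP: u01 => ? ?; apply/andP; split; lra.
by rewrite !side_sum // phiM.
Qed.

(** Along a side only the summands of its two end corners survive. Crossing it takes the corner [x]
    to [corner_next x] and the other end to [mate x]. *)
Lemma compatible_corner_sum (V : zmodType) (phi : side -> plane -> V) :
  (forall x u, 0 <= u <= 1 ->
    phi x (side_point x.2 u) = phi (corner_next x) (side_point (mate x).2 (1 - u))) ->
  (forall x p, bary x.2 p = 0 -> phi x p = 0) ->
  compatible (fun t p => \sum_k phi (t, k) p).
Proof.
move=> phiM phi0 x u u01.
have corner_sum y v : \sum_k phi (y.1, k) (side_point y.2 v) =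
    phi y (side_point y.2 v) + phi (y.1, ordS y.2) (side_point y.2 v).
  have [b1 b2 b3] := bary_side y.2 v.
  rewrite (sum_ord3 _ y.2) -surjective_pairing.
  by rewrite (phi0 (y.1, ord_pred y.2)) ?addr0.
have u01' : 0 <= 1 - u <= 1 by case/andP: u01 => ? ?; apply/andP; split; lra.
rewrite !corner_sum phiM // addrC; congr (_ + _).
by rewrite (phiM (mate x)) // /corner_next mateK subKr.
Qed.

Lemma lift_surf_continuous (T : topologicalType) (phi : face G -> plane -> T) :
  compatible phi -> (forall t, continuous (phi t)) -> continuous (lift_surf phi).
Proof.
move=> phiC cphi s; apply: (lift_surf_cont (U := setT)) => //; first exact: openT.
move=> t p _; apply: continuous_comp; first exact: clamp_cont.
exact: cphi.
Qed.

Lemma sum_ord3_continuous (phi : 'I_3 -> plane -> R) :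
  (forall k, continuous (phi k)) -> continuous (fun p => \sum_k phi k p).
Proof.
move=> cphi; have -> : (fun p => \sum_k phi k p) =
    (fun p => phi ord0 p + phi (ordS ord0) p + phi (ord_pred ord0) p).
  by apply/funext => p; apply: sum_ord3.
by move=> p; apply: cvgD; [apply: cvgD|]; apply: cphi.
Qed.

End SideSums.

(** * Charts along the edges *)

Section EdgeCharts.
Variables (R : realType) (G : gluing) (e : edge G).
Local Notation plane := (R * R)%type.
Local Notation side := (face G * 'I_3)%type.
Local Notation S := (surf R G).
Implicit Types (t : face G) (k : 'I_3) (p q : plane) (x y : side).

(** On the triangles, positive exactly on the open edge and the open triangles along it, which form
    the domain of the chart. *)
Definition edge_dist t p : R :=
  \sum_k if edge_of (t, k) == e then Num.min (bary k p) (bary (ordS k) p) else 0.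

(** Unfolds the two triangles along the edge, which becomes a segment of the first axis: the
    triangle of [val e] lies above, its mate below. On the mate the first coordinate is [bary x.2]
    because the gluing reverses the side. *)
Definition edge_coord x p : plane :=
  if x == val e then (bary (ordS x.2) p, bary (ord_pred x.2) p)
  else (bary x.2 p, - bary (ord_pred x.2) p).

Definition edge_chart t p : plane :=
  \sum_k if [&& edge_of (t, k) == e, 0 < bary k p & 0 < bary (ordS k) p]
         then edge_coord (t, k) p else 0.

Lemma edge_of_val x : edge_of x = e -> x = val e \/ mate x = val e /\ x != val e.
Proof.
move=> xe; have : side_rep x = val e by rewrite -xe.
case: (side_repE x) => -> <-; first by left.
by right; rewrite eq_sym mate_neq.
Qed.

Lemma edge_dist_compatible : compatible edge_dist.
Proof.
apply: (compatible_side_sum (phi := fun x p =>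
  if edge_of x == e then Num.min (bary x.2 p) (bary (ordS x.2) p) else 0)) => [x u _|x p tp].
  have [-> -> _] := bary_side x.2 u; have [-> -> _] := bary_side (mate x).2 (1 - u).
  by rewrite edge_of_mate subKr minC.
have := tp x.2; have := tp (ordS x.2) => h1 h2 [->|->]; case: ifP => // _.
  by rewrite min_l.
by rewrite min_r.
Qed.

Lemma edge_chart_compatible : compatible edge_chart.
Proof.
apply: (compatible_side_sum (phi := fun x p =>
  if [&& edge_of x == e, 0 < bary x.2 p & 0 < bary (ordS x.2) p]
  then edge_coord x p else 0)) => [x u _|x p tp]; last first.
  by move=> [->|->]; rewrite ltxx ?andbF.
rewrite /edge_coord; have [-> -> ->] := bary_side x.2 u.
have [-> -> ->] := bary_side (mate x).2 (1 - u).
rewrite edge_of_mate subKr [X in _ && X]andbC.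
case: eqP => //= xe; case: ifP => // _; rewrite oppr0.
case: (edge_of_val xe) => [xv|[-> /negbTE ->]]; last by rewrite eqxx.
by rewrite xv eqxx (negbTE (mate_neq _)).
Qed.

Lemma edge_sum (V : zmodType) (F : 'I_3 -> V) t k : edge_of (t, k) = e ->
  \sum_j (if edge_of (t, j) == e then F j else 0) = F k.
Proof.
move=> te; rewrite (bigD1 k) //= te eqxx big1 ?addr0 // => j jk.
by case: eqP => // je; case/eqP: jk; apply: (@edge_of_inj _ t); rewrite te.
Qed.

Lemma edge_distE t k p : edge_of (t, k) = e ->
  edge_dist t p = Num.min (bary k p) (bary (ordS k) p).
Proof. by move=> te; rewrite /edge_dist (edge_sum _ te). Qed.

Lemma edge_chartE t k p : edge_of (t, k) = e ->
  0 < bary k p -> 0 < bary (ordS k) p -> edge_chart t p = edge_coord (t, k) p.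
Proof.
move=> te k0 k1; rewrite /edge_chart -[RHS](_ : (if [&& true, 0 < bary k p & 0 < bary (ordS k) p]
  then edge_coord (t, k) p else 0) = _); last by rewrite k0 k1.
rewrite -(edge_sum (fun j => if [&& true, 0 < bary j p & 0 < bary (ordS j) p] then
  edge_coord (t, j) p else 0) te).
by apply: eq_bigr => j _; case: eqP.
Qed.

Lemma edge_dist_pos t p : 0 < edge_dist t p ->
  exists2 k, edge_of (t, k) = e & 0 < bary k p /\ 0 < bary (ordS k) p.
Proof.
have [[k te]|ne] := pselect (exists k, edge_of (t, k) = e).
  by rewrite (edge_distE _ te) lt_min => /andP [k0 k1]; exists k.
rewrite /edge_dist big1 ?ltxx // => k _; case: eqP => // te.
by case: ne; exists k.
Qed.

Lemma edge_dist_continuous : continuous (lift_surf edge_dist).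
Proof.
apply: lift_surf_continuous; first exact: edge_dist_compatible.
move=> t; apply: sum_ord3_continuous => k; case: (_ == e) => p; last exact: cvg_cst.
by apply: cvg_min; exact: bary_cont.
Qed.

Lemma edge_coord_continuous x : continuous (edge_coord x).
Proof.
move=> p; rewrite /edge_coord; case: (x == val e); apply: cvg_point; try exact: bary_cont.
by apply: cvgN; exact: bary_cont.
Qed.

Lemma edge_dist_open : open [set s | 0 < lift_surf edge_dist s].
Proof. exact/open_pos/edge_dist_continuous. Qed.

Lemma edge_chart_continuous s : 0 < lift_surf edge_dist s ->
  {for s, continuous (lift_surf edge_chart)}.
Proof.
apply: (lift_surf_cont edge_chart_compatible edge_dist_open) => t p /=.
rewrite lift_surf_clamp; last exact: edge_dist_compatible.
move=> /edge_dist_pos [k te [k0 k1]].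
have cb j : continuous (fun q => bary j (@clamp R q)).
  move=> q; apply: (continuous_comp (g := bary j)); first exact: clamp_cont.
  exact: bary_cont.
have n0 : \forall q \near p, 0 < bary k (clamp q).
  by apply: open_nbhs_nbhs; split; [exact/open_pos/cb | exact: k0].
have n1 : \forall q \near p, 0 < bary (ordS k) (clamp q).
  by apply: open_nbhs_nbhs; split; [exact/open_pos/cb | exact: k1].
have ce : {for p, continuous (edge_coord (t, k) \o @clamp R)}.
  by apply: continuous_comp; [exact: clamp_cont | exact: edge_coord_continuous].
have pE : (edge_chart t \o @clamp R) p = edge_coord (t, k) (clamp p).
  by rewrite /= (edge_chartE te k0 k1).
have {}ce : (edge_coord (t, k) \o @clamp R) @ p --> (edge_chart t \o @clamp R) p.
  by rewrite pE; exact: ce.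
apply: cvg_trans ce; apply: near_eq_cvg.
by near=> q; rewrite /= (@edge_chartE _ k) //; [near: q | near: q].
Unshelve. all: by end_near. Qed.


Variant edge_point_spec s : Prop :=
  EdgePoint x p of edge_of x = e & tri p & s = surf_pt x.1 p & 0 < bary x.2 p
    & 0 < bary (ordS x.2) p & lift_surf edge_chart s = edge_coord x p
    & lift_surf edge_dist s = Num.min (bary x.2 p) (bary (ordS x.2) p).

Lemma edge_pointE x p : edge_of x = e -> tri p -> 0 < bary x.2 p -> 0 < bary (ordS x.2) p ->
  lift_surf edge_chart (surf_pt x.1 p) = edge_coord x p /\
  lift_surf edge_dist (surf_pt x.1 p) = Num.min (bary x.2 p) (bary (ordS x.2) p).
Proof.
case: x => t k xe tp k0 k1.
rewrite (lift_surfE _ edge_chart_compatible tp) (lift_surfE _ edge_dist_compatible tp).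
by rewrite (edge_chartE xe k0 k1) (edge_distE _ xe).
Qed.

Lemma edge_pointP s : 0 < lift_surf edge_dist s -> edge_point_spec s.
Proof.
rewrite -(surf_repK s); have := surf_rep_tri s; move: (surf_rep s) => [t p] /= tp.
rewrite (lift_surfE _ edge_dist_compatible tp) => /edge_dist_pos [k te [k0 k1]].
have [h1 h2] := @edge_pointE (t, k) p te tp k0 k1.
exact: (@EdgePoint _ (t, k) p).
Qed.

Lemma edge_chart_inj s s' : 0 < lift_surf edge_dist s -> 0 < lift_surf edge_dist s' ->
  lift_surf edge_chart s = lift_surf edge_chart s' -> s = s'.
Proof.
(* Equal images from opposite triangles have a second coordinate that is both nonnegative and
   nonpositive, so the two points lie on the glued side. *)
have cross x p p' : x = val e -> tri p -> tri p' ->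
    edge_coord x p = edge_coord (mate x) p' -> surf_pt x.1 p = surf_pt (mate x).1 p'.
  move=> xe tp tp'; rewrite /edge_coord xe eqxx (negbTE (mate_neq _)) -xe => -[bS bP].
  have P0 : bary (ord_pred x.2) p = 0.
    by have := tp (ord_pred x.2); have := tp' (ord_pred (mate x).2); lra.
  have P0' : bary (ord_pred (mate x).2) p' = 0 by lra.
  have u01 : 0 <= bary (ordS x.2) p <= 1.
    rewrite tp /=; have := tp x.2; have := bary_sum x.2 p; lra.
  have [b1 b2 b3] := bary_side x.2 (bary (ordS x.2) p).
  have [c1 c2 c3] := bary_side (mate x).2 (1 - bary (ordS x.2) p).
  have := @surf_pt_mate R G x _ u01.
  have -> : side_point x.2 (bary (ordS x.2) p) = p.
    by apply: (bary_inj (k := x.2)); rewrite ?b2 ?b3.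
  have -> // : side_point (mate x).2 (1 - bary (ordS x.2) p) = p'.
  apply: (bary_inj (k := (mate x).2)); rewrite ?c2 ?c3 //.
  by have := bary_sum (mate x).2 p'; lra.
move=> /edge_pointP [x p xe tp -> _ _ -> _] /edge_pointP [y q ye tq -> _ _ -> _].
case: (edge_of_val xe) => [xv|[xv nx]]; case: (edge_of_val ye) => [yv|[yv ny]].
- rewrite xv yv /edge_coord eqxx => -[h1 h2]; congr surf_pt.
  exact: (bary_inj h1 h2).
- have -> : y = mate x by rewrite xv -yv mateK.
  by move=> /cross; apply.
- have -> : x = mate y by rewrite yv -xv mateK.
  by move=> /esym /cross -> //.
- have -> : x = y by apply: (can_inj (@mateK G)); rewrite xv.
  rewrite /edge_coord (negbTE ny) => -[h1 /oppr_inj h2]; congr surf_pt.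
  apply: (bary_inj (k := y.2)) => //.
  by have := bary_sum y.2 p; have := bary_sum y.2 q; lra.
Qed.

(** [edge_dist] in chart coordinates: the arguments of the minimum are the two end coordinates, in
    an order that depends on the half-plane. *)
Definition edge_height (z : plane) : R := Num.min z.1 (1 - z.1 - `|z.2|).

Lemma edge_height_continuous : continuous edge_height.
Proof.
move=> z; apply: cvg_min; first exact: fst_cont.
apply: cvgB; last by apply: cvg_norm; exact: snd_cont.
by apply: cvgB; [exact: cvg_cst | exact: fst_cont].
Qed.

Lemma edge_distE_height s : 0 < lift_surf edge_dist s ->
  lift_surf edge_dist s = edge_height (lift_surf edge_chart s).
Proof.
move=> /edge_pointP [x p xe tp _ _ _ -> ->]; rewrite /edge_height /edge_coord.
have := tp (ord_pred x.2); have := bary_sum x.2 p => sp P0.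
case: ifP => _ /=; rewrite ?normrN ger0_norm //; last by congr Num.min; lra.
by rewrite minC; congr Num.min; lra.
Qed.

Lemma edge_chart_onto z : 0 < edge_height z ->
  exists2 s, 0 < lift_surf edge_dist s & lift_surf edge_chart s = z.
Proof.
rewrite /edge_height lt_min => /andP [z1 z2].
have [z0|z0] := leP 0 z.2.
  rewrite ger0_norm // in z2.
  have [b1 b2 b3] := bary_of (val e).2 z.1 z.2; set p := of_bary _ _ _ in b1 b2 b3.
  have tp : tri p by apply: tri_of; lra.
  have [|||h1 h2] := @edge_pointE (val e) p _ tp; first exact: edge_val.
  - by rewrite b1; lra.
  - by rewrite b2.
  exists (surf_pt (val e).1 p); first by rewrite h2 b1 b2 lt_min z1 andbT; lra.
  by rewrite h1 /edge_coord eqxx b2 b3 -surjective_pairing.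
rewrite ltr0_norm // opprK in z2.
pose y := mate (val e).
have [b1 b2 b3] := bary_of y.2 (1 - z.1 + z.2) (- z.2); set p := of_bary _ _ _ in b1 b2 b3.
have tp : tri p by apply: tri_of; lra.
have [|||h1 h2] := @edge_pointE y p _ tp; first by rewrite edge_of_mate edge_val.
- by rewrite b1; lra.
- by rewrite b2; lra.
exists (surf_pt y.1 p); first by rewrite h2 b1 b2 lt_min; apply/andP; split; lra.
rewrite h1 /edge_coord (negbTE (mate_neq _)) b1 b3 opprK.
by rewrite [RHS]surjective_pairing; congr pair; lra.
Qed.

Lemma edge_has_chart s : 0 < lift_surf edge_dist s -> has_chart [set: R * R] s.
Proof.
apply: (chart_of (@surf_compact R G) edge_dist_continuous edge_height_continuous
  edge_distE_height edge_chart_onto edge_chart_inj edge_chart_continuous).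
Qed.

End EdgeCharts.

(** * The circle of the l1 norm *)

Section Diamond.
Variable R : realType.
Implicit Types (s : R) (z : R * R).

(* A parametrization of the unit circle of the l1 norm. *)
Definition diamond s : R * R := (`|4 * s - 2| - 1, `|4 * s - 3| - `|4 * s - 1| - 2 + 4 * s).

(** On each quarter of the circle the absolute values resolve into linear functions, which reduces
    later claims to linear arithmetic. *)
Lemma diamond_quadrants s : 0 <= s <= 1 ->
  [\/ [/\ s <= 1 / 4, (diamond s).1 = 1 - 4 * s & (diamond s).2 = 4 * s],
      [/\ 1 / 4 <= s, s <= 1 / 2, (diamond s).1 = 1 - 4 * s & (diamond s).2 = 2 - 4 * s],
      [/\ 1 / 2 <= s, s <= 3 / 4, (diamond s).1 = 4 * s - 3 & (diamond s).2 = 2 - 4 * s]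
    | [/\ 3 / 4 <= s, (diamond s).1 = 4 * s - 3 & (diamond s).2 = 4 * s - 4]].
Proof.
move=> /andP [s0 s1]; rewrite /diamond /=.
have [h1|h1] := leP s (1 / 4); first by
  apply: Or41; split=> //; rewrite ?ler0_norm; lra.
have [h2|h2] := leP s (1 / 2); first by
  apply: Or42; split=> //; rewrite ?(ler0_norm (x := 4 * s - 3)) ?(ger0_norm (x := 4 * s - 1))
    ?(ler0_norm (x := 4 * s - 2)); lra.
have [h3|h3] := leP s (3 / 4); first by
  apply: Or43; split=> //; rewrite ?(ler0_norm (x := 4 * s - 3)) ?(ger0_norm (x := 4 * s - 1))
    ?(ger0_norm (x := 4 * s - 2)); lra.
by apply: Or44; split=> //; rewrite ?ger0_norm; lra.
Qed.

Lemma diamond_norm s : 0 <= s <= 1 -> `|(diamond s).1| + `|(diamond s).2| = 1.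
Proof.
move=> s01; case/andP: (s01) => s0 s1.
by case: (diamond_quadrants s01) => [[? -> ->]|[? ? -> ->]|[? ? -> ->]|[? -> ->]];
  do 2 (case: ger0P => ?); lra.
Qed.

Lemma diamond_inj s s' : 0 <= s < 1 -> 0 <= s' < 1 -> diamond s = diamond s' -> s = s'.
Proof.
move=> /andP [s0 s1] /andP [s'0 s'1] ss'.
have s01 : 0 <= s <= 1 by apply/andP; split; lra.
have s'01 : 0 <= s' <= 1 by apply/andP; split; lra.
have := diamond_quadrants s'01; have := diamond_quadrants s01; rewrite ss'.
by move=> [[? -> ->]|[? ? -> ->]|[? ? -> ->]|[? -> ->]]
  [[? ? ?]|[? ? ? ?]|[? ? ? ?]|[? ? ?]]; lra.
Qed.

Lemma diamond01 : diamond 1 = diamond 0.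
Proof.
have h0 := @diamond_quadrants 0; have h1 := @diamond_quadrants 1.
rewrite [LHS]surjective_pairing [RHS]surjective_pairing.
have := h0; rewrite lexx ler01 => /(_ isT) {}h0.
have := h1; rewrite lexx ler01 => /(_ isT) {}h1.
by case: h0 => [[? -> ->]|[? ? -> ->]|[? ? -> ->]|[? -> ->]];
 case: h1 => [[? -> ->]|[? ? -> ->]|[? ? -> ->]|[? -> ->]]; congr pair; lra.
Qed.

Lemma diamond_onto z : `|z.1| + `|z.2| = 1 -> exists2 s, 0 <= s < 1 & diamond s = z.
Proof.
have build s : 0 <= s < 1 -> (diamond s).1 = z.1 -> (diamond s).2 = z.2 ->
    exists2 s, 0 <= s < 1 & diamond s = z.
  by move=> s01 h1 h2; exists s => //; rewrite [LHS]surjective_pairing h1 h2 -surjective_pairing.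
have wk s : 0 <= s < 1 -> 0 <= s <= 1 by move=> /andP [? ?]; apply/andP; split; lra.
have [z1|z1] := leP 0 z.1; have [z2|z2] := leP 0 z.2;
  rewrite ?(ger0_norm z1) ?(ger0_norm z2) ?(ltr0_norm z1) ?(ltr0_norm z2) => zz.
- have s01 : 0 <= z.2 / 4 < 1 by apply/andP; split; lra.
  apply: (build (z.2 / 4)) => //; case: (diamond_quadrants (wk _ s01)) =>
    [[? ? ?]|[? ? ? ?]|[? ? ? ?]|[? ? ?]]; lra.
- have s01 : 0 <= 1 + z.2 / 4 < 1 by apply/andP; split; lra.
  apply: (build (1 + z.2 / 4)) => //; case: (diamond_quadrants (wk _ s01)) =>
    [[? ? ?]|[? ? ? ?]|[? ? ? ?]|[? ? ?]]; lra.
- have s01 : 0 <= (2 - z.2) / 4 < 1 by apply/andP; split; lra.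
  apply: (build ((2 - z.2) / 4)) => //; case: (diamond_quadrants (wk _ s01)) =>
    [[? ? ?]|[? ? ? ?]|[? ? ? ?]|[? ? ?]]; lra.
- have s01 : 0 <= (2 - z.2) / 4 < 1 by apply/andP; split; lra.
  apply: (build ((2 - z.2) / 4)) => //; case: (diamond_quadrants (wk _ s01)) =>
    [[? ? ?]|[? ? ? ?]|[? ? ? ?]|[? ? ?]]; lra.
Qed.

Lemma diamond_continuous : continuous diamond.
Proof.
have lin (a : R) : continuous (fun s : R => `|4 * s - a|).
  move=> s; apply: cvg_norm; apply: cvgB; last exact: cvg_cst.
  by apply: cvgMr; exact: cvg_id.
move=> s; apply: cvg_point; first by apply: cvgB; [exact: lin | exact: cvg_cst].
apply: cvgD; last by apply: cvgMr; exact: cvg_id.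
by apply: cvgB; [apply: cvgB; exact: lin | exact: cvg_cst].
Qed.

End Diamond.

Arguments diamond {R} s.

(** * Charts at the vertices *)

Section VertexCharts.
Variables (R : realType) (G : gluing) (v : corner_class G).
Local Notation plane := (R * R)%type.
Local Notation side := (face G * 'I_3)%type.
Local Notation S := (surf R G).
Implicit Types (t : face G) (k : 'I_3) (p q : plane) (x y : side).

Let n := order (@corner_next G) (val v).
Let idx x := findex (@corner_next G) (val v) x.

Lemma vert_iter x : vert x = v -> iter (idx x) (@corner_next G) (val v) = x /\ (idx x < n)%N.
Proof.
move=> xv; have : fconnect (@corner_next G) (val v) x by apply/vertP; rewrite vert_val.
by split; [apply: iter_findex | apply: findex_max].
Qed.

Lemma iter_vert i : vert (iter i (@corner_next G) (val v)) = v.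
Proof. by elim: i => [|i IH] /=; rewrite ?vert_next ?vert_val. Qed.

Lemma idx_next x : vert x = v ->
  (idx (corner_next x) = (idx x).+1 :> nat) \/ (idx (corner_next x) = 0%N /\ (idx x).+1 = n).
Proof.
move=> /vert_iter [xE ltn]; have -> : corner_next x = iter (idx x).+1 (@corner_next G) (val v).
  by rewrite iterS xE.
have idx_iter j : (j < n)%N -> idx (iter j (@corner_next G) (val v)) = j by apply: findex_iter.
case: (ltngtP (idx x).+1 n) => [lt|gt|eq].
- by left; apply: idx_iter.
- by rewrite ltnS leqNgt ltn in gt.
- right; split=> //; rewrite eq iter_order; last exact: corner_next_inj.
  exact: findex0.
Qed.

Lemma corner_order_gt0 : 0 < n%:R :> R.
Proof. by rewrite ltr0n order_gt0. Qed.

(** The position at which the ray from the corner through [p] meets the opposite side: 0 along the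
    side [ord_pred x.2], 1 along the side [x.2], beyond which lies [corner_next x]. At the corner
    itself division by 0 gives 0. *)
Definition corner_frac x p : R := bary (ordS x.2) p / (1 - bary x.2 p).

(** The [n] corners around [v], numbered by [idx], get equal shares of a full turn of length 1. *)
Definition corner_angle x p : R := ((idx x)%:R + corner_frac x p) / n%:R.

Definition corner_coord x p : plane :=
  ((1 - bary x.2 p) * (diamond (corner_angle x p)).1,
   (1 - bary x.2 p) * (diamond (corner_angle x p)).2).

(** A triangle may have several corners at [v]. At most one barycentric coordinate exceeds 1/2, so
    cutting there keeps the pieces at these corners disjoint. *)
Definition vertex_dist t p : R :=
  \sum_k if vert (t, k) == v then Num.max 0 (bary k p - 1 / 2) else 0.

Definition vertex_chart t p : plane :=
  \sum_k if (vert (t, k) == v) && (1 / 2 < bary k p) then corner_coord (t, k) p else 0.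

Lemma corner_frac01 x p : tri p -> 0 <= corner_frac x p <= 1.
Proof.
move=> tp; rewrite /corner_frac.
have := bary_sum x.2 p; have := tp x.2; have := tp (ordS x.2); have := tp (ord_pred x.2).
move=> P0 S0 k0 sp; have [k1|k1] := eqVneq (1 - bary x.2 p) 0.
  by rewrite k1 invr0 mulr0 lexx ler01.
have k1' : 0 < 1 - bary x.2 p by rewrite lt_def k1; lra.
by rewrite divr_ge0 ?ler_pdivrMr //=; lra.
Qed.

Lemma corner_angle01 x p : vert x = v -> tri p -> 0 <= corner_angle x p <= 1.
Proof.
move=> /vert_iter [_ ltn] tp; case/andP: (corner_frac01 x tp) => f0 f1.
have le1 : (idx x)%:R + 1 <= n%:R :> R by rewrite natr1 ler_nat.
have i0 : 0 <= (idx x)%:R :> R by [].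
have n0 := corner_order_gt0.
by rewrite /corner_angle divr_ge0 ?ler_pdivrMr //=; lra.
Qed.

Lemma vertex_dist_compatible : compatible vertex_dist.
Proof.
apply: (compatible_corner_sum (phi := fun x p =>
  if vert x == v then Num.max 0 (bary x.2 p - 1 / 2) else 0)) => [x u _|x p ->].
  have [-> _ _] := bary_side x.2 u; have [_ -> _] := bary_side (mate x).2 (1 - u).
  by rewrite vert_next.
by case: ifP => // _; rewrite max_l //; lra.
Qed.

Lemma vertex_chart_compatible : compatible vertex_chart.
Proof.
apply: (compatible_corner_sum (phi := fun x p =>
  if (vert x == v) && (1 / 2 < bary x.2 p) then corner_coord x p else 0)) => [x u _|x p ->];
  last by case: ifP => // /andP [_ h]; exfalso; lra.
rewrite /corner_coord /corner_angle /corner_frac vert_next.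
have [-> -> _] := bary_side x.2 u; have [c1 -> c3] := bary_side (mate x).2 (1 - u).
rewrite ordSS c3 subKr mul0r addr0; case: eqP => // xv; rewrite !andTb; case: ifP => // _.
(* At [u = 0] the radius is 0. Otherwise the fraction 1 at [x] meets the fraction 0 at
   [corner_next x]; the index grows by one or, after a full turn, returns to 0, where [diamond01]
   closes the circle. *)
have [-> //|u0] := eqVneq u 0; first by rewrite !mul0r.
rewrite divff //. suff -> : diamond (((idx x)%:R + 1) / n%:R) =
    diamond ((idx (corner_next x))%:R / n%:R :> R) by [].
case: (idx_next xv) => [->|[-> ni]]; first by rewrite natr1.
by rewrite natr1 ni divff ?mul0r ?diamond01 // lt0r_neq0 // corner_order_gt0.
Qed.

Lemma half_unique t p k j : tri p -> 1 / 2 < bary k p -> 1 / 2 < bary j p -> j = k.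
Proof.
move=> tp k0; have := bary_sum k p; have := tp (ordS k); have := tp (ord_pred k) => h1 h2 h3.
move: j; apply: (@ord3P (fun j => 1 / 2 < bary j p -> j = k) k) => // h; exfalso; lra.
Qed.

Lemma vertex_sum (V : zmodType) (F : 'I_3 -> V) t p k : tri p -> vert (t, k) = v ->
  1 / 2 < bary k p -> \sum_j (if (vert (t, j) == v) && (1 / 2 < bary j p) then F j else 0) = F k.
Proof.
move=> tp kv k0; rewrite (bigD1 k) //= kv eqxx k0 big1 ?addr0 // => j jk.
case: ifP => // /andP [_ j0]; case/eqP: jk; exact: (half_unique t tp k0 j0).
Qed.

Lemma vertex_distE' t p : vertex_dist t p =
  \sum_k if (vert (t, k) == v) && (1 / 2 < bary k p) then bary k p - 1 / 2 else 0.
Proof.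
apply: eq_bigr => k _; case: eqP => //= _; case: ltP => h.
  by rewrite max_r //; lra.
by rewrite max_l //; lra.
Qed.

Lemma vertex_dist_pos t p : tri p -> 0 < vertex_dist t p ->
  exists2 k, vert (t, k) = v & 1 / 2 < bary k p.
Proof.
move=> tp; rewrite vertex_distE'.
have [[k [kv k0]]|ne] := pselect (exists k, vert (t, k) = v /\ 1 / 2 < bary k p).
  by move=> _; exists k.
rewrite big1 ?ltxx // => k _; case: ifP => // /andP [/eqP kv k0].
by case: ne; exists k.
Qed.

Lemma vertex_pointE x p : vert x = v -> tri p -> 1 / 2 < bary x.2 p ->
  lift_surf vertex_chart (surf_pt x.1 p) = corner_coord x p /\
  lift_surf vertex_dist (surf_pt x.1 p) = bary x.2 p - 1 / 2.
Proof.
case: x => t k xv tp k0.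
rewrite (lift_surfE _ vertex_chart_compatible tp) (lift_surfE _ vertex_dist_compatible tp).
rewrite /vertex_chart (vertex_sum (fun j => corner_coord (t, j) p) tp xv k0).
by rewrite vertex_distE' (vertex_sum (fun j => bary j p - 1 / 2) tp xv k0).
Qed.

(** The condition on [ord_pred x.2] moves points of the side [x.2] to the next corner. The fraction
    is then less than 1, and the angle stays in the half-open interval on which [diamond] is
    injective. *)
Variant vertex_point_spec s : Prop :=
  VertexPoint x p of vert x = v & tri p & s = surf_pt x.1 p & 1 / 2 < bary x.2 p
    & (bary x.2 p = 1 \/ 0 < bary (ord_pred x.2) p)
    & lift_surf vertex_chart s = corner_coord x p
    & lift_surf vertex_dist s = bary x.2 p - 1 / 2.

Lemma vertex_pointP s : 0 < lift_surf vertex_dist s -> vertex_point_spec s.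
Proof.
rewrite -(surf_repK s); have := surf_rep_tri s; move: (surf_rep s) => [t p] /= tp.
rewrite (lift_surfE _ vertex_dist_compatible tp) => /(vertex_dist_pos tp) [k kv k0].
have build x q : vert x = v -> tri q -> surf_pt t p = surf_pt x.1 q -> 1 / 2 < bary x.2 q ->
    (bary x.2 q = 1 \/ 0 < bary (ord_pred x.2) q) -> vertex_point_spec (surf_pt t p).
  move=> xv tq -> q0 q1; have [h1 h2] := vertex_pointE xv tq q0.
  exact: (@VertexPoint _ x q).
have := tp (ord_pred k); rewrite le_eqVlt => /orP [/eqP P0|P0]; last first.
  by apply: (build (t, k) p) => //; right.
have [k1|k1] := eqVneq (bary k p) 1; first by apply: (build (t, k) p) => //; left.
pose u := bary (ordS k) p; have sp := bary_sum k p.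
have u01 : 0 <= u <= 1 by rewrite tp /= /u; lra.
have u01' : 0 <= 1 - u <= 1 by case/andP: u01 => ? ?; apply/andP; split; lra.
have pE : p = side_point k u.
  by have [b1 b2 b3] := bary_side k u; apply: (bary_inj (k := k)); rewrite ?b2 ?b3.
have [c1 c2 c3] := bary_side (mate (t, k)).2 (1 - u).
apply: (build (corner_next (t, k)) (side_point (mate (t, k)).2 (1 - u))) => //.
- by rewrite vert_next.
- exact: tri_side.
- by rewrite {1}pE; exact: (@surf_pt_mate R G (t, k) u).
- by rewrite /= c2 /u; lra.
right; rewrite /= ord_predS c1 subKr lt_def tp andbT.
by apply: contra_neq k1 => u0; move: sp; rewrite -/u u0 -P0; lra.
Qed.

Definition vertex_height (z : plane) : R := 1 / 2 - `|z.1| - `|z.2|.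

Lemma vertex_height_continuous : continuous vertex_height.
Proof.
move=> z; apply: cvgB; last by apply: cvg_norm; exact: snd_cont.
by apply: cvgB; [exact: cvg_cst | apply: cvg_norm; exact: fst_cont].
Qed.

Lemma corner_coord_norm x p : vert x = v -> tri p ->
  `|(corner_coord x p).1| + `|(corner_coord x p).2| = 1 - bary x.2 p.
Proof.
move=> xv tp; have := diamond_norm (corner_angle01 xv tp).
have : 0 <= 1 - bary x.2 p.
  have := bary_sum x.2 p; have := tp (ordS x.2); have := tp (ord_pred x.2); lra.
by rewrite /corner_coord /= !normrM => /ger0_norm -> d1; rewrite -mulrDr d1 mulr1.
Qed.

Lemma vertex_distE_height s : 0 < lift_surf vertex_dist s ->
  lift_surf vertex_dist s = vertex_height (lift_surf vertex_chart s).
Proof.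
move=> /vertex_pointP [x p xv tp _ _ _ -> ->]; have := corner_coord_norm xv tp.
by rewrite /vertex_height; lra.
Qed.

Lemma vertex_dist_continuous : continuous (lift_surf vertex_dist).
Proof.
apply: lift_surf_continuous; first exact: vertex_dist_compatible.
move=> t; apply: sum_ord3_continuous => k; case: (_ == v) => p; last exact: cvg_cst.
apply: cvg_max; first exact: cvg_cst.
by apply: cvgB; [exact: bary_cont | exact: cvg_cst].
Qed.

Lemma vertex_dist_open : open [set s | 0 < lift_surf vertex_dist s].
Proof. exact/open_pos/vertex_dist_continuous. Qed.

Lemma corner_coord_continuous x q : 1 - bary x.2 q != 0 -> {for q, continuous (corner_coord x)}.
Proof.
move=> q1; have cr : continuous (fun p => 1 - bary x.2 p).
  by move=> p; apply: cvgB; [exact: cvg_cst | exact: bary_cont].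
have cf : {for q, continuous (corner_frac x)}.
  by apply: cvgM; [exact: bary_cont | apply: cvgV => //; exact: cr].
have ca : {for q, continuous (corner_angle x)}.
  by apply: cvgMl; apply: cvgD; [exact: cvg_cst | exact: cf].
have cd : {for q, continuous (diamond \o corner_angle x)}.
  by apply: continuous_comp => //; exact: diamond_continuous.
apply: cvg_point; apply: cvgM; try exact: cr.
  exact: (cvg_comp _ _ cd (@fst_cont R _)).
exact: (cvg_comp _ _ cd (@snd_cont R _)).
Qed.

(* At the vertex itself the angle is undefined, but the radius vanishes. *)
Lemma corner_coord_clamp_continuous x p : vert x = v ->
  {for p, continuous (corner_coord x \o @clamp R)}.
Proof.
move=> xv; have [k1|k1] := eqVneq (1 - bary x.2 (clamp p)) 0; last first.
  by apply: continuous_comp; [exact: clamp_cont | exact: corner_coord_continuous].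
have cr : 1 - bary x.2 (clamp q) @[q --> p] --> (0 : R).
  rewrite -[X in _ --> X]k1; apply: cvgB; first exact: cvg_cst.
  by apply: (continuous_comp (g := bary x.2)); [exact: clamp_cont | exact: bary_cont].
have cnr : - (1 - bary x.2 (clamp q)) @[q --> p] --> (0 : R).
  by rewrite -[X in _ --> X]oppr0; apply: cvgN.
have bound q : `|(corner_coord x (clamp q)).1| <= 1 - bary x.2 (clamp q) /\
    `|(corner_coord x (clamp q)).2| <= 1 - bary x.2 (clamp q).
  have := corner_coord_norm xv (clamp_tri q).
  have := normr_ge0 (corner_coord x (clamp q)).1.
  by have := normr_ge0 (corner_coord x (clamp q)).2; split; lra.
have p0 : (corner_coord x \o @clamp R) p = (0, 0) by rewrite /= /corner_coord k1 !mul0r.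
have : (corner_coord x \o @clamp R) @ p --> ((0, 0) : plane).
  have -> : corner_coord x \o @clamp R =
      (fun q => ((corner_coord x (clamp q)).1, (corner_coord x (clamp q)).2)) by [].
  apply: cvg_point; apply: (squeeze_cvgr _ cnr cr); apply: nearW => q.
    by rewrite -ler_norml; have [] := bound q.
  by rewrite -ler_norml; have [] := bound q.
by rewrite -p0.
Qed.

Lemma vertex_chart_continuous s : 0 < lift_surf vertex_dist s ->
  {for s, continuous (lift_surf vertex_chart)}.
Proof.
apply: (lift_surf_cont vertex_chart_compatible vertex_dist_open) => t p /=.
rewrite (lift_surf_clamp _ _ vertex_dist_compatible).
move=> /(vertex_dist_pos (clamp_tri p)) [k kv k0].
have n0 : \forall q \near p, 0 < bary k (clamp q) - 1 / 2.
  apply: open_nbhs_nbhs; split; last by rewrite /=; lra.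
  apply: (@open_pos _ _ (fun q => bary k (clamp q) - 1 / 2)) => q.
  apply: cvgB; last exact: cvg_cst.
  by apply: (continuous_comp (g := bary k)); [exact: clamp_cont | exact: bary_cont].
have chartE q : 1 / 2 < bary k (clamp q) ->
    vertex_chart t (clamp q) = corner_coord (t, k) (clamp q).
  by move=> q0; exact: (vertex_sum (fun j => corner_coord (t, j) _) (clamp_tri q) kv q0).
have ce : (corner_coord (t, k) \o @clamp R) @ p --> (vertex_chart t \o @clamp R) p.
  by rewrite [X in _ --> X]/= (chartE _ k0); exact: corner_coord_clamp_continuous.
apply: cvg_trans ce; apply: near_eq_cvg.
by near=> q; rewrite /= chartE // -subr_gt0; near: q.
Unshelve. all: by end_near. Qed.

Lemma surf_pt_corner x y p q : vert x = vert y -> tri p -> tri q ->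
  bary x.2 p = 1 -> bary y.2 q = 1 -> surf_pt x.1 p = surf_pt y.1 q :> S.
Proof.
have corner (z : side) (r : plane) : tri r -> bary z.2 r = 1 -> r = side_point z.2 0.
  move=> tr r1; have [b1 b2 b3] := bary_side z.2 (0 : R).
  have := bary_sum z.2 r; have := tr (ordS z.2); have := tr (ord_pred z.2) => ? ? ?.
  by apply: (bary_inj (k := z.2)); rewrite ?b2 ?b3; lra.
move=> xy tp tq /(corner _ _ tp) -> /(corner _ _ tq) ->; apply: val_inj.
rewrite !val_surf_pt; try exact: tri_corner.
by rewrite !cell_point_corner -!surjective_pairing xy.
Qed.

Lemma vertex_chart_inj s s' : 0 < lift_surf vertex_dist s -> 0 < lift_surf vertex_dist s' ->
  lift_surf vertex_chart s = lift_surf vertex_chart s' -> s = s'.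
Proof.
move=> /vertex_pointP [x p xv tp -> x0 xP -> _] /vertex_pointP [y q yv tq -> y0 yP -> _] xy.
have bE : bary x.2 p = bary y.2 q.
  have := corner_coord_norm xv tp; have := corner_coord_norm yv tq; rewrite xy; lra.
case: xP => [x1|xP].
  by apply: surf_pt_corner; rewrite ?xv ?yv // -bE.
case: yP => [y1|yP]; first by apply: surf_pt_corner; rewrite ?xv ?yv // bE.
have frac1 (z : side) (r : plane) : tri r -> 0 < bary (ord_pred z.2) r ->
    0 < 1 - bary z.2 r /\ 0 <= corner_frac z r < 1.
  move=> tr zr; have := bary_sum z.2 r; have := tr (ordS z.2) => z0 sz.
  have r0 : 0 < 1 - bary z.2 r by lra.
  by split=> //; rewrite /corner_frac ltr_pdivrMr // divr_ge0 //=; lra.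
have [rx fx] := frac1 x p tp xP; have [ry fy] := frac1 y q tq yP.
have angle1 (z : side) (r : plane) : vert z = v -> 0 <= corner_frac z r < 1 ->
    0 <= corner_angle z r < 1.
  move=> /vert_iter [_ zn] /andP [f0 f1]; have n0 := corner_order_gt0.
  have le1 : (idx z)%:R + 1 <= n%:R :> R by rewrite natr1 ler_nat.
  have i0 : 0 <= (idx z)%:R :> R by [].
  by rewrite /corner_angle ltr_pdivrMr // divr_ge0 //=; lra.
have dE : diamond (corner_angle x p) = diamond (corner_angle y q).
  move: xy; rewrite /corner_coord -bE => /eqP; rewrite xpair_eqE.
  have r0 : 1 - bary x.2 p != 0 by rewrite lt0r_neq0.
  move=> /andP [/eqP /(mulfI r0) e1 /eqP /(mulfI r0) e2].
  by rewrite [LHS]surjective_pairing [RHS]surjective_pairing e1 e2.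
have aE := diamond_inj (angle1 _ _ xv fx) (angle1 _ _ yv fy) dE.
have {aE} : (idx x)%:R + corner_frac x p = (idx y)%:R + corner_frac y q.
  move: aE; rewrite /corner_angle => /mulIf; apply.
  by rewrite invr_neq0 // lt0r_neq0 // corner_order_gt0.
move=> sE.
(* Both fractions lie in the half-open unit interval, so the integer parts agree. *)
have iE : idx x = idx y.
  case/andP: fx => fx0 fx1; case/andP: fy => fy0 fy1.
  by apply/eqP; rewrite eqn_leq; apply/andP; split; rewrite -ltnS -(ltr_nat R) -natr1; lra.
have xyE : x = y.
  by rewrite -[LHS](vert_iter xv).1 -[RHS](vert_iter yv).1 iE.
move: sE; rewrite iE => /addrI; rewrite /corner_frac -bE => /mulIf fE.
have {fE} SE : bary (ordS x.2) p = bary (ordS y.2) q.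
  by apply: fE; rewrite invr_neq0 // lt0r_neq0.
rewrite xyE; congr surf_pt; apply: (bary_inj (k := y.2)); first by rewrite -SE xyE.
by have := bary_sum y.2 p; have := bary_sum y.2 q; move: SE bE; rewrite xyE; lra.
Qed.

Lemma vertex_chart_onto z : 0 < vertex_height z ->
  exists2 s, 0 < lift_surf vertex_dist s & lift_surf vertex_chart s = z.
Proof.
rewrite /vertex_height; pose r := `|z.1| + `|z.2| => hz.
have r12 : r < 1 / 2 by rewrite /r; lra.
have r0 : 0 <= r by rewrite /r addr_ge0.
(* The quotient [f * r / r] is kept as [corner_frac] produces it, which also covers [r = 0]. *)
have build x (f : R) : vert x = v -> 0 <= f <= 1 ->
    (r * (diamond (((idx x)%:R + f * r / r) / n%:R)).1,
     r * (diamond (((idx x)%:R + f * r / r) / n%:R)).2) = z ->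
    exists2 s, 0 < lift_surf vertex_dist s & lift_surf vertex_chart s = z.
  move=> xv /andP [f0 f1] zE.
  have fr : f * r <= r by rewrite ler_piMl.
  have [b1 b2 b3] := bary_of x.2 (f * r) (r - f * r); set p := of_bary _ _ _ in b1 b2 b3.
  have tp : tri p by apply: tri_of; rewrite ?mulr_ge0 //; lra.
  have b1' : bary x.2 p = 1 - r by rewrite b1; lra.
  have [|h1 h2] := vertex_pointE xv tp; first by rewrite b1'; lra.
  exists (surf_pt x.1 p); first by rewrite h2 b1'; lra.
  by rewrite h1 /corner_coord /corner_angle /corner_frac b1' b2 subKr.
have [rz|rz] := eqVneq r 0.
  apply: (build (val v) 0); rewrite ?vert_val ?lexx ?ler01 //.
  have z1 : z.1 = 0 by apply/normr0_eq0; have := normr_ge0 z.2; have := normr_ge0 z.1;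
    move: rz; rewrite /r; lra.
  have z2 : z.2 = 0 by apply/normr0_eq0; have := normr_ge0 z.2; have := normr_ge0 z.1;
    move: rz; rewrite /r; lra.
  by rewrite rz !mul0r [RHS]surjective_pairing z1 z2.
have [|a a01 aE] := @diamond_onto R (z.1 / r, z.2 / r).
  by rewrite /= !normrM normfV (ger0_norm r0) -mulrDl divff.
case/andP: a01 => a0 a1; have n0 := corner_order_gt0.
have an0 : 0 <= a * n%:R by rewrite mulr_ge0 // ltW.
(* The integer part of [a * n] selects the corner, and the remainder is the fraction within it. *)
case/andP: (truncn_itv an0); set i := Num.trunc _ => i1 i2.
have ltin : (i < n)%N.
  by rewrite -(ltr_nat R); apply: le_lt_trans i1 _; rewrite gtr_pMl.
have iE : idx (iter i (@corner_next G) (val v)) = i by apply: findex_iter.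
apply: (build (iter i (@corner_next G) (val v)) (a * n%:R - i%:R)).
- exact: iter_vert.
- by move: i2; rewrite -natr1 => i2; apply/andP; split; lra.
have -> : ((idx (iter i (@corner_next G) (val v)))%:R + (a * n%:R - i%:R) * r / r) / n%:R = a.
  by rewrite iE mulfK // addrC subrK mulfK // lt0r_neq0.
rewrite aE /= ![r * _]mulrC !divfK //.
by rewrite -surjective_pairing.
Qed.

Lemma vertex_has_chart s : 0 < lift_surf vertex_dist s -> has_chart [set: R * R] s.
Proof.
apply: (chart_of (@surf_compact R G) vertex_dist_continuous vertex_height_continuous
  vertex_distE_height vertex_chart_onto vertex_chart_inj vertex_chart_continuous).
Qed.

End VertexCharts.

(** * The glued space is a surface without boundary *)

Section SurfaceIsSurface.
Variables (R : realType) (G : gluing).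
Local Notation S := (surf R G).

(** An interior point of a triangle lies in the chart domain of any of its sides, so faces get no
    charts of their own. *)
Lemma surf_cases (s : S) : (exists v : corner_class G, 0 < lift_surf (vertex_dist v) s) \/
  (exists e : edge G, 0 < lift_surf (edge_dist e) s).
Proof.
rewrite -(surf_repK s); have := surf_rep_tri s; move: (surf_rep s) => [t p] /= tp.
case: (tri_cases tp) => [[k pE]|[k [u [/andP [u0 u1] pE]]]|p0].
- left; exists (vert (t, k)); have [b1 b2 b3] := bary_side k (0 : R).
  have [|_ ->] := @vertex_pointE R G _ (t, k) p erefl tp; rewrite /= pE b1; lra.
- right; exists (edge_of (t, k)); have [b1 b2 b3] := bary_side k u.
  have [||_ ->] := @edge_pointE R G _ (t, k) p erefl tp; rewrite /= pE ?b1 ?b2 ?lt_min; lra.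
- right; exists (edge_of (t, ord0)).
  by have [||_ ->] := @edge_pointE R G _ (t, ord0) p erefl tp; rewrite ?lt_min ?p0.
Qed.

Lemma surf_has_chart (s : S) : has_chart [set: R * R] s.
Proof.
by case: (surf_cases s) => [[v]|[e]]; [apply: vertex_has_chart | apply: edge_has_chart].
Qed.

Lemma surf_hausdorff : hausdorff_space S.
Proof.
apply: (@hausdorff_of_charts R) => s; case: (surf_cases s) => [[v sv]|[e se]].
  exists (lift_surf (vertex_chart v)), (lift_surf (vertex_dist v)); split=> //.
  - exact: vertex_dist_continuous.
  - exact: vertex_chart_inj.
  - exact: vertex_chart_continuous.
exists (lift_surf (edge_chart e)), (lift_surf (edge_dist e)); split=> //.
- exact: edge_dist_continuous.
- exact: edge_chart_inj.
- exact: edge_chart_continuous.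
Qed.

Lemma surf_is_surface : is_surface R S.
Proof.
split; [exact: surf_compact | exact: surf_connected | exact: surf_hausdorff | |].
  by exists (surf_pt (face0 G) (0, 0)).
by move=> s; left; exact: surf_has_chart.
Qed.

Lemma surf_boundary0 : surface_boundary R S = set0.
Proof. by apply/seteqP; split=> // s; apply; exact: surf_has_chart. Qed.

End SurfaceIsSurface.

(** * The triangulation and its quiver *)

Section SurfaceTriangulation.
Variables (R : realType) (G : gluing).
Local Notation plane := (R * R)%type.
Local Notation side := (face G * 'I_3)%type.
Local Notation S := (surf R G).
Implicit Types (t : face G) (k : 'I_3) (p q : plane) (x y : side).

Definition surf_edge_map (e : edge G) (u : R) : S :=
  surf_pt (val e).1 (side_point (val e).2 u).

Definition surf_cells : cell_data R S := {|
  tr_vertex := corner_class G;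
  tr_edge := edge G;
  tr_face := face G;
  tr_vertex_map := fun v => surf_pt (val v).1 (side_point (val v).2 0);
  tr_edge_map := surf_edge_map;
  tr_face_map := @surf_pt R G;
  tr_side := fun t k => edge_of (t, k) |}.

Lemma side_point_continuous k : continuous (@side_point R k).
Proof.
have -> : @side_point R k = (fun u => of_bary k u 0) by apply/funext => u; apply: side_of_bary.
case: k => [[|[|[|]]]] //= ? u; rewrite /of_bary /=; apply: cvg_point;
  do ?[exact: cvg_cst | exact: cvg_id | apply: cvgB].
Qed.

Lemma surf_edge_map_continuous e : continuous (surf_edge_map e).
Proof.
move=> u; apply: (continuous_comp (g := @surf_pt R G (val e).1)).
  exact: side_point_continuous.
exact: surf_pt_cont.
Qed.

Lemma val_surf_vertex (v : corner_class G) :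
  val (surf_pt (val v).1 (side_point (val v).2 0) : S) = inl (inl v).
Proof.
rewrite val_surf_pt; last exact: tri_corner.
by rewrite cell_point_corner -surjective_pairing vert_val.
Qed.

Lemma val_surf_edge (e : edge G) (u : R) : 0 < u < 1 ->
  val (surf_edge_map e u) = inl (inr (e, u)).
Proof.
move=> u01; rewrite val_surf_pt; last first.
  by apply: tri_side; case/andP: u01 => /ltW -> /ltW ->.
rewrite cell_point_side // -surjective_pairing edge_val /edge_param.
by rewrite (eqP (valP e)) eqxx.
Qed.

Lemma val_surf_face t p : (forall k, 0 < bary k p) ->
  val (surf_pt t p : S) = inr (t, p).
Proof.
by move=> p0; rewrite val_surf_pt ?cell_point_int // => k; apply: ltW.
Qed.

(** The normal form names the cell, so that disjointness and covering of the cells can be read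
    off. *)
Lemma open_cellP (c : corner_class G + edge G + face G) (s : S) :
  @open_cell R S surf_cells c s <->
  match val s with
  | inl (inl v) => c = inl (inl v)
  | inl (inr eu) => c = inl (inr eu.1)
  | inr tp => c = inr tp.1
  end.
Proof.
split.
  case: c => [[v|e]|t] /=; first by move=> ->; rewrite val_surf_vertex.
    by move=> [u]; rewrite /= in_itv /= => u01 <-; rewrite val_surf_edge.
  by move=> [p /tri_intP p0 <-]; rewrite val_surf_face.
case: s => [[[v|[e u]]|[t p]] sP] /= ->.
- by apply: val_inj; rewrite val_surf_vertex.
- exists u; first by rewrite /= in_itv.
  by apply: val_inj; rewrite val_surf_edge.
- have p0 : forall k, 0 < bary k p by apply/forallP.
  by exists p; [apply/tri_intP | apply: val_inj; rewrite val_surf_face].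
Qed.

Lemma mem_codom_edge (e : edge G) t :
  (e \in codom (fun k => edge_of (t, k))) = (t == (val e).1) || (t == (mate (val e)).1).
Proof.
apply/codomP/orP => [[k eE]|[/eqP ->|/eqP ->]].
- have : edge_of (t, k) = edge_of (val e) by rewrite edge_val.
  by move=> /edge_ofP [tE|tE]; [left | right]; rewrite -tE.
- by exists (val e).2; rewrite -surjective_pairing edge_val.
- by exists (mate (val e)).2; rewrite -surjective_pairing edge_of_mate edge_val.
Qed.

Lemma surf_edge_card (e : edge G) :
  #|[set t : face G | e \in codom (fun k => edge_of (t, k))]%SET| = 2%N.
Proof.
have -> : [set t : face G | e \in codom (fun k => edge_of (t, k))]%SET =
    [set (val e).1; (mate (val e)).1]%SET.
  by apply/setP => t; rewrite !inE mem_codom_edge.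
by rewrite cards2 eq_sym mate_face.
Qed.

Lemma surf_edge_ge2 : (2 <= #|edge G|)%N.
Proof.
apply: leq_trans (_ : 3 <= _)%N => //; rewrite -[X in (X <= _)%N]card_ord.
exact: leq_card (@edge_of_inj G (face0 G)).
Qed.

Lemma surf_face_attach t k :
  (forall u : R, `[0, 1]%classic u ->
     surf_pt t (side_point k u) = surf_edge_map (edge_of (t, k)) u) \/
  (forall u : R, `[0, 1]%classic u ->
     surf_pt t (side_point k u) = surf_edge_map (edge_of (t, k)) (1 - u)).
Proof.
rewrite /surf_edge_map /=; case: (side_repE (t, k)) => ->; [left | right] => // u.
by rewrite /= in_itv /= => u01; exact: (@surf_pt_mate R G (t, k)).
Qed.

Lemma surf_edge_attach e :
  range (tr_vertex_map (c := surf_cells)) (surf_edge_map e 0) /\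
  range (tr_vertex_map (c := surf_cells)) (surf_edge_map e 1).
Proof.
have corner t k : range (tr_vertex_map (c := surf_cells)) (surf_pt t (side_point k 0)).
  exists (vert (t, k)) => //; apply: val_inj; rewrite [LHS]val_surf_vertex.
  by rewrite val_surf_pt ?cell_point_corner //; exact: tri_corner.
by split; rewrite /surf_edge_map ?side_point1; apply: corner.
Qed.

Definition surf_triangulation : triangulation R S.
Proof.
apply: (@Triangulation R S surf_cells).
- by move=> e; apply/continuous_subspaceT/surf_edge_map_continuous.
- by move=> t; apply/continuous_subspaceT/surf_pt_cont.
- move=> e u u'; rewrite !inE /= !in_itv /= => u01 u'01 /(congr1 val).
  by rewrite !val_surf_edge // => -[].
- move=> t p q; rewrite !inE => /tri_intP p0 /tri_intP q0 /(congr1 val).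
  by rewrite !val_surf_face // => -[].
- move=> c c' _ _ [s [/open_cellP sc /open_cellP sc']].
  by move: sc sc'; case: (val s) => [[v|[e u]]|[t p]] -> ->.
- apply/seteqP; split=> // s _.
  by case sE : (val s) => [[v|[e u]]|[t p]];
    [exists (inl (inl v)) | exists (inl (inr e)) | exists (inr t)] => //;
    apply/open_cellP; rewrite sE.
- exact: surf_edge_attach.
- exact: surf_face_attach.
- by move=> t; left; exact: edge_of_inj.
- by move=> e; apply: Or31; exact: surf_edge_card.
- exact: surf_edge_ge2.
Defined.

Lemma surf_not_self_folded (t : tr_face surf_triangulation) : ~ self_folded t.
Proof.
move=> [e [k [h1 h2 _ _]]]; have := ordS_neq k; rewrite (@edge_of_inj G t (ordS k) k) ?eqxx //.
by rewrite -[LHS]/(tr_side (t : tr_face surf_cells) (ordS k)) h2 -h1.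
Qed.

End SurfaceTriangulation.

(** * The quiver of the triangulation *)

Section SurfaceQuiver.
Variables (R : realType) (G : gluing).
Local Notation T := (surf_triangulation R G).
Local Notation side := (face G * 'I_3)%type.

(** As glued sides run in opposite directions, the side numberings turn the same way in adjacent
    triangles, and the orbits of [surface_g] are the turns around the vertices. *)
Definition coherent_orientation : orientation T := fun _ => true.
Local Notation Q := (surface_quiver coherent_orientation).

Lemma surf_no_boundary_edge (e : boundary_edge T) : False.
Proof.
case: e => e /asboolP /(_ (tr_edge_map e 0)); rewrite surf_boundary0; apply.
by exists 0 => //; rewrite /= in_itv /= lexx ler01.
Qed.

Definition side_arrow (x : side) : arrow Q := inl x.

Lemma side_arrowP (a : arrow Q) : exists x, a = side_arrow x.
Proof. by case: a => [x|e]; [exists x | case: (surf_no_boundary_edge e)]. Qed.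

Lemma side_arrow_inj : injective side_arrow.
Proof. by move=> x y []. Qed.

Lemma src_side_arrow x : src (side_arrow x) = edge_of x.
Proof. by case: x. Qed.

Lemma bar_side_arrow x : bar (side_arrow x) = side_arrow (mate x).
Proof.
rewrite /bar; case: pickP => [b|/(_ (side_arrow (mate x)))].
  have [y ->] := side_arrowP b => /andP [/eqP yx ny].
  have {}yx : src (side_arrow y) = src (side_arrow x) := yx.
  move: yx ny; rewrite !src_side_arrow => /edge_ofP [->|-> //].
  by rewrite eqxx.
have -> : src (side_arrow (mate x)) = src (side_arrow x) by rewrite !src_side_arrow edge_of_mate.
by rewrite eqxx (inj_eq side_arrow_inj) mate_neq.
Qed.

Definition side_next (x : side) : side := mate (x.1, ordS x.2).

Lemma surface_f_side x : surface_f (side_arrow x) = side_arrow (x.1, ordS x.2).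
Proof. by case: x. Qed.

Lemma surface_g_side x : surface_g (side_arrow x) = side_arrow (side_next x).
Proof. by rewrite /surface_g surface_f_side bar_side_arrow. Qed.

Lemma surface_g_inj : injective (@surface_g R (surf R G) T coherent_orientation).
Proof.
move=> a b; have [x ->] := side_arrowP a; have [y ->] := side_arrowP b.
rewrite !surface_g_side => /side_arrow_inj /(can_inj (@mateK G)) /eqP.
rewrite xpair_eqE => /andP [/eqP h1 /eqP /(can_inj (@ordSK 3)) h2].
by rewrite (surjective_pairing x) (surjective_pairing y) h1 h2.
Qed.

Lemma src_surface_g (a : arrow Q) : src (surface_g a) = tgt a.
Proof.
have [x ->] := side_arrowP a; rewrite surface_g_side src_side_arrow edge_of_mate.
by case: x.
Qed.

Lemma bar_surface_neq (a : arrow Q) : bar a != a.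
Proof.
have [x ->] := side_arrowP a.
by rewrite bar_side_arrow (inj_eq side_arrow_inj) mate_neq.
Qed.

(** Only [surface_f a] and its [bar], which is [surface_g a], start at the target of [a]; a
    composable [b] other than [surface_g a] is therefore [surface_f a]. *)
Lemma surface_relationsE (K : fieldType) (m : weight_function coherent_orientation) :
  surface_relations (K := K) m =
  biserial_relations K (@surface_g R (surf R G) T coherent_orientation)
    (fun a => m (g_orbit a)).
Proof.
rewrite /surface_relations /biserial_relations; congr (_ `|` _).
apply/seteqP; split=> z [a].
  move=> ->; exists a, (surface_f a); split=> //.
    by have [x ->] := side_arrowP a; rewrite surface_f_side src_side_arrow; case: x.
  by move=> /esym /eqP; rewrite (negbTE (bar_surface_neq _)).
move=> [b [ab nb ->]]; exists a; congr (_ * arrow_elt K _).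
move: ab nb; have [x ->] := side_arrowP a; have [y ->] := side_arrowP b.
rewrite surface_g_side surface_f_side src_side_arrow /side_next.
have -> : tgt (side_arrow x) = edge_of (x.1, ordS x.2) by case: x.
by move=> /edge_ofP [<- //|->]; rewrite mateK => -[].
Qed.

End SurfaceQuiver.

(** * The surface of a Brauer graph *)

Section BrauerGluing.
Variable B : brauer_graph.
Local Notation half_edge := (bg_edge B * bool)%type.
Local Notation rot := (@bg_rot B).
Implicit Types h : half_edge.

Definition flip h : half_edge := (h.1, ~~ h.2).

Lemma flipK : involutive flip.
Proof. by case=> i b; rewrite /flip /= negbK. Qed.

Lemma flip_neq h : flip h != h.
Proof. by case: h => i b; rewrite /flip xpair_eqE eqxx /=; case: b. Qed.

(* The orbits of [face_next] are the boundary walks of the faces of the ribbon graph. *)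
Definition face_next h : half_edge := flip (rot h).
Definition face_prev h : half_edge := (rot^-1)%g (flip h).

Lemma face_nextK : cancel face_next face_prev.
Proof. by move=> h; rewrite /face_prev flipK permK. Qed.

Lemma face_prevK : cancel face_prev face_next.
Proof. by move=> h; rewrite /face_next permKV flipK. Qed.

Definition i0 : 'I_3 := Ordinal (isT : 0 < 3)%N.
Definition i1 : 'I_3 := Ordinal (isT : 1 < 3)%N.
Definition i2 : 'I_3 := Ordinal (isT : 2 < 3)%N.

Lemma ord3_cases (k : 'I_3) : [\/ k = i0, k = i1 | k = i2].
Proof.
by case: k => [[|[|[|]]]] //= ?; [apply: Or31 | apply: Or32 | apply: Or33]; apply: val_inj.
Qed.

(* Each face is a polygon, coned off from a centre [c]; its sector at the side [h], which runs from
   [P] to [P'], is divided by an inner point [q] into the triangles [(h, i0)] with sides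
   [PP', P'q, qP], [(h, i1)] with sides [Pq, qc, cP] and [(h, i2)] with sides [P'c, cq, qP']. *)
Definition brauer_mate (x : (half_edge * 'I_3) * 'I_3) : (half_edge * 'I_3) * 'I_3 :=
  let h := x.1.1 in
  match val x.1.2, val x.2 with
  | 0%N, 0%N => ((flip h, i0), i0)
  | 0%N, 1%N => ((h, i2), i2)
  | 0%N, _ => ((h, i1), i0)
  | 1%N, 0%N => ((h, i0), i2)
  | 1%N, 1%N => ((h, i2), i1)
  | 1%N, _ => ((face_prev h, i2), i0)
  | _, 0%N => ((face_next h, i1), i2)
  | _, 1%N => ((h, i1), i1)
  | _, _ => ((h, i0), i1)
  end.

Lemma brauer_mateK : involutive brauer_mate.
Proof.
move=> [[h j] k]; case: (ord3_cases j) => ->; case: (ord3_cases k) => ->;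
  by rewrite /brauer_mate /= ?flipK ?face_nextK ?face_prevK.
Qed.

Lemma brauer_mate_face x : (brauer_mate x).1 != x.1.
Proof.
case: x => [[h j] k]; case: (ord3_cases j) => ->; case: (ord3_cases k) => ->;
  by rewrite /brauer_mate /= xpair_eqE ?andbF ?(negbTE (flip_neq _)).
Qed.

Local Notation adjacent := [rel t1 t2 | [exists k, (brauer_mate (t1, k)).1 == t2]].

Lemma adjacentP t k : connect adjacent t (brauer_mate (t, k)).1.
Proof. by apply: connect1 => /=; apply/existsP; exists k. Qed.

Lemma adjacent_flip h : connect adjacent (h, i0) (flip h, i0).
Proof. exact: (adjacentP (h, i0) i0). Qed.

(** A turn around the common vertex through the sector of [h] and the next one; it ends across the
    edge of [rot h] because [flip (face_next h)] is [rot h]. *)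
Lemma adjacent_rot h : connect adjacent (h, i0) (rot h, i0).
Proof.
have c1 : connect adjacent (h, i0) (h, i2) := adjacentP (h, i0) i1.
have c2 : connect adjacent (h, i2) (face_next h, i1) := adjacentP (h, i2) i0.
have c3 : connect adjacent (face_next h, i1) (face_next h, i0) := adjacentP (face_next h, i1) i0.
have := adjacent_flip (face_next h); rewrite {2}/face_next flipK => c4.
exact: connect_trans c1 (connect_trans c2 (connect_trans c3 c4)).
Qed.

Lemma adjacent_end h h' : bg_end h = bg_end h' -> connect adjacent (h, i0) (h', i0).
Proof.
move=> /esym /eqP; rewrite -bg_rotP => /porbitP [n ->].
elim: n => [|n IH]; first by rewrite expg0 perm1.
by rewrite expgSr permM; apply: connect_trans IH (adjacent_rot _).
Qed.

Lemma adjacent_half_edges h h' : connect adjacent (h, i0) (h', i0).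
Proof.
case/connectP: (bg_connected (bg_end h) (bg_end h')) => c.
elim: c h => [|v c IH] h /=; first by move=> _ /esym; apply: adjacent_end.
move=> /andP [/existsP [i /existsP [b /andP [/eqP hb /eqP vb]]] cP] hE.
apply: connect_trans (adjacent_end (esym hb)) _.
apply: connect_trans (adjacent_flip (i, b)) _.
by apply: IH; rewrite /flip /= vb.
Qed.

Lemma brauer_connect t t' : connect adjacent t t'.
Proof.
have from0 h j : connect adjacent (h, i0) (h, j).
  case: (ord3_cases j) => ->; first exact: connect0.
    exact: (adjacentP (h, i0) i2).
  exact: (adjacentP (h, i0) i1).
have to0 h j : connect adjacent (h, j) (h, i0).
  case: (ord3_cases j) => ->; first exact: connect0.
    exact: (adjacentP (h, i1) i0).
  exact: (adjacentP (h, i2) i2).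
case: t t' => [h j] [h' j'].
exact: connect_trans (to0 h j) (connect_trans (adjacent_half_edges h h') (from0 h' j')).
Qed.

Lemma half_edge0 : half_edge.
Proof. by have /card_gt0P/sigW [i _] := bg_edge_gt0 B; exact: (i, true). Qed.

Definition brauer_gluing : gluing :=
  Gluing brauer_mateK brauer_mate_face brauer_connect (half_edge0, i0).

End BrauerGluing.

(** * The Brauer graph algebra as a corner *)

Section BrauerCorner.
Variables (R : realType) (K : fieldType) (B : brauer_graph).
Local Notation half_edge := (bg_edge B * bool)%type.
Local Notation rot := (@bg_rot B).
Local Notation G := (brauer_gluing B).
Local Notation T := (surf_triangulation R G).
Local Notation o := (@coherent_orientation R G).
Local Notation Q := (surface_quiver o).
Local Notation g := (@surface_g R (surf R G) T o).
Implicit Types h : half_edge.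

(* The arrow that leaves the edge of [h] in the triangle on the face of [h]. *)
Definition half_edge_arrow h : arrow Q := @side_arrow R G ((h, i0), i0).

Definition edge_vertex (i : bg_edge B) : vertex Q :=
  edge_of (G := G) (((i, true), i0), i0).

Lemma edge_vertexP x i : edge_of (G := G) x = edge_vertex i <-> exists b, x = (((i, b), i0), i0).
Proof.
rewrite edge_ofP; split=> [[->|->]|[[] ->]];
  by [exists true | exists false | left | right].
Qed.

Lemma src_half_edge_arrow h : src (half_edge_arrow h) = edge_vertex h.1.
Proof. by rewrite src_side_arrow; apply/edge_vertexP; exists h.2; rewrite -surjective_pairing. Qed.

Lemma edge_vertex_inj : injective edge_vertex.
Proof. by move=> i j /edge_vertexP [b []]. Qed.

Lemma half_edge_arrow_inj : injective half_edge_arrow.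
Proof. by move=> h h' /side_arrow_inj []. Qed.

Lemma g1_half_edge h : g (half_edge_arrow h) = @side_arrow R G ((h, i2), i2).
Proof. by rewrite surface_g_side. Qed.

Lemma g2_half_edge h : g (@side_arrow R G ((h, i2), i2)) =
  @side_arrow R G ((face_next h, i1), i2).
Proof. by rewrite surface_g_side. Qed.

Lemma g3_half_edge h : g (@side_arrow R G ((h, i1), i2)) =
  @side_arrow R G ((h, i0), i2).
Proof. by rewrite surface_g_side. Qed.

Lemma g4_half_edge h : g (@side_arrow R G ((h, i0), i2)) = half_edge_arrow (flip h).
Proof. by rewrite surface_g_side. Qed.

(** The arrow of [h] turns around the end [P'] of the side [h], so [P'] is the point that stands for
    [bg_end h]. The turn meets [P'q] and [P'c] in the sector of [h], then the edge [Pq] of the next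
    sector, before it reaches the edge of [rot h]. *)
Lemma iter4_half_edge h : iter 4 g (half_edge_arrow h) = half_edge_arrow (rot h).
Proof.
by rewrite /= g1_half_edge g2_half_edge g3_half_edge g4_half_edge /face_next flipK.
Qed.

Lemma src_mid_half_edge h j i : (0 < j < 4)%N ->
  src (iter j g (half_edge_arrow h)) <> edge_vertex i.
Proof.
case: j => [|[|[|[|]]]] // _; rewrite ?iterS -[iter 0 _ _]/(half_edge_arrow h) g1_half_edge
  ?g2_half_edge ?g3_half_edge src_side_arrow; by move=> /edge_vertexP [b] /(congr1 snd).
Qed.

Lemma half_edge_arrow_onto (a : arrow Q) i : src a = edge_vertex i ->
  exists h, a = half_edge_arrow h.
Proof.
have [x ->] := side_arrowP a; rewrite src_side_arrow => /edge_vertexP [b ->].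
by exists (i, b).
Qed.

Lemma bar_half_edge h : bar (h : arrow (brauer_quiver B)) = flip h.
Proof.
rewrite /bar; case: pickP => [b /andP [/eqP bh nb]|/(_ (flip h))] /=; last first.
  by rewrite eqxx flip_neq.
move: bh nb; case: b => i b; case: h => j c /= ->; rewrite xpair_eqE eqxx /flip /=.
by case: b; case: c.
Qed.

Lemma bar_half_edge_arrow h : bar (half_edge_arrow h) =
  half_edge_arrow (bar (h : arrow (brauer_quiver B))).
Proof. by rewrite bar_half_edge bar_side_arrow. Qed.

(** Unless the number of steps is a multiple of four, the source is a new edge; so two such arrows
    in one orbit differ by a power of [rot]. This makes the choice in the weight function
    immaterial. *)
Lemma fconnect_half_edge h h' : fconnect g (half_edge_arrow h) (half_edge_arrow h') ->
  bg_end h' = bg_end h.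
Proof.
move=> /iter_findex; set n := findex _ _ _; rewrite (divn_eq n 4) addnC iterD.
have iterq q : iter (q * 4) g (half_edge_arrow h) = half_edge_arrow (iter q rot h).
  by elim: q => // q IH; rewrite mulSn iterD IH iter4_half_edge.
rewrite iterq; case: (posnP (n %% 4)%N) => [->|r0].
  move=> /half_edge_arrow_inj <-; apply/eqP; rewrite -bg_rotP.
  by apply/porbitP; exists (n %/ 4)%N; rewrite permX.
move=> /(congr1 src); rewrite src_half_edge_arrow => /src_mid_half_edge.
by rewrite r0 ltn_mod => /(_ isT).
Qed.

(** The orbits around centres and inner points contain no half-edge arrow and get the weight 1. *)
Definition brauer_weight_fun (O : {set arrow Q}) : nat :=
  if [pick h | half_edge_arrow h \in O] is Some h then bg_mult (bg_end h) else 1%N.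

Lemma brauer_weight_gt0 a : (0 < brauer_weight_fun (g_orbit a))%N.
Proof. by rewrite /brauer_weight_fun; case: pickP => // h _; apply: bg_mult_gt0. Qed.

Definition brauer_weight : weight_function o := WeightFunction brauer_weight_gt0.

Lemma brauer_weight_half_edge h :
  brauer_weight (g_orbit (half_edge_arrow h)) = bg_mult (bg_end h).
Proof.
rewrite /= /brauer_weight_fun; case: pickP => [h'|/(_ h)].
  by rewrite inE => /fconnect_half_edge ->.
by rewrite inE connect0.
Qed.

Lemma g_orbit_g (a : arrow Q) : g_orbit (g a) = g_orbit a.
Proof. by apply/setP => b; rewrite !inE -(same_fconnect1 (@surface_g_inj R G)). Qed.

Lemma brauer_corner : exists e : idempotent_of (surface_algebra K brauer_weight),
  alg_isomorphic (brauer_algebra K B) (corner e).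
Proof.
(* The proof of properness is generalized because its type mentions the relations to be
   rewritten. *)
rewrite /surface_algebra; move: (surface_relations_proper (K := K) (m := brauer_weight)).
rewrite surface_relationsE => proper2.
apply: (@corner_iso K (brauer_quiver B) Q (@brauer_succ B) (@brauer_mult B) g
  (fun a => brauer_weight (g_orbit a)) _ _ _ _ _ _ _ _ edge_vertex half_edge_arrow 4) => //.
- exact: perm_inj.
- by move=> h; rewrite bar_half_edge flip_neq.
- by move=> h; apply: bg_mult_gt0.
- exact: surface_g_inj.
- exact: src_surface_g.
- by move=> a; apply: weight_gt0.
- by move=> a; rewrite g_orbit_g.
- exact: edge_vertex_inj.
- exact: half_edge_arrow_inj.
- exact: src_half_edge_arrow.
- exact: iter4_half_edge.
- exact: src_mid_half_edge.
- exact: half_edge_arrow_onto.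
- exact: brauer_weight_half_edge.
- exact: bar_half_edge_arrow.
Qed.

End BrauerCorner.

Theorem corollary2 (R : realType) (K : closedFieldType) (A : algType K) :
  is_brauer_graph_algebra A ->
  exists (S : topologicalType) (T : triangulation R S) (o : orientation T)
         (m : weight_function o) (e : idempotent_of (surface_algebra K m)),
    [/\ is_surface R S, surface_boundary R S = set0,
        (forall t : tr_face T, ~ self_folded t) &
        alg_isomorphic A (corner e)].
Proof.
move=> [B AB]; have [e eP] := brauer_corner R K B.
exists (surf R (brauer_gluing B)), (surf_triangulation R (brauer_gluing B)).
exists (@coherent_orientation R (brauer_gluing B)), (brauer_weight R B), e.
split; [exact: surf_is_surface | exact: surf_boundary0 | exact: surf_not_self_folded |].
exact: alg_isomorphic_trans AB eP.
Qed.
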